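(* Let $\mathcal{M}^1$ be $\mathbb{R}$ or $\mathbb{S}^1$, and let $\Phi=\{f_e:e\in\mathcal{E}\}$ be a conformal graph directed Markov system on $\mathcal{M}^1$ (in the sense of the context), with associated topologically transitive subshift of finite type $\sigma:\Sigma\to\Sigma$ and coding map $\pi$. Let $\psi:\Sigma\to\mathbb{R}$ be Hölder continuous with $P(\psi)=0$, and let $\nu$ be a Gibbs measure of $\psi$. Define $v:\Sigma\to\mathbb{R}$ by $v(\xi)=\log|f'_{\xi_1}(\pi(\sigma(\xi)))|<0$ for $\xi\in\Sigma$, and $u=-v:\Sigma\to(0,+\infty)$. Then for every $\alpha\ge 0$ with $\alpha\notin\{\alpha^-_{\psi,v},\alpha^+_{\psi,v}\}$, $$\dim_H(\mathcal{UD}^\alpha_\nu)=\dim_u(\mathcal{L}^\alpha_{\psi,v}).$$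
   Context: Setting (conformal graph directed Markov system). $\mathcal{M}^1$ is $\mathbb{R}$ or the unit circle $\mathbb{S}^1$, with Euclidean metric $d_{\mathcal{M}^1}$. $(\mathcal{V},\mathcal{E})$ is a directed graph (multiple edges allowed) with finite vertex set $\mathcal{V}$ and finite edge set $\mathcal{E}$ with at least two edges; $p_-(e),p_+(e)$ are the initial and terminal vertices of $e$. The graph is strongly connected. $\{I_p:p\in\mathcal{V}\}$ is a family of compact intervals of positive length in $\mathcal{M}^1$ with pairwise disjoint interiors. For each $e\in\mathcal{E}$, $f_e:I_{p_+(e)}\to I_{p_-(e)}$ is a contraction; there is $c<1$ with $d_{\mathcal{M}^1}(f_e(x),f_e(y))\le c\,d_{\mathcal{M}^1}(x,y)$ for all $e$ and $x,y\in I_{p_+(e)}$. Each $f_e$ extends to a $C^1$ diffeomorphism (onto its image) on an open neighbourhood $U_e$ of $I_{p_+(e)}$, with $f_e'$ Hölder continuous on $U_e$. Open set condition: $\mathrm{Int}(f_e(I_{p_+(e)}))\cap\mathrm{Int}(f_{e'}(I_{p_+(e')}))=\varnothing$ for distinct $e,e'$. Associated SFT: alphabet $\mathcal{E}$, with $ee'$ allowed iff $p_+(e)=p_-(e')$; words and sequences all of whose consecutive pairs are allowed are called admissible; $\Sigma\subseteq\mathcal{E}^{\mathbb{N}}$ is the set of admissible sequences, $\sigma$ the left shift. For an admissible word $\omega$ of length $n\ge1$: $f_\omega=f_{\omega_1}\circ\cdots\circ f_{\omega_n}$, $I_\omega=f_\omega(I_{p_+(\omega_n)})$; in particular $I_e=f_e(I_{p_+(e)})$.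 The coding map $\pi:\Sigma\to\mathcal{M}^1$ is given by $\{\pi(\xi)\}=\bigcap_{k\ge1}I_{\xi_1\cdots\xi_k}$; the limit set is $J=\pi(\Sigma)$. Symbolic notions: $[\omega]=\{\xi\in\Sigma:\xi_1\cdots\xi_{|\omega|}=\omega\}$, $S_nf=\sum_{k=0}^{n-1}f\circ\sigma^k$, $S_\omega f=\sup_{\xi\in[\omega]}S_{|\omega|}f(\xi)$. With $\xi\wedge\xi'$ the longest common initial block of $\xi\ne\xi'$, $d_1(\xi,\xi')=\exp(-|\xi\wedge\xi'|)$; Hölder continuity on $\Sigma$ is with respect to $d_1$ (some positive exponent). $d_u(\xi,\xi')=\exp(S_{\xi\wedge\xi'}(-u))$ for $\xi\ne\xi'$ is a metric, and $\dim_u(E)$ is the Hausdorff dimension of $E$ in $(\Sigma,d_u)$ ($\dim\varnothing=0$). $P(f)=\lim_{n\to\infty}\frac1n\log\sum_{|\omega|=n}\exp(S_\omega f)$ (sum over admissible words). A Gibbs measure of $f$ is a Borel probability measure $\nu$ on $\Sigma$ for which there is $C\ge1$ with $C^{-1}e^{S_\omega f-|\omega|P(f)}\le\nu([\omega])\le Ce^{S_\omega f-|\omega|P(f)}$ for all non-empty admissible $\omega$. $\mathcal{L}^\alpha_{\psi,v}=\{\xi\in\Sigma:\lim_nS_n\psi(\xi)/S_nv(\xi)=\alpha\}$; $\alpha^-_{\psi,v}=\inf_{\xi\in\Sigma}\liminf_nS_n\psi(\xi)/S_nv(\xi)$, $\alpha^+_{\psi,v}=\sup_{\xi\in\Sigma}\limsup_nS_n\psi(\xi)/S_nv(\xi)$.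 Hölder derivatives: for $x,y\in I_e$, $[x,y]_e$ is the minimal subinterval of $I_e$ containing $x$ and $y$; $\pi_*\nu$ is the pushforward of $\nu$. For $\alpha\ge0$ and $x$ in the interior of $I_e$ (such $e$ is unique), $$\underline{D}^\alpha\pi_*\nu(x)=\lim_{\varepsilon\to0}\inf\Big\{\frac{\pi_*\nu([x,y]_e)}{d_{\mathcal{M}^1}(x,y)^\alpha}:y\in I_e,\ 0<d_{\mathcal{M}^1}(x,y)<\varepsilon\Big\},$$ and $\overline{D}^\alpha\pi_*\nu(x)$ is defined likewise with $\sup$. Then $$\mathcal{UD}^\alpha_\nu=\Big\{x\in J\setminus\bigcup_{e\in\mathcal{E}}\partial I_e:0<\underline{D}^\alpha\pi_*\nu(x)\le\overline{D}^\alpha\pi_*\nu(x)<+\infty\Big\}.$$ $\dim_H$ is Hausdorff dimension in $\mathcal{M}^1$. *)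

(* Defs.v *)
From HB Require Import structures.
From mathcomp Require Import all_boot all_order all_algebra.
From mathcomp Require Import ring lra.
From mathcomp Require Import all_classical all_reals all_analysis.
Set Implicit Arguments.
Unset Strict Implicit.
Unset Printing Implicit Defensive.
Import Order.TTheory GRing.Theory Num.Theory.
Import numFieldNormedType.Exports.
Local Open Scope classical_set_scope.
Local Open Scope ring_scope.

Section distance_functions.
Context {R : realType} {T : Type} (d : T -> T -> R).

Definition open_for : set (set T) :=
  [set A | forall x, A x -> exists2 r, 0 < r & [set y | d x y < r] `<=` A].

Definition hoelder_on (A : set T) (g : T -> R) : Prop :=
  exists beta C, 0 < beta /\
    forall x y, A x -> A y -> `|g x - g y| <= C * d x y `^ beta.

Definition diam (A : set T) : \bar R :=
  ereal_sup [set (d p.1 p.2)%:E | p in A `*` A].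

(* [diam A] to the power [s], with the conventions that the empty set weighs
   0 and that 0 to the power 0 is 1 *)
Definition hausdorff_weight (s : R) (A : set T) : \bar R :=
  if `[< A = set0 >] then 0%E else (diam A `^ s)%E.

Definition hausdorff_content (s delta : R) (A : set T) : \bar R :=
  ereal_inf [set (\sum_(0 <= i <oo) hausdorff_weight s (F i))%E | F in
    [set F : nat -> set T | A `<=` \bigcup_i F i /\
                            forall i, (diam (F i) <= delta%:E)%E]].

Definition hausdorff_measure (s : R) (A : set T) : \bar R :=
  ereal_sup [set hausdorff_content s delta A | delta in [set e | 0 < e]].

Definition hausdorff_dim (A : set T) : \bar R :=
  ereal_inf [set s%:E | s in [set s | 0 <= s /\ hausdorff_measure s A = 0%E]].

End distance_functions.

Section circle.
Variable R : realType.

Definition circle : Type := {z : R * R | z.1 ^+ 2 + z.2 ^+ 2 == 1}.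

HB.instance Definition _ := Choice.on circle.

(* the chordal distance, i.e. the restriction of the Euclidean one *)
Definition circle_dist (z w : circle) : R :=
  Num.sqrt (((val z).1 - (val w).1) ^+ 2 + ((val z).2 - (val w).2) ^+ 2).

Let circle_distxx z : circle_dist z z = 0.
Proof. by rewrite /circle_dist !subrr expr0n addr0 sqrtr0. Qed.

Let circle_dist_positivity z w : circle_dist z w = 0 -> z = w.
Proof.
move=> /eqP; rewrite sqrtr_eq0 => h; apply: val_inj.
case: (val z) (val w) h => [a b] [c e] /= h.
have h1 : (a - c) ^+ 2 = 0.
  by apply/eqP; rewrite eq_le sqr_ge0 andbT (le_trans _ h)// lerDl sqr_ge0.
have h2 : (b - e) ^+ 2 = 0.
  by apply/eqP; rewrite eq_le sqr_ge0 andbT (le_trans _ h)// lerDr sqr_ge0.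
move/eqP: h1; move/eqP: h2.
by rewrite !sqrf_eq0 !subr_eq0 => /eqP -> /eqP ->.
Qed.

Let circle_dist_sym z w : circle_dist z w = circle_dist w z.
Proof.
by rewrite /circle_dist -sqrrN opprB -[X in _ + X]sqrrN opprB.
Qed.

Let circle_dist_triangle y x z :
  circle_dist x z <= circle_dist x y + circle_dist y z.
Proof.
rewrite /circle_dist.
case: (val x) (val y) (val z) => [a b] [c e] [p q] /=.
set A := a - c; set B := b - e; set C := c - p; set D := e - q.
have -> : a - p = A + C by rewrite /A /C; ring.
have -> : b - q = B + D by rewrite /B /D; ring.
set s := Num.sqrt (A ^+ 2 + B ^+ 2); set t := Num.sqrt (C ^+ 2 + D ^+ 2).
have s0 : 0 <= s by exact: sqrtr_ge0.
have t0 : 0 <= t by exact: sqrtr_ge0.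
have s2 : s ^+ 2 = A ^+ 2 + B ^+ 2 by rewrite sqr_sqrtr// addr_ge0 ?sqr_ge0.
have t2 : t ^+ 2 = C ^+ 2 + D ^+ 2 by rewrite sqr_sqrtr// addr_ge0 ?sqr_ge0.
rewrite -[leRHS]ger0_norm ?addr_ge0// -sqrtr_sqr ler_wsqrtr//.
have cs : A * C + B * D <= s * t.
  apply: (le_trans (ler_norm _)).
  rewrite -[leRHS]ger0_norm ?mulr_ge0// -ler_sqr ?nnegrE//.
  rewrite !real_normK ?num_real// exprMn s2 t2 -subr_ge0.
  have -> : (A ^+ 2 + B ^+ 2) * (C ^+ 2 + D ^+ 2) - (A * C + B * D) ^+ 2 =
    (A * D - B * C) ^+ 2 by ring.
  exact: sqr_ge0.
have -> : (s + t) ^+ 2 = s ^+ 2 + t ^+ 2 + 2 * (s * t) by ring.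
rewrite s2 t2 -subr_ge0.
have -> : A ^+ 2 + B ^+ 2 + (C ^+ 2 + D ^+ 2) + 2 * (s * t) -
  ((A + C) ^+ 2 + (B + D) ^+ 2) = 2 * (s * t - (A * C + B * D)) by ring.
by rewrite mulr_ge0// subr_ge0.
Qed.

HB.instance Definition _ := @isMetric.Build R circle circle_dist
  circle_distxx circle_dist_positivity circle_dist_sym circle_dist_triangle.

Let angleP (t : R) : (cos t, sin t).1 ^+ 2 + (cos t, sin t).2 ^+ 2 == 1.
Proof. by rewrite /= cos2Dsin2. Qed.

Definition angle (t : R) : circle :=
  exist (fun z : R * R => z.1 ^+ 2 + z.2 ^+ 2 == 1) _ (angleP t).

End circle.

Variant one_manifold := Line | Circle.

Definition M1 (R : realType) (k : one_manifold) : metricType R :=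
  match k with
  | Line => R^o
  | Circle => circle R
  end.

Section M1.
Context {R : realType} {k : one_manifold}.
Notation M := (M1 R k).

(* the arc-length parametrization *)
Definition par : R -> M :=
  match k return R -> M1 R k with
  | Line => id
  | Circle => @angle R
  end.

(* [par @` `[a, b]] is an interval of the circle only if it does not go all
   the way round *)
Definition simple_arc (a b : R) : Prop := k = Circle -> b - a < 2 * pi.

Definition compact_interval (A : set M) : Prop :=
  exists a b, [/\ a <= b, simple_arc a b & A = par @` `[a, b]].

Definition nondegenerate_interval (A : set M) : Prop :=
  exists a b, [/\ a < b, simple_arc a b & A = par @` `[a, b]].

Definition boundary (A : set M) : set M := closure A `\` A°.

(* [g] is a lift of [f] through [par] near [t]; on the line [par] is the
   identity and this is the usual derivative *)
Definition has_deriv (f : M -> M) (x : M) (a : R) : Prop :=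
  exists (t : R) (g : R -> R),
    [/\ par t = x, \forall s \near t, par (g s) = f (par s) &
        is_derive t 1 g a].

Definition deriv (f : M -> M) (x : M) : R := xget 0 (has_deriv f x).

Definition C1_on (U : set M) (f : M -> M) : Prop :=
  [/\ open U, forall x, U x -> exists a, has_deriv f x a &
      {within U, continuous (deriv f)}].

Definition C1_diffeo_on (U : set M) (f : M -> M) : Prop :=
  C1_on U f /\
  exists g : M -> M, C1_on (f @` U) g /\ forall x, U x -> g (f x) = x.

End M1.

Record digraph := Digraph {
  vertex : finType ;
  edge : finType ;
  init : edge -> vertex ;
  term : edge -> vertex
}.

Definition adjacent (G : digraph) : rel (vertex G) :=
  [rel p q | [exists e : edge G, (init e == p) && (term e == q)]].

Record scgraph := SCGraph {
  scgraph_graph :> digraph ;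
  edge_ge2 : (2 <= #|edge scgraph_graph|)%N ;
  strongly_connected : forall p q, connect (@adjacent scgraph_graph) p q
}.

Section shift_space.
Variable G : scgraph.

Definition Sigma : Type :=
  {xi : nat -> edge G | forall n, term (xi n) = init (xi n.+1)}.

Definition admissible (w : seq (edge G)) : bool :=
  sorted (fun e e' => term e == init e') w.

(* letters are numbered from 0 *)
Definition letter (xi : Sigma) (n : nat) : edge G := sval xi n.

Definition initial_word (xi : Sigma) (n : nat) : seq (edge G) :=
  mkseq (letter xi) n.

Definition left_shift (xi : Sigma) : Sigma :=
  exist (fun xi : nat -> edge G => forall n, term (xi n) = init (xi n.+1))
    (fun n => letter xi n.+1) (fun n => proj2_sig xi n.+1).

Definition cylinder (w : seq (edge G)) : set Sigma :=
  [set xi | initial_word xi (size w) = w].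

(* for [xi <> zeta], the length of the longest common initial block *)
Definition meet_length (xi zeta : Sigma) : nat :=
  xget 0%N [set n | initial_word xi n = initial_word zeta n /\
                    letter xi n <> letter zeta n].

Definition meet (xi zeta : Sigma) : seq (edge G) :=
  initial_word xi (meet_length xi zeta).

Let successor (e : edge G) : exists e', term e = init e'.
Proof.
have /connectP[[|q s] /=] := @strongly_connected G (term e) (init e).
  by move=> _ eq_e; exists e.
by move=> /andP[/existsP[e' /andP[/eqP ie' _]] _] _; exists e'.
Qed.

Let Sigma_inhabited : exists xi : Sigma, True.
Proof.
have [next nextP] := choice successor.
have /card_gt0P[e0 _] : (0 < #|edge G|)%N := ltnW (edge_ge2 G).
pose xi n := iter n next e0.
have xiP n : term (xi n) = init (xi n.+1) by exact: nextP.
by exists (exist _ xi xiP).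
Qed.

HB.instance Definition _ := gen_eqMixin Sigma.
HB.instance Definition _ := gen_choiceMixin Sigma.
HB.instance Definition _ :=
  isPointed.Build Sigma (projT1 (cid Sigma_inhabited)).

End shift_space.

Section thermodynamics.
Context {R : realType} {G : scgraph}.
Notation Sigma := (Sigma G).
Implicit Types (f psi u v : Sigma -> R) (w : seq (edge G)).

Definition birkhoff f (n : nat) (xi : Sigma) : R :=
  \sum_(0 <= i < n) f (iter i (@left_shift G) xi).

Definition sup_birkhoff f w : R :=
  sup [set birkhoff f (size w) xi | xi in cylinder w].

Definition d1 (xi zeta : Sigma) : R :=
  if `[< xi = zeta >] then 0 else expR (- (meet_length xi zeta)%:R).

Definition du u (xi zeta : Sigma) : R :=
  if `[< xi = zeta >] then 0
  else expR (sup_birkhoff (fun z => - u z) (meet xi zeta)).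

Definition pressure f : R :=
  limn (fun n : nat =>
    n%:R^-1 * ln (\sum_(w : n.-tuple (edge G) | admissible w)
                    expR (sup_birkhoff f w))).

Definition borel_Sigma := g_sigma_algebraType (open_for d1).

Definition gibbs psi (nu : set borel_Sigma -> \bar R) : Prop :=
  exists2 C : R, 1 <= C & forall w, w != [::] -> admissible w ->
    let E := expR (sup_birkhoff psi w - (size w)%:R * pressure psi) in
    ((C^-1 * E)%:E <= nu (cylinder w) <= (C * E)%:E)%E.

Definition birkhoff_ratio psi v (xi : Sigma) (n : nat) : R :=
  birkhoff psi n xi / birkhoff v n xi.

Definition level_set psi v (alpha : R) : set Sigma :=
  [set xi | birkhoff_ratio psi v xi n @[n --> \oo] --> alpha].

Definition alpha_minus psi v : \bar R :=
  ereal_inf (range (fun xi => limn_einf (EFin \o birkhoff_ratio psi v xi))).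

Definition alpha_plus psi v : \bar R :=
  ereal_sup (range (fun xi => limn_esup (EFin \o birkhoff_ratio psi v xi))).

End thermodynamics.

(* [branch e] is the extension of the contraction attached to [e] to the
   neighbourhood [nbhd e]; its values outside [nbhd e] are irrelevant *)
Record cgdms (R : realType) (k : one_manifold) := CGDMS {
  cgdms_graph :> scgraph ;
  Ivert : vertex cgdms_graph -> set (M1 R k) ;
  branch : edge cgdms_graph -> M1 R k -> M1 R k ;
  nbhd : edge cgdms_graph -> set (M1 R k) ;
  Ivert_interval : forall p, nondegenerate_interval (Ivert p) ;
  Ivert_disjoint : forall p q, p <> q -> (Ivert p)° `&` (Ivert q)° = set0 ;
  branch_maps : forall e, branch e @` Ivert (term e) `<=` Ivert (init e) ;
  branch_contraction : exists2 c : R, c < 1 &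
    forall e x y, Ivert (term e) x -> Ivert (term e) y ->
      mdist (branch e x) (branch e y) <= c * mdist x y ;
  nbhd_open : forall e, open (nbhd e) ;
  Ivert_nbhd : forall e, Ivert (term e) `<=` nbhd e ;
  branch_diffeo : forall e, C1_diffeo_on (nbhd e) (branch e) ;
  branch_hoelder : forall e, hoelder_on mdist (nbhd e) (deriv (branch e)) ;
  open_set_condition : forall e e', e <> e' ->
    (branch e @` Ivert (term e))° `&` (branch e' @` Ivert (term e'))° = set0
}.

Section limit_set.
Context {R : realType} {k : one_manifold} (Phi : cgdms R k).
Notation M := (M1 R k).
Notation Sigma := (Sigma Phi).

Definition fword (w : seq (edge Phi)) : M -> M :=
  foldr (fun e g => branch e \o g) id w.

(* of interest only for [w] non-empty *)
Definition Iword (w : seq (edge Phi)) : set M :=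
  if w is e :: s then fword w @` Ivert (term (last e s)) else setT.

Definition Iedge (e : edge Phi) : set M := Iword [:: e].

Definition coding (xi : Sigma) : M :=
  xget (par 0) (\bigcap_n Iword (initial_word xi n.+1)).

Definition limit_set : set M := range coding.

Definition geometric_potential (xi : Sigma) : R :=
  ln `|deriv (branch (letter xi 0)) (coding (left_shift xi))|.

Definition segment (e : edge Phi) (x y : M) : set M :=
  \bigcap_(A in [set A | [/\ compact_interval A, A `<=` Iedge e, A x & A y]]) A.

Definition push (nu : set (@borel_Sigma R Phi) -> \bar R) (A : set M)
  : \bar R :=
  nu (coding @^-1` A).

Definition hoelder_quotients nu (alpha : R) (e : edge Phi) (x : M) (eps : R) :=
  [set (push nu (segment e x y) * ((mdist x y `^ alpha)^-1)%:E)%E | y in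
    [set y | Iedge e y /\ 0 < mdist x y < eps]].

Definition lower_deriv nu alpha e x : \bar R :=
  lim (ereal_inf (hoelder_quotients nu alpha e x eps) @[eps --> 0^'+]).

Definition upper_deriv nu alpha e x : \bar R :=
  lim (ereal_sup (hoelder_quotients nu alpha e x eps) @[eps --> 0^'+]).

Definition UD nu (alpha : R) : set M :=
  [set x | (limit_set `\` \bigcup_e boundary (Iedge e)) x /\
    exists e, [/\ (Iedge e)° x, (0 < lower_deriv nu alpha e x)%E,
      (lower_deriv nu alpha e x <= upper_deriv nu alpha e x)%E &
      (upper_deriv nu alpha e x < +oo)%E]].

End limit_set.

(* Main.v *)
Require Import Defs.
From HB Require Import structures.
From mathcomp Require Import all_boot all_order all_algebra.
From mathcomp Require Import ring lra zify.
From mathcomp Require Import all_classical all_reals all_analysis.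
Set Implicit Arguments.
Unset Strict Implicit.
Unset Printing Implicit Defensive.
Import Order.TTheory GRing.Theory Num.Theory.
Import numFieldNormedType.Exports.
Local Open Scope classical_set_scope.
Local Open Scope ring_scope.

(** Coordinates on the intervals [Ivert p] turn the branches into contractions of
compact intervals of the line. By bounded distortion the [n]-th cell around
[coding xi] has length [exp (S_n v xi)] up to a constant factor, and the Gibbs
property gives it mass [exp (S_n psi xi)]; write [phi] for [psi - alpha * v].

Upper bound. Both Hoelder derivatives at [coding xi] being finite and positive,
the mass of a cell is comparable to the power [alpha] of its length, so that
[S_n phi xi] is bounded and [xi] is in the level set. (An atom at [coding xi] forces
[alpha = 0], and one of the at most two codings of this point is then an atom.)
The coding map is Lipschitz from [du u].

Lower bound. Let [0 < r < s < dim_u] of the level set. The words [w] of length [n]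
having a point with [|S_n phi| <= eps * n] satisfy [sum exp (r * S_w v) > exp (delta * n)]
for arbitrarily large [n], with [delta] independent of [eps]; otherwise their
cylinders, which cover the level set, would give it zero [s]-measure. Since
[alpha] lies strictly between [alpha_minus] and [alpha_plus], there are loops along
which [phi] has a large positive, respectively negative, sum. Appending some of them
to these words brings [S phi] back to a bounded value at a cost of [O (eps * n)], less
than the gain [delta * n]; so the words can be concatenated freely into a tree
whose branches have positive [r]-measure and bounded [S_n phi]. Each block also ends
with a word whose cell has neighbours of the same generation on both sides. Hence
every point of a branch sees, at all scales and on both sides, cells of comparable
size and mass; its image is in [UD], and the coding map is bi-Lipschitz on the
branches. *)

(** * Hausdorff measures *)

(** The obstacle lies at the ends of cells. An end may face a gap without mass, or touch a cell of
    unrelated mass, and a point there may have two codings; yet [UD] compares mass with distance on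
    both sides of a point at every scale. All this is cured when a coding reads, with bounded gaps,
    a word [th] whose cell lies between the cells of two words of the same length: these provide
    mass on either side, and all codings of nearby points then agree with the given one up to that
    time. Three distinct words of one length from one vertex suffice to find [th], since intervals
    with disjoint interiors are ordered on the line; the growth of the good words provides them. No
    measure is built on the tree. A node [u] has the weight [exp (r * S_u v)], comparable to the
    [r]-th power of its diameter, and children weigh together at least as much as their parent; so a
    family of nodes lighter in total than the root misses some branch. The gap between [r] and [s]
    is the source of the growth rate that pays for all auxiliary words. *)

Section hausdorff.
Context {R : realType} {T : Type} (d : T -> T -> R).
Implicit Types (A : set T) (s : R).

Lemma diam_le A (c : R) : (forall x y, A x -> A y -> d x y <= c) ->
  (diam d A <= c%:E)%E.
Proof.
by move=> h; apply: ge_ereal_sup => _ [[x y] [/= Ax Ay] <-]; rewrite lee_fin h.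
Qed.

Lemma le_diam A x y : A x -> A y -> ((d x y)%:E <= diam d A)%E.
Proof. by move=> Ax Ay; apply: ereal_sup_ubound; exists (x, y). Qed.

Lemma hausdorff_weight_ge0 s A : (0 <= hausdorff_weight d s A)%E.
Proof.
by rewrite /hausdorff_weight; case: ifP => // _; exact: poweR_ge0.
Qed.

Lemma hausdorff_weight0 s : hausdorff_weight d s set0 = 0%E.
Proof. by rewrite /hausdorff_weight asboolT. Qed.

Lemma hausdorff_weightE s A x : A x ->
  hausdorff_weight d s A = (diam d A `^ s)%E.
Proof.
by move=> Ax; rewrite /hausdorff_weight asboolF// => A0; rewrite A0 in Ax.
Qed.

Lemma hausdorff_measure0P s A : hausdorff_measure d s A = 0%E <->
  forall delta eps : R, 0 < delta -> 0 < eps -> exists F : nat -> set T,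
    [/\ A `<=` \bigcup_i F i, forall i, (diam d (F i) <= delta%:E)%E &
        (\sum_(0 <= i <oo) hausdorff_weight d s (F i) <= eps%:E)%E].
Proof.
split=> [h delta eps delta0 eps0|h].
  have : (hausdorff_content d s delta A < eps%:E)%E.
    apply: (@le_lt_trans _ _ 0%E); last by rewrite lte_fin.
    by rewrite -h; apply: ereal_sup_ubound; exists delta.
  move=> /ereal_inf_lt[_ [F [AF Fd] <-] /ltW Fe].
  by exists F.
apply/eqP; rewrite eq_le; apply/andP; split.
  apply: ge_ereal_sup => _ [delta /= delta0 <-].
  apply/lee_addgt0Pr => eps eps0; rewrite add0e.
  have [F [AF Fd Fe]] := h _ _ delta0 eps0.
  by apply: le_trans Fe; apply: ereal_inf_lbound; exists F.
apply: (@le_trans _ _ (hausdorff_content d s 1 A)).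
  apply: le_ereal_inf_tmp => _ [F _ <-].
  by apply: nneseries_ge0 => i _ _; exact: hausdorff_weight_ge0.
by apply: ereal_sup_ubound; exists 1 => //=.
Qed.

Lemma hausdorff_measure_set0 s : hausdorff_measure d s set0 = 0%E.
Proof.
apply/hausdorff_measure0P => delta eps delta0 eps0.
exists (fun=> set0); split=> //.
  by move=> i; exact: diam_le.
by rewrite eseries0 ?lee_fin ?ltW// => i _ _; exact: hausdorff_weight0.
Qed.

(** Since 0 to the power 0 is 1, each non-empty piece of a cover weighs 1, so a cover of weight 1/2
    has only empty pieces. This settles the exponent 0, which the tree argument, made for [0 < r],
    does not reach. *)
Lemma hausdorff_measure_0_set0 A : hausdorff_measure d 0 A = 0%E -> A = set0.
Proof.
have half0 : 0 < 1 / 2 :> R by lra.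
move=> /hausdorff_measure0P/(_ 1 (1 / 2) ltr01 half0)[F [AF _ Fe]].
rewrite -subset0 => x /AF[i _ Fx]; move: Fe; apply/negP; rewrite -ltNge.
apply: (@lt_le_trans _ _ 1%E); first by rewrite lte_fin; lra.
rewrite (nneseries_split 0 i.+1); last by move=> j _; exact: hausdorff_weight_ge0.
rewrite add0n big_nat_recr//= (hausdorff_weightE _ Fx) poweRe0 -addeA addeCA leeDl//.
rewrite adde_ge0//; last by apply: nneseries_ge0 => j _ _; exact: hausdorff_weight_ge0.
by apply: sume_ge0 => j _; exact: hausdorff_weight_ge0.
Qed.

Lemma hausdorff_dim_gt_measure s A : 0 <= s -> (s%:E < hausdorff_dim d A)%E ->
  hausdorff_measure d s A <> 0%E.
Proof.
move=> s0 + h; apply/negP; rewrite -leNgt.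
by apply: ereal_inf_lbound; exists s.
Qed.

End hausdorff.

(** The Lipschitz map is the inverse of [g], so covers of [A] are pulled back along [g]. For the
    upper bound [g] chooses a coding of each point of [UD]; for the lower bound it is [coding] on
    the branches of the tree. *)
Lemma hausdorff_measure0_transfer {R : realType} {TA TB : Type}
    (dA : TA -> TA -> R) (dB : TB -> TB -> R) (g : TB -> TA)
    (A : set TA) (B : set TB) (C s : R) :
  0 <= s -> 0 < C -> (forall x, 0 <= dA x x) -> (forall x, 0 <= dB x x) ->
  (forall x, B x -> A (g x)) ->
  (forall x y, B x -> B y -> dB x y <= C * dA (g x) (g y)) ->
  hausdorff_measure dA s A = 0%E -> hausdorff_measure dB s B = 0%E.
Proof.
move=> s0 C0 dA0 dB0 gAB lip /hausdorff_measure0P hA.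
apply/hausdorff_measure0P => delta eps delta0 eps0.
have Cs0 : 0 < C `^ s by rewrite powR_gt0.
have [|| F [AF Fd Fe]] := hA (delta / C) (eps / C `^ s); rewrite ?divr_gt0//.
(* The Lipschitz estimate holds on [B] only; pieces that become empty weigh 0 by convention. *)
pose G i := g @^-1` F i `&` B.
have dG i : (diam dB (G i) <= C%:E * diam dA (F i))%E.
  apply: ge_ereal_sup => _ [[x y] [/= [Fx Bx] [Fy By]] <-].
  apply: (@le_trans _ _ (C * dA (g x) (g y))%:E); first by rewrite lee_fin lip.
  by rewrite EFinM lee_pmul2l// le_diam.
exists G; split.
- by move=> x Bx; have [i _ Fi] := AF _ (gAB _ Bx); exists i.
- move=> i; apply: (le_trans (dG i)).
  rewrite (_ : delta = C * (delta / C)); last by rewrite mulrC divfK ?gt_eqF.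
  by rewrite [in leRHS]EFinM lee_pmul2l.
- apply: (@le_trans _ _ (\sum_(0 <= i <oo)
     ((C `^ s)%:E * hausdorff_weight dA s (F i)))%E).
    apply: lee_nneseries => [i _ _|i _]; first exact: hausdorff_weight_ge0.
    have [->|/set0P[x [Fx Bx]]] := eqVneq (G i) set0.
      rewrite hausdorff_weight0; apply: mule_ge0; first by rewrite lee_fin ltW.
      exact: hausdorff_weight_ge0.
    rewrite (hausdorff_weightE _ _ (conj Fx Bx : G i x)).
    have {}Fx : F i (g x) by [].
    rewrite (hausdorff_weightE _ _ Fx).
    have F0 : (0 <= diam dA (F i))%E.
      by rewrite (le_trans _ (le_diam _ Fx Fx))// lee_fin.
    rewrite -poweR_EFin -poweRM ?lee_fin ?(ltW C0)//.
    apply: gt0_ler_poweR => //; rewrite ?in_itv/= ?leey ?andbT.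
      have Gx : G i x by split.
      by rewrite (le_trans _ (le_diam _ Gx Gx))// lee_fin.
    by rewrite mule_ge0// lee_fin ltW.
  rewrite nneseriesZl; last by move=> i _; exact: hausdorff_weight_ge0.
  rewrite (_ : eps = C `^ s * (eps / C `^ s)); last first.
    by rewrite mulrC divfK ?gt_eqF.
  by rewrite [in leRHS]EFinM lee_pmul2l.
Qed.

(** * Words and Birkhoff sums *)

Section words.
Context {G : scgraph}.
Notation Sigma := (Sigma G).
Notation shift := (@left_shift G).
Implicit Types (p q : vertex G) (e : edge G) (u w : seq (edge G)) (xi zeta : Sigma).

(** In contrast with [admissible], the starting vertex is part of the data: concatenation is then
    governed by [walk_end], and the empty word is a walk at every vertex. *)
Fixpoint walk p w : bool :=
  if w is e :: w' then (init e == p) && walk (term e) w' else true.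

Definition walk_end p w : vertex G := last p [seq term e | e <- w].

Definition start xi : vertex G := init (letter xi 0).

Lemma walk_cat p u w : walk p (u ++ w) = walk p u && walk (walk_end p u) w.
Proof. by elim: u p => //= e u IH p; rewrite IH andbA. Qed.

Lemma walk_end_cat p u w : walk_end p (u ++ w) = walk_end (walk_end p u) w.
Proof. by rewrite /walk_end map_cat last_cat. Qed.

Lemma admissible_walk e w : admissible (e :: w) = walk (init e) (e :: w).
Proof.
rewrite /admissible /= eqxx /=; elim: w e => //= e' w IH e.
by rewrite IH eq_sym.
Qed.

Lemma walk_admissible p w : walk p w -> admissible w.
Proof. by case: w => // e w; rewrite admissible_walk /= eqxx => /andP[]. Qed.

Lemma connect_walk p q : exists2 w, walk p w & walk_end p w = q.
Proof.
have /connectP[s sp ->] := strongly_connected p q.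
elim: s p sp => [p _|q' s IH p /= /andP[/existsP[e /andP[pe qe]] qs]]; first by exists [::].
have [w ww wq] := IH _ qs.
exists (e :: w); rewrite /= ?pe ?(eqP qe)//.
by rewrite /walk_end/= (eqP qe).
Qed.

Lemma size_initial_word xi n : size (initial_word xi n) = n.
Proof. by rewrite size_mkseq. Qed.

Lemma letter_iter xi m n : letter (iter m shift xi) n = letter xi (m + n).
Proof. by elim: m xi n => //= m IH xi n; rewrite /letter/= -/(letter _ _) IH addnS. Qed.

Lemma initial_wordD xi m n :
  initial_word xi (m + n) = initial_word xi m ++ initial_word (iter m shift xi) n.
Proof.
apply: (@eq_from_nth _ (letter xi 0)); rewrite ?size_cat ?size_initial_word// => i imn.
rewrite nth_cat size_initial_word nth_mkseq//; case: ltnP => im.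
  by rewrite nth_mkseq.
by rewrite nth_mkseq ?letter_iter ?subnKC// ltn_subLR.
Qed.

Lemma initial_wordS xi n :
  initial_word xi n.+1 = letter xi 0 :: initial_word (shift xi) n.
Proof. exact: (initial_wordD xi 1 n). Qed.

Lemma take_initial_word xi m n : (m <= n)%N ->
  take m (initial_word xi n) = initial_word xi m.
Proof.
by move=> mn; rewrite -(subnKC mn) initial_wordD take_size_cat// size_initial_word.
Qed.

Lemma start_shift xi : start (shift xi) = term (letter xi 0).
Proof. exact/esym/(svalP xi 0). Qed.

Lemma walk_initial_word xi n : walk (start xi) (initial_word xi n).
Proof.
elim: n xi => // n IH xi; rewrite initial_wordS /= eqxx/=.
by rewrite -start_shift; exact: IH.
Qed.

Lemma walk_end_initial_word xi n :
  walk_end (start xi) (initial_word xi n) = start (iter n shift xi).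
Proof.
elim: n xi => // n IH xi; rewrite initial_wordS iterSr -IH.
by rewrite /walk_end/= start_shift.
Qed.

Lemma cylinder_initial_word xi n : cylinder (initial_word xi n) xi.
Proof. by rewrite /cylinder/= size_initial_word. Qed.

Lemma cylinder_cat u w xi : cylinder (u ++ w) xi <->
  cylinder u xi /\ cylinder w (iter (size u) shift xi).
Proof.
rewrite /cylinder/= size_cat initial_wordD; split=> [/eqP|[-> ->//]].
by rewrite eqseq_cat ?size_initial_word// => /andP[/eqP -> /eqP ->].
Qed.

Lemma cylinder_start p w xi : cylinder w xi -> walk p w -> w != [::] -> start xi = p.
Proof.
by case: w => // e w; rewrite /cylinder/= initial_wordS => -[e0 _] /andP[/eqP <- _] _; rewrite /start e0.
Qed.

Lemma cylinder_walk w xi : cylinder w xi -> walk (start xi) w.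
Proof. by move=> <-; exact: walk_initial_word. Qed.

Lemma cylinder_walk_end w xi : cylinder w xi ->
  walk_end (start xi) w = start (iter (size w) shift xi).
Proof. by move=> {1}<-; exact: walk_end_initial_word. Qed.

Lemma Sigma_eq xi zeta : (forall n, letter xi n = letter zeta n) -> xi = zeta.
Proof.
case: xi zeta => x xP [z zP] /= h.
have E : x = z by apply/funext => n; exact: (h n).
by move: zP; rewrite -E => zP; congr exist; exact: Prop_irrelevance.
Qed.

Lemma prepend p w xi : walk p w -> walk_end p w = start xi ->
  exists zeta, [/\ cylinder w zeta, iter (size w) shift zeta = xi & start zeta = p].
Proof.
elim: w p => [p _ ep|e w IH p /= /andP[/eqP ep ew] we].
  by exists xi; split=> //; rewrite -ep.
have [zeta [wz zx sz]] := IH _ ew we.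
have zP n : term (if n is m.+1 then letter zeta m else e) = init (letter zeta n).
  by case: n => [|n]; [rewrite -sz|exact: (svalP zeta n)].
pose eta : Sigma := exist (fun x : nat -> edge G => forall n, term (x n) = init (x n.+1)) _ zP.
have se : shift eta = zeta by exact: Sigma_eq.
exists eta; split => //.
  by rewrite /cylinder/= initial_wordS se wz.
by rewrite -iterS iterSr se.
Qed.

Lemma exists_start p : exists xi, start xi = p.
Proof.
have [w pw we] := connect_walk p (start (point : Sigma)).
by have [xi [_ _ xip]] := prepend pw we; exists xi.
Qed.

Lemma walk_cylinder p w : walk p w -> exists2 xi, cylinder w xi & start xi = p.
Proof.
move=> pw; have [xi xis] := exists_start (walk_end p w).
by have [zeta [wz _ zp]] := prepend pw (esym xis); exists zeta.
Qed.

(** The bound on the sizes makes letter [n] readable in [u n.+1], and later words agree there. *)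
Lemma walks_limit (p : vertex G) (u : nat -> seq (edge G)) :
  (forall n, walk p (u n)) -> (forall n, exists w, u n.+1 = u n ++ w) ->
  (forall n, (n <= size (u n))%N) -> exists xi, forall n, cylinder (u n) xi.
Proof.
move=> pu un su; have [xi0 _] := exists_start p; pose e0 := letter xi0 0.
have mono m n : (m <= n)%N -> exists w, u n = u m ++ w.
  move=> /subnK <-; elim: (n - m)%N => [|i [w E]]; first by exists [::]; rewrite cats0.
  by have [w' E'] := un (i + m)%N; exists (w ++ w'); rewrite addSn E' E catA.
have nthu m n i : (i < size (u m))%N -> (i < size (u n))%N -> nth e0 (u m) i = nth e0 (u n) i.
  wlog mn : m n / (m <= n)%N.
    by move=> h; case: (leqP m n) => [|/ltnW] /h H im iin; [|apply/esym]; exact: H.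
  by move=> im _; have [w ->] := mono _ _ mn; rewrite nth_cat im.
pose x n := nth e0 (u n.+1) n.
have xP n : term (x n) = init (x n.+1).
  have sn : (n.+1 < size (u n.+2))%N by exact: su.
  have := pu n.+2; rewrite -{1}(cat_take_drop n (u n.+2)).
  rewrite (drop_nth e0) ?(drop_nth e0 sn)//; last exact: ltnW.
  rewrite walk_cat/= => /andP[_ /and3P[_ /eqP E _]].
  by rewrite /x (@nthu n.+1 n.+2) ?E// ltnW.
exists (exist (fun x : nat -> edge G => forall n, term (x n) = init (x n.+1)) _ xP) => n.
apply: (@eq_from_nth _ e0); rewrite size_initial_word// => i iu.
by rewrite nth_mkseq// /letter/=; apply: nthu => //; exact: su.
Qed.

(** The vertex is prescribed besides the word because the words flanking [th] are walks from [q],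
    and must be able to replace [th] at the time [j]. *)
Definition recurrent q (th : seq (edge G)) (N : nat) xi := forall n, exists j,
  [/\ (n <= j <= n + N)%N, cylinder th (iter j shift xi) & start (iter j shift xi) = q].

Lemma meet_lengthP xi zeta : xi <> zeta ->
  initial_word xi (meet_length xi zeta) = initial_word zeta (meet_length xi zeta) /\
  letter xi (meet_length xi zeta) <> letter zeta (meet_length xi zeta).
Proof.
move=> ne; pose P n := letter xi n != letter zeta n.
have exP : exists n, P n.
  apply: contrapT => h; apply: ne; apply: Sigma_eq => n.
  by apply/eqP/negPn/negP => Pn; apply: h; exists n.
have : exists n, [set n | initial_word xi n = initial_word zeta n /\
                    letter xi n <> letter zeta n] n.
  exists (ex_minn exP); case: ex_minnP => m /eqP Pm minm; split=> //.
  apply: (@eq_from_nth _ (letter xi 0)); rewrite ?size_initial_word// => i im.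
  rewrite !nth_mkseq//; apply/eqP/negPn/negP => Pi.
  by have := minm _ Pi; rewrite leqNgt im.
by move=> /(xgetPex 0%N).
Qed.

Lemma le_meet_length xi zeta n : xi <> zeta ->
  initial_word xi n = initial_word zeta n -> (n <= meet_length xi zeta)%N.
Proof.
move=> ne E; have [_ l] := meet_lengthP ne; rewrite leqNgt; apply/negP => mn; apply: l.
have := congr1 (fun s => nth (letter xi 0) s (meet_length xi zeta)) E.
by rewrite !nth_mkseq.
Qed.

Lemma meet_length_lt xi zeta n : xi <> zeta ->
  initial_word xi n <> initial_word zeta n -> (meet_length xi zeta < n)%N.
Proof.
move=> ne E; rewrite ltnNge; apply/negP => nm; apply: E.
have [h _] := meet_lengthP ne.
by rewrite -(take_initial_word _ nm) h take_initial_word.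
Qed.

End words.

Section birkhoff.
Context {R : realType} {G : scgraph}.
Notation Sigma := (Sigma G).
Notation shift := (@left_shift G).
Implicit Types (f g : Sigma -> R) (w : seq (edge G)) (xi zeta : Sigma).

Definition bounded_by (M : R) f := forall xi, `|f xi| <= M.

(** Together with [bounded_by], the form in which the regularity of a potential enters the symbolic
    part. For [psi] it comes from Hoelder continuity, for [v] from the geometry of the cells. *)
Definition bounded_distortion (D : R) f := forall n xi zeta,
  initial_word xi n = initial_word zeta n -> `|birkhoff f n xi - birkhoff f n zeta| <= D.

Lemma bounded_by_ge0 M f : bounded_by M f -> 0 <= M.
Proof. by move=> fM; apply: le_trans (fM point). Qed.

Lemma bounded_distortion_ge0 D f : bounded_distortion D f -> 0 <= D.
Proof. by move=> fD; apply: le_trans (fD 0%N point point erefl). Qed.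

Lemma birkhoffD f m n xi :
  birkhoff f (m + n) xi = birkhoff f m xi + birkhoff f n (iter m shift xi).
Proof.
rewrite /birkhoff (@big_cat_nat _ _ _ m)//= ?leq_addr//; congr (_ + _).
rewrite -{1}(add0n m) [in (m + n)%N]addnC big_addn addnK.
by apply: eq_bigr => i _; rewrite iterD.
Qed.

Lemma birkhoff0 f xi : birkhoff f 0 xi = 0.
Proof. by rewrite /birkhoff big_geq. Qed.

Lemma birkhoffS f n xi : birkhoff f n.+1 xi = f xi + birkhoff f n (shift xi).
Proof. by rewrite (birkhoffD f 1 n) /birkhoff big_nat1. Qed.

Lemma birkhoffB_scale f g (a : R) n xi :
  birkhoff (fun z => f z - a * g z) n xi = birkhoff f n xi - a * birkhoff g n xi.
Proof. by rewrite /birkhoff mulr_sumr -sumrB. Qed.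

Lemma birkhoff_le f (m : R) n xi : (forall z, f z <= m) -> birkhoff f n xi <= m * n%:R.
Proof.
move=> fm; elim: n xi => [|n IH] xi; first by rewrite birkhoff0 mulr0.
by rewrite birkhoffS mulrSr mulrDr mulr1 addrC lerD.
Qed.

Lemma norm_birkhoff_le (M : R) f n xi : bounded_by M f -> `|birkhoff f n xi| <= M * n%:R.
Proof.
move=> fM; elim: n xi => [|n IH] xi; first by rewrite birkhoff0 mulr0 normr0.
by rewrite birkhoffS mulrSr mulrDr mulr1 addrC (le_trans (ler_normD _ _))// lerD.
Qed.

Lemma bounded_by_sub_scale f g (M N a : R) : bounded_by M f -> bounded_by N g ->
  bounded_by (M + `|a| * N) (fun z => f z - a * g z).
Proof.
move=> fM gN z; rewrite (le_trans (ler_normB _ _))// lerD// normrM.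
by rewrite ler_wpM2l.
Qed.

Lemma bounded_distortion_sub_scale f g (D E a : R) :
  bounded_distortion D f -> bounded_distortion E g ->
  bounded_distortion (D + `|a| * E) (fun z => f z - a * g z).
Proof.
move=> fD gE n xi zeta h; rewrite !birkhoffB_scale.
have -> (x y z t : R) : x - a * y - (z - a * t) = (x - z) - a * (y - t) by ring.
by rewrite (le_trans (ler_normB _ _))// lerD ?fD// normrM ler_wpM2l// gE.
Qed.

Lemma sup_birkhoff_bounds (M D : R) f w xi : bounded_by M f -> bounded_distortion D f ->
  cylinder w xi ->
  birkhoff f (size w) xi <= sup_birkhoff f w <= birkhoff f (size w) xi + D.
Proof.
move=> fM fD wx; apply/andP; split.
  apply: ub_le_sup; last by exists xi.
  exists (M * (size w)%:R) => _ [z _ <-].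
  by rewrite (le_trans (ler_norm _))// norm_birkhoff_le.
apply: ge_sup; first by exists (birkhoff f (size w) xi), xi.
move=> _ [z wz <-]; rewrite -lerBlDl (le_trans (ler_norm _))//.
by apply: fD; rewrite wz wx.
Qed.

End birkhoff.

Lemma birkhoff_dist_le {R : realType} {G : scgraph} (f : Sigma G -> R) (M : R) (m n N : nat) xi :
  bounded_by M f -> (m <= n <= m + N)%N -> `|birkhoff f n xi - birkhoff f m xi| <= M * N%:R.
Proof.
move=> fM /andP[mn nN]; rewrite -(subnKC mn) birkhoffD addrAC subrr add0r.
apply: (le_trans (norm_birkhoff_le _ _ fM)); rewrite ler_wpM2l//.
  by apply: le_trans (fM xi).
by rewrite ler_nat leq_subLR.
Qed.

Lemma birkhoff_cat_dist {R : realType} {G : scgraph} (f : Sigma G -> R) (M D : R) (k n : nat) xi zeta :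
  bounded_by M f -> bounded_distortion D f -> initial_word xi k = initial_word zeta k ->
  `|birkhoff f (k + n) zeta - birkhoff f k xi| <= D + M * n%:R.
Proof.
move=> fM fD E; rewrite birkhoffD addrAC.
apply: (le_trans (ler_normD _ _)); apply: lerD; first exact: fD.
exact: norm_birkhoff_le.
Qed.

(** The terms of index [i] in the two sums see sequences that agree for [n - i] letters, so their
    difference decays geometrically in [n - i]. *)
Lemma hoelder_d1_regular {R : realType} {G : scgraph} (f : Sigma G -> R) :
  hoelder_on d1 setT f ->
  (exists2 M : R, 0 < M & bounded_by M f) /\ (exists2 D : R, 0 < D & bounded_distortion D f).
Proof.
move=> [beta [C0 [beta0 H0]]]; pose C := `|C0| + 1.
have Cp : 0 < C by rewrite ltr_wpDl.
have d0 (x y : Sigma G) : 0 <= d1 x y :> R.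
  by rewrite /d1; case: asboolP => // _; exact: expR_ge0.
have H (x y : Sigma G) : `|f x - f y| <= C * d1 x y `^ beta.
  apply: (le_trans (H0 x y Logic.I Logic.I)); rewrite ler_wpM2r ?powR_ge0//.
  by rewrite (le_trans (ler_norm _))// /C lerDl.
pose r := expR (- beta).
have r0 : 0 < r by exact: expR_gt0.
have r1 : r < 1 by rewrite /r expR_lt1; lra.
have Hn n (x y : Sigma G) : initial_word x n = initial_word y n -> `|f x - f y| <= C * r ^+ n.
  move=> E; apply: (le_trans (H x y)); rewrite ler_pM2l//.
  rewrite /d1; case: asboolP => [_|ne].
    by rewrite powR0 ?gt_eqF// exprn_ge0// ltW.
  rewrite -expRM /r -expRM_natl ler_expR mulNr mulrN lerN2 ler_pM2r// ler_nat.
  exact: le_meet_length.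
split.
  exists (`|f point| + C); first by rewrite ltr_wpDl.
  move=> x; rewrite -(subrK (f point) (f x)) addrC (le_trans (ler_normD _ _))// lerD2l.
  by have := Hn 0%N x point erefl; rewrite expr0 mulr1.
have rr : 0 < 1 - r by rewrite subr_gt0.
exists (C / (1 - r)); first by rewrite divr_gt0.
(* The bound for [n] letters is a partial sum of the geometric series of ratio [r], which makes the
   induction close. *)
have KE n : C / (1 - r) * (1 - r ^+ n.+1) = C / (1 - r) * (1 - r ^+ n) + C * r ^+ n.
  by rewrite exprS; field; rewrite gt_eqF.
move=> n x y E.
suff : `|birkhoff f n x - birkhoff f n y| <= C / (1 - r) * (1 - r ^+ n).
  move=> /le_trans; apply; rewrite ler_piMr ?divr_ge0 ?(ltW Cp) ?(ltW rr)//.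
  by rewrite gerBl exprn_ge0// ltW.
elim: n x y E => [|n IH] x y E; first by rewrite !birkhoff0 subrr normr0 expr0 subrr mulr0.
rewrite !birkhoffS KE opprD addrACA (le_trans (ler_normD _ _))// [leRHS]addrC.
apply: lerD; last by apply: IH; move: E; rewrite !initial_wordS => -[_ ->].
by apply: (le_trans (Hn _ _ _ E)); rewrite ler_pM2l// exprS ler_piMl ?exprn_ge0 ?ltW.
Qed.

Lemma gibbs_cylinder {R : realType} {G : scgraph} (psi : Sigma G -> R)
    (nu : set (@borel_Sigma R G) -> \bar R) :
  hoelder_on d1 setT psi -> pressure psi = 0 -> gibbs psi nu ->
  exists2 D : R, 0 < D & forall xi n, (0 < n)%N ->
    ((expR (birkhoff psi n xi - D))%:E <= nu (cylinder (initial_word xi n)) <=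
     (expR (birkhoff psi n xi + D))%:E)%E.
Proof.
move=> /hoelder_d1_regular[[M M0 fM] [D D0 fD]] p0 [C C1 H].
have C0 : 0 < C by exact: lt_le_trans C1.
have lnC : 0 <= ln C by exact: ln_ge0.
exists (D + ln C); first by rewrite ltr_pwDl.
move=> xi n n0.
have [w0 aw] : initial_word xi n != [::] /\ admissible (initial_word xi n).
  split; last by apply: walk_admissible; exact: walk_initial_word.
  by rewrite -size_eq0 size_initial_word -lt0n.
have := H _ w0 aw; rewrite p0 mulr0 subr0 => /andP[h1 h2].
have := sup_birkhoff_bounds fM fD (cylinder_initial_word xi n).
rewrite size_initial_word => /andP[s1 s2].
have CE x : C * expR x = expR (x + ln C) by rewrite expRD lnK ?posrE// mulrC.
have CVE x : C^-1 * expR x = expR (x - ln C) by rewrite expRD -lnV ?posrE// lnK ?posrE ?invr_gt0// mulrC.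
rewrite CVE in h1; rewrite CE in h2.
apply/andP; split; [apply: le_trans h1|apply: (le_trans h2)]; rewrite lee_fin ler_expR; lra.
Qed.

(** * Trees of words of large Hausdorff dimension *)

Section sums_over_words.
Context {R : realType} {E : finType}.

Lemma sum_words_le (a : seq E -> R) (s : seq (seq E)) (B : nat) : (forall w, 0 <= a w) ->
  uniq s -> (forall w, w \in s -> (size w < B)%N) ->
  \sum_(w <- s) a w <= \sum_(n < B) \sum_(t : n.-tuple E) a t.
Proof.
move=> a0 us sB.
apply: (@le_trans _ _ (\sum_(w <- s) \sum_(n < B) \sum_(t : n.-tuple E | tval t == w) a w)).
  rewrite big_seq [leRHS]big_seq; apply: ler_sum => w ws.
  rewrite (bigD1 (Ordinal (sB w ws)))//= (bigD1 (in_tuple w))//=.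
  rewrite -addrA lerDl addr_ge0//; last by do 2 (apply: sumr_ge0 => ? _).
  exact: sumr_ge0.
rewrite exchange_big/=; apply: ler_sum => n _.
under eq_bigr do rewrite big_mkcond/=.
rewrite exchange_big/=; apply: ler_sum => t _.
rewrite -big_mkcond/=.
under eq_bigl do rewrite eq_sym.
have [ts|ts] := boolP (tval t \in s).
  rewrite big_mkcond (bigD1_seq (tval t))//= eqxx big1 ?addr0// => w /negbTE wt.
  by rewrite wt.
rewrite big_seq_cond big1// => w /andP[ws /eqP wt].
by move: ts; rewrite -wt ws.
Qed.

(** The sets of a cover are numbered by natural numbers, so words are enumerated by [pickle]; a
    partial sum meets finitely many words, hence words of bounded length. *)
Lemma sum_pickle_words_le (a : seq E -> R) (N : nat) : (forall w, 0 <= a w) ->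
  exists B, \sum_(i < N) oapp a 0 (pickle_inv i) <= \sum_(n < B) \sum_(t : n.-tuple E) a t.
Proof.
move=> a0; pose s : seq (seq E) := pmap pickle_inv (iota 0 N).
exists (\max_(w <- s) size w).+1.
have -> : \sum_(i < N) oapp a 0 (pickle_inv i) = \sum_(w <- s) a w.
  by rewrite big_pmap -(big_mkord xpredT (fun i => oapp a 0 (pickle_inv i))) /index_iota subn0.
apply: sum_words_le => //.
  by apply: (@pmap_uniq _ _ _ pickle); [exact: pickle_invK|exact: iota_uniq].
by move=> w ws; rewrite ltnS; apply: (leq_bigmax_seq w).
Qed.

Lemma geometric_tail_le (x : R) (N B : nat) : 0 < x < 1 ->
  \sum_(n < B | (N <= n)%N) x ^+ n <= x ^+ N / (1 - x).
Proof.
move=> /andP[x0 x1]; have x10 : 0 < 1 - x by rewrite subr_gt0.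
rewrite ler_pdivlMr//.
have [NB|BN] := leqP N B; last first.
  rewrite big1 ?mul0r ?exprn_ge0 ?(ltW x0)// => i Ni.
  by have := ltn_ord i; lia.
suff -> : (\sum_(n < B | (N <= n)%N) x ^+ n) * (1 - x) = x ^+ N - x ^+ B.
  by rewrite gerBl exprn_ge0// ltW.
elim: B NB => [|B IH]; first by rewrite leqn0 => /eqP ->; rewrite big_ord0 mul0r subrr.
rewrite leq_eqVlt => /orP[/eqP ->|]; last rewrite ltnS => NB.
  rewrite big1 ?mul0r ?subrr// => i Ni; have := ltn_ord i; lia.
rewrite big_mkcond big_ord_recr/= -big_mkcond/= NB mulrDl IH// exprS; ring.
Qed.

End sums_over_words.

Lemma near_expr_le {R : realType} (z e : R) : 0 < z < 1 -> 0 < e ->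
  \forall n \near \oo, z ^+ n <= e.
Proof.
move=> /andP[z0 z1] e0; have nz : `|z| < 1 by rewrite gtr0_norm.
have /cvgrPdist_le/(_ _ e0) := @cvg_geometric _ 1 _ nz.
by apply: filterS => n; rewrite /= sub0r normrN mul1r; apply: le_trans (ler_norm _).
Qed.

(** * Growth of the number of good words *)

Section many_good_words.
Context {R : realType} {G : scgraph}.
Notation Sigma := (Sigma G).
Variables (psi v : Sigma -> R) (alpha m Mv Dv : R).
Hypothesis m0 : 0 < m.
Hypothesis vm : forall z, v z <= - m.
Hypothesis vM : bounded_by Mv v.
Hypothesis vD : bounded_distortion Dv v.
Notation du := (du (fun z => - v z)).
Notation phi := (fun z => psi z - alpha * v z).

Definition good (eps : R) (w : seq (edge G)) : bool :=
  `[< exists2 xi, cylinder w xi & `|birkhoff phi (size w) xi| <= eps * (size w)%:R >].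

Lemma du_ge0 (xi zeta : Sigma) : 0 <= du xi zeta.
Proof. by rewrite /Defs.du; case: asboolP => // _; exact: expR_ge0. Qed.

Lemma duE (xi zeta : Sigma) : xi <> zeta -> du xi zeta = expR (sup_birkhoff v (meet xi zeta)).
Proof.
move=> ne; rewrite /Defs.du asboolF//.
by have -> : (fun z => - - v z) = v by apply/funext => x; rewrite opprK.
Qed.

Lemma sup_birkhoff_le (w : seq (edge G)) xi : cylinder w xi ->
  sup_birkhoff v w <= - m * (size w)%:R.
Proof.
move=> wx; apply: ge_sup; first by exists (birkhoff v (size w) xi), xi.
by move=> _ [z _ <-]; exact: birkhoff_le.
Qed.

(** Because [v < 0], extending a word lowers the Birkhoff sums: the supremum over the cylinder of
    [w] dominates that of every longer common block, without a distortion constant. *)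
Lemma du_cylinder_le (w : seq (edge G)) xi zeta : cylinder w xi -> cylinder w zeta ->
  du xi zeta <= expR (sup_birkhoff v w).
Proof.
move=> wx wz; have [->|ne] := pselect (xi = zeta).
  by rewrite /Defs.du asboolT// expR_ge0.
rewrite duE// ler_expR.
have wl : (size w <= meet_length xi zeta)%N by apply: le_meet_length; rewrite // wx wz.
have := cylinder_initial_word xi (meet_length xi zeta); rewrite -/(meet xi zeta) => mx.
apply: ge_sup; first by exists (birkhoff v (size (meet xi zeta)) xi), xi.
move=> _ [eta me <-].
have we : cylinder w eta.
  rewrite /cylinder/= -(take_initial_word eta wl).
  move: me; rewrite /cylinder/= size_initial_word => ->.
  by rewrite /meet take_initial_word.
rewrite size_initial_word -(subnKC wl) birkhoffD.
have /andP[h _] := sup_birkhoff_bounds vM vD we.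
apply: le_trans h; rewrite gerDl.
apply: (le_trans (birkhoff_le _ _ vm)); by rewrite mulNr oppr_le0 mulr_ge0 ?ler0n// ltW.
Qed.

Lemma level_set_good (eps : R) xi : 0 < eps -> level_set psi v alpha xi ->
  \forall n \near \oo, good eps (initial_word xi n).
Proof.
move=> eps0 /cvgrPdist_le xl.
have Mv0 : 0 < Mv.
  rewrite (lt_le_trans m0)// (le_trans _ (vM point))// -normrN (le_trans _ (ler_norm _))//.
  by rewrite lerNr vm.
(* The error of the ratio gets multiplied by [|S_n v|], which is at most [Mv * n]. *)
have e0 : 0 < eps / Mv by rewrite divr_gt0.
have := xl _ e0; apply: filterS2; last exact: (nbhs_infty_gt 0).
move=> n n0; rewrite /birkhoff_ratio distrC => h.
apply/asboolP; exists xi; rewrite ?size_initial_word; first exact: cylinder_initial_word.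
rewrite birkhoffB_scale.
have fn : birkhoff v n xi <= - m * n%:R by exact: birkhoff_le.
have mn : 0 < m * n%:R by rewrite mulr_gt0// ltr0n.
have f0 : birkhoff v n xi < 0 by lra.
have -> : birkhoff psi n xi - alpha * birkhoff v n xi =
    (birkhoff psi n xi / birkhoff v n xi - alpha) * birkhoff v n xi.
  by rewrite mulrBl divfK// lt_eqF.
rewrite normrM (le_trans (ler_wpM2r _ h))//.
rewrite (le_trans (ler_wpM2l (ltW e0) (norm_birkhoff_le n xi vM)))//.
by rewrite mulrA divfK ?gt_eqF.
Qed.

Lemma many_good_words (r s eps : R) (n0 : nat) : 0 <= r -> r < s -> 0 < eps ->
  hausdorff_measure du s (level_set psi v alpha) <> 0%E ->
  exists2 n, (n0 <= n)%N & expR ((s - r) * m / 2 * n%:R) <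
    \sum_(t : n.-tuple (edge G) | good eps t) expR (r * sup_birkhoff v t).
Proof.
move=> r0 rs eps0 Hs; apply: contrapT => none; apply: Hs.
have s0 : 0 < s by exact: le_lt_trans rs.
(* Passing from the exponent [r] to [s] multiplies the term of a word of length [n] by at most
   [exp (- 2 * d * n)]. If the sums with exponent [r] are at most [exp (d * n)], those with exponent
   [s] are dominated by a geometric series of ratio [exp (- d)]. *)
pose d := (s - r) * m / 2.
have d0 : 0 < d by rewrite /d divr_gt0// mulr_gt0// subr_gt0.
have few n : (n0 <= n)%N ->
    \sum_(t : n.-tuple (edge G) | good eps t) expR (r * sup_birkhoff v t) <= expR (d * n%:R).
  by move=> nn; rewrite leNgt; apply/negP => h; apply: none; exists n.
apply/hausdorff_measure0P => delta ep delta0 ep0.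
pose x := expR (- d).
have x0 : 0 < x by exact: expR_gt0.
have x1 : x < 1 by rewrite /x expR_lt1 oppr_lt0.
pose y := expR (- m).
have y0 : 0 < y by exact: expR_gt0.
have y1 : y < 1 by rewrite /y expR_lt1 oppr_lt0.
(* [y ^+ N] bounds the diameters of the cylinders used, [x ^+ N / (1 - x)] their total weight. *)
have [N [Nn0 Ny Nx]] : exists N, [/\ (n0 <= N)%N, y ^+ N <= delta & x ^+ N <= ep * (1 - x)].
  have : \forall N \near \oo, [/\ (n0 <= N)%N, y ^+ N <= delta & x ^+ N <= ep * (1 - x)].
    near=> N; split; near: N; [exact: nbhs_infty_ge| |]; apply: near_expr_le;
      by rewrite ?x0 ?y0// mulr_gt0// subr_gt0.
  by move=> [N _ h]; exists N; apply: h => /=.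
pose chosen w := (N <= size w)%N && good eps w.
pose a w := if chosen w then expR (s * sup_birkhoff v w) else 0.
have a0 w : 0 <= a w by rewrite /a; case: ifP => // _; exact: expR_ge0.
pose C w : set Sigma := if chosen w then cylinder w else set0.
pose F i := oapp C set0 (pickle_inv i : option (seq (edge G))).
have diamC w : chosen w -> (diam du (cylinder w) <= (expR (sup_birkhoff v w))%:E)%E.
  by move=> _; apply: diam_le => xi zeta; exact: du_cylinder_le.
have nonempty w : good eps w -> exists xi, cylinder w xi by move=> /asboolP[xi wx _]; exists xi.
exists F; split.
- move=> xi /(level_set_good eps0) H.
  have [n [Nn gn]] : exists n, (N <= n)%N /\ good eps (initial_word xi n).
    have : \forall n \near \oo, (N <= n)%N /\ good eps (initial_word xi n).
      by near=> n; split; near: n => //; exact: nbhs_infty_ge.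
    by move=> [n _ h]; exists n; apply: h => /=.
  exists (pickle (initial_word xi n)) => //; rewrite /F pickleK_inv /= /C /chosen.
  by rewrite size_initial_word Nn gn /=; exact: cylinder_initial_word.
- move=> i; rewrite /F; case: pickle_inv => [w|]/=; last by apply: diam_le.
  rewrite /C; case: ifPn => [cw|_]; last by apply: diam_le.
  apply: (le_trans (diamC w cw)); have /andP[Nw gw] := cw; have [xi wx] := nonempty w gw.
  rewrite lee_fin (le_trans _ Ny)// -expRM_natl ler_expR (le_trans (sup_birkhoff_le wx))//.
  by rewrite mulNr mulrN lerN2 mulrC ler_pM2l// ler_nat.
have Fa i : (hausdorff_weight du s (F i) <= (oapp a 0 (pickle_inv i))%:E)%E.
  rewrite /F; case: pickle_inv => [w|]/=; last by rewrite hausdorff_weight0.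
  rewrite /C /a; case: ifPn => [cw|_]; last by rewrite hausdorff_weight0.
  have /andP[Nw gw] := cw; have [xi wx] := nonempty w gw.
  have dd : (0 <= diam du (cylinder w))%E.
    by rewrite (le_trans _ (le_diam _ wx wx))// lee_fin du_ge0.
  rewrite (hausdorff_weightE _ _ wx).
  apply: (@le_trans _ _ ((expR (sup_birkhoff v w))%:E `^ s)%E).
    apply: gt0_ler_poweR; rewrite ?(ltW s0) ?in_itv/= ?leey ?andbT ?lee_fin ?expR_ge0//.
    exact: diamC.
  by rewrite poweR_EFin -expRM mulrC.
apply: (@le_trans _ _ (\sum_(0 <= i <oo) (oapp a 0 (pickle_inv i))%:E)%E).
  by apply: lee_nneseries => // i _ _; exact: hausdorff_weight_ge0.
apply: lime_le.
  apply: is_cvg_nneseries => i _ _; rewrite lee_fin.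
  by case: pickle_inv => //= w.
near=> j; rewrite sumEFin lee_fin big_mkord.
have [B hB] := sum_pickle_words_le j a0.
apply: (le_trans hB).
apply: (@le_trans _ _ (\sum_(n < B | (N <= n)%N) x ^+ n)); last first.
  apply: (le_trans (@geometric_tail_le _ x N B _)); first by rewrite x0.
  by rewrite ler_pdivrMr// subr_gt0.
rewrite [leRHS]big_mkcond; apply: ler_sum => n _; case: ifPn => Nn; last first.
  rewrite big1// => t _; rewrite /a /chosen size_tuple (negbTE Nn)//.
apply: (@le_trans _ _ (x ^+ n * x ^+ n * expR (d * n%:R))); last first.
  rewrite /x -expRM_natl -mulrA -expRD mulrN (mulrC d) addNr expR0 mulr1//.
apply: (@le_trans _ _ (x ^+ n * x ^+ n *
    \sum_(t : n.-tuple (edge G) | good eps t) expR (r * sup_birkhoff v t))); last first.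
  by rewrite ler_pM2l ?mulr_gt0 ?exprn_gt0//; apply: few; exact: leq_trans Nn.
rewrite mulr_sumr [leRHS]big_mkcond; apply: ler_sum => t _.
rewrite /a /chosen size_tuple Nn/=; case: ifPn => // gt.
have [xi wx] := nonempty _ gt.
rewrite /x -expRM_natl -!expRD ler_expR.
have := sup_birkhoff_le wx; rewrite size_tuple => h.
have : (s - r) * sup_birkhoff v t <= (s - r) * (- m * n%:R).
  by rewrite ler_wpM2l// subr_ge0 ltW.
rewrite /d; lra.
Unshelve. all: by end_near. Qed.

End many_good_words.

(** * A mass distribution principle for trees of words *)

Section trees_of_words.
Context {R : realType} {G : scgraph}.
Notation Sigma := (Sigma G).
Notation word := (seq (edge G)).
Variables (I : finType) (W : pred I) (ext : word -> I -> word) (q : vertex G) (N0 : nat).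
Variables (Inv : word -> Prop) (v : Sigma -> R) (r m Mv Dv : R).
Notation wt u := (expR (r * sup_birkhoff v u)).
Notation du := (du (fun z => - v z)).
Hypothesis Inv0 : Inv [::].
Hypothesis InvS : forall u i, Inv u -> W i -> Inv (u ++ ext u i).
Hypothesis Inv_walk : forall u, Inv u -> walk q u.
Hypothesis ext_size : forall u i, Inv u -> W i -> (0 < size (ext u i) <= N0)%N.
Hypothesis ext_disjoint : forall u i j xi, Inv u -> W i -> W j ->
  cylinder (u ++ ext u i) xi -> cylinder (u ++ ext u j) xi -> i = j.
Hypothesis wt_children : forall u, Inv u -> wt u <= \sum_(i | W i) wt (u ++ ext u i).

Fixpoint node (f : nat -> I) (j : nat) : word :=
  if j is j'.+1 then node f j' ++ ext (node f j') (f j') else [::].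

Definition branches : set Sigma :=
  [set xi | exists f, (forall j, W (f j)) /\ forall j, cylinder (node f j) xi].

Lemma Inv_node f j : (forall j, W (f j)) -> Inv (node f j).
Proof. by move=> Wf; elim: j => //= j IH; exact: InvS. Qed.

Lemma size_node f j : (forall j, W (f j)) -> (j <= size (node f j))%N.
Proof.
move=> Wf; elim: j => //= j IH; rewrite size_cat.
have /andP[h _] := ext_size (Inv_node j Wf) (Wf j); lia.
Qed.

Lemma size_nodeS f j : (forall j, W (f j)) -> (size (node f j.+1) <= size (node f j) + N0)%N.
Proof.
move=> Wf /=; rewrite size_cat leq_add2l.
by have /andP[_ h] := ext_size (Inv_node j Wf) (Wf j).
Qed.

Lemma node_unique f f' j xi : (forall j, W (f j)) -> (forall j, W (f' j)) ->
  cylinder (node f j) xi -> cylinder (node f' j) xi -> node f j = node f' j.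
Proof.
move=> Wf Wf'; elim: j => //= j IH c c'.
have E : node f j = node f' j.
  by apply: IH; [move: c|move: c'] => /cylinder_cat[].
rewrite -E in c' *; congr (_ ++ ext _ _).
exact: ext_disjoint (Inv_node j Wf) _ _ c c'.
Qed.

Section avoiding.
Variables (P : pred nat) (c : nat -> word).
Hypothesis cP : forall i, P i -> exists f j, (forall j, W (f j)) /\ c i = node f j.

Let M u : \bar R :=
  (\sum_(0 <= i <oo) (if P i && prefix u (c i) then (wt (c i))%:E else 0))%E.

Let M_ge0 (u : word) i : (0 <= (if P i && prefix u (c i) then (wt (c i))%:E else 0))%E.
Proof. by case: ifP => // _; rewrite lee_fin expR_ge0. Qed.

Let c_cylinder i : P i -> exists xi, cylinder (c i) xi.
Proof.
move=> /cP[f [j [Wf ->]]].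
by have [xi h _] := walk_cylinder (Inv_walk (Inv_node j Wf)); exists xi.
Qed.

(** The cylinders of the children are disjoint, so a selected node extends at most one of them. *)
Let M_children u : Inv u -> (\sum_(i | W i) M (u ++ ext u i) <= M u)%E.
Proof.
move=> uI; rewrite -nneseries_sum; last by move=> i j _; exact: M_ge0.
apply: lee_nneseries => [j _ _|j _]; first by apply: sume_ge0 => i _; exact: M_ge0.
have [/existsP[i0 /and3P[W0 Pj pj]]|none] :=
    boolP [exists i, [&& W i, P j & prefix (u ++ ext u i) (c j)]].
  rewrite (bigD1 i0)//= Pj pj /= big1 ?adde0.
    case/prefixP: pj => s ->; rewrite -catA (_ : prefix _ _)//; exact: prefix_prefix.
  move=> i /andP[Wi ii0]; case: ifPn => // pj'.
  have [xi xc] := c_cylinder Pj.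
  case/eqP: ii0; apply: (ext_disjoint uI Wi W0 (xi := xi)).
    by case/prefixP: pj' xc => s -> /cylinder_cat[].
  by case/prefixP: pj xc => s -> /cylinder_cat[].
rewrite big1 ?M_ge0// => i Wi; case: ifPn => // /andP[Pj pj].
by case/negP: none; apply/existsP; exists i; rewrite Wi Pj.
Qed.

Let M_step u : Inv u -> (M u < (wt u)%:E)%E ->
  exists i, W i /\ (M (u ++ ext u i) < (wt (u ++ ext u i))%:E)%E.
Proof.
move=> uI Mu; apply: contrapT => none; move: Mu; apply/negP; rewrite -leNgt.
apply: le_trans (M_children uI).
apply: (@le_trans _ _ (\sum_(i | W i) (wt (u ++ ext u i))%:E)%E).
  by rewrite sumEFin lee_fin wt_children.
apply: lee_sum => i Wi; rewrite leNgt; apply/negP => h.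
by apply: none; exists i.
Qed.

(** If [M u < wt u], then [M_children] and [wt_children] give a child with the same strict
    inequality. A branch made of such children passes through no selected node [c i], because
    [M (c i)] is at least [wt (c i)]. *)
Lemma branch_avoiding :
  (\sum_(0 <= i <oo) (if P i then (wt (c i))%:E else 0) < (wt [::])%:E)%E ->
  exists2 xi, branches xi & forall i, P i -> ~ cylinder (c i) xi.
Proof.
move=> small.
have M0 : (M [::] < (wt [::])%:E)%E.
  apply: le_lt_trans small; rewrite le_eqVlt; apply/orP; left; apply/eqP.
  by apply: eq_eseriesr => i _; rewrite prefix0s andbT.
have [g gP] : exists g : word -> I, forall u, Inv u /\ (M u < (wt u)%:E)%E ->
    W (g u) /\ (M (u ++ ext u (g u)) < (wt (u ++ ext u (g u)))%:E)%E.
  have H u : exists i, Inv u /\ (M u < (wt u)%:E)%E ->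
      W i /\ (M (u ++ ext u i) < (wt (u ++ ext u i))%:E)%E.
    have [[uI Mu]|n] := pselect (Inv u /\ (M u < (wt u)%:E)%E).
      by have [i h] := M_step uI Mu; exists i.
    have [i _] := M_step Inv0 M0.
    by exists i.
  by have [g gP] := choice H; exists g.
pose T := fix T j := if j is j'.+1 then T j' ++ ext (T j') (g (T j')) else [::] : word.
have TP j : Inv (T j) /\ (M (T j) < (wt (T j))%:E)%E.
  by elim: j => //= j IH; have [Wg Mg] := gP _ IH; split=> //; apply: InvS => //; case: IH.
pose f j := g (T j).
have Wf j : W (f j) by have [] := gP _ (TP j).
have nT j : node f j = T j by elim: j => //= j ->.
have [|||xi xc] := @walks_limit G q (node f).
- by move=> j; exact/Inv_walk/Inv_node.
- by move=> j; eexists.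
- by move=> j; exact: size_node.
exists xi; first by exists f.
move=> i Pi ci; have [f' [j [Wf' cE]]] := cP Pi.
have := (TP j).2; apply/negP; rewrite -leNgt -nT.
have E : node f j = c i by rewrite cE; apply: node_unique => //; rewrite -cE.
rewrite /M (nneseries_split 0 i.+1); last by move=> *; exact: M_ge0.
rewrite add0n big_nat_recr//= E Pi /= (_ : prefix (c i) (c i)); last exact: prefix_refl.
rewrite -addeA addeCA leeDl// adde_ge0//.
  by apply: sume_ge0 => l _; exact: M_ge0.
by apply: nneseries_ge0 => l _ _; exact: M_ge0.
Qed.

End avoiding.

Hypothesis m0 : 0 < m.
Hypothesis r0 : 0 < r.
Hypothesis vm : forall z, v z <= - m.
Hypothesis vM : bounded_by Mv v.
Hypothesis vD : bounded_distortion Dv v.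

(** A covering set is traded for the last node, on the branch of one of its points, that contains
    all its points lying on branches. The next node separates two points of [F] and is at most [N0]
    letters longer, so their distance is comparable to [exp (S_u v)]. If no node ever separates, a
    deep node of weight at most [e] serves. *)
Lemma node_cover (F : set Sigma) (e : R) : 0 < e -> (exists2 xi, branches xi & F xi) ->
  (diam du F <= 1%:E)%E ->
  exists u, [/\ exists f j, (forall j, W (f j)) /\ u = node f j,
    forall zeta, branches zeta -> F zeta -> cylinder u zeta &
    ((wt u)%:E <= (expR (r * (Dv + Mv * N0%:R)))%:E * hausdorff_weight du r F + e%:E)%E].
Proof.
move=> e0 [xi [f [Wf xf]] Fxi] F1.
pose Q j := `[< forall zeta, branches zeta -> F zeta -> cylinder (node f j) zeta >].
have Cw0 : (0 <= (expR (r * (Dv + Mv * N0%:R)))%:E * hausdorff_weight du r F)%E.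
  by rewrite mule_ge0// ?lee_fin ?expR_ge0// hausdorff_weight_ge0.
have wt_small j : wt (node f j) <= expR (- (r * m)) ^+ j.
  rewrite -expRM_natl ler_expR.
  have h1 := sup_birkhoff_le vm (xf j).
  have h2 : m * j%:R <= m * (size (node f j))%:R.
    by rewrite ler_pM2l// ler_nat; exact: size_node.
  have h3 : sup_birkhoff v (node f j) <= - (m * j%:R) by lra.
  have := ler_wpM2l (ltW r0) h3; lra.
have [allQ|] := pselect (forall j, Q j).
  have [|j _ /(_ j (leqnn j)) je] := @near_expr_le R (expR (- (r * m))) e _ e0.
    by rewrite expR_gt0 expR_lt1 oppr_lt0 mulr_gt0.
  exists (node f j); split; [by exists f, j|by move: (allQ j) => /asboolP|].
  rewrite -[leLHS]add0e leeD// lee_fin; exact: le_trans je.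
move=> /existsNP nQ.
have ex : exists j, ~~ Q j by have [j /negP] := nQ; exists j.
case: (ex_minnP ex) => -[|j] nQj minj.
  by case/negP: nQj; apply/asboolP => zeta _ _.
have Qj : Q j by apply: contrapT => /negP /minj; rewrite ltnn.
exists (node f j); split; [by exists f, j|by move: Qj => /asboolP|].
have [zeta [Fz nz]] : exists zeta, F zeta /\ ~ cylinder (node f j.+1) zeta.
  apply: contrapT => h; case/negP: nQj; apply/asboolP => zeta _ Fz.
  by apply: contrapT => n; apply: h; exists zeta.
have xz : xi <> zeta by move=> E; apply: nz; rewrite -E.
have ml : (meet_length xi zeta < size (node f j.+1))%N.
  apply: meet_length_lt => // E; apply: nz; rewrite /cylinder/= -E; exact: xf.
have mlN : (meet_length xi zeta <= size (node f j) + N0)%N.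
  by rewrite (leq_trans (ltnW ml))//; exact: size_nodeS.
have v0 z : v z <= 0 by rewrite (le_trans (vm z))// oppr_le0 ltW.
have Mv0 := bounded_by_ge0 vM.
have key : sup_birkhoff v (node f j) <= sup_birkhoff v (meet xi zeta) + (Dv + Mv * N0%:R).
  have /andP[_ h1] := sup_birkhoff_bounds vM vD (xf j).
  have := sup_birkhoff_bounds vM vD (cylinder_initial_word xi (meet_length xi zeta)).
  rewrite size_initial_word -/(meet xi zeta) => /andP[h2 _].
  have h3 : birkhoff v (size (node f j)) xi - Mv * N0%:R <= birkhoff v (meet_length xi zeta) xi.
    have [le|lt] := leqP (size (node f j)) (meet_length xi zeta).
      have := norm_birkhoff_le (meet_length xi zeta - size (node f j))
        (iter (size (node f j)) (@left_shift G) xi) vM.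
      rewrite -{3}(subnKC le) birkhoffD ler_norml => /andP[h _].
      have : Mv * (meet_length xi zeta - size (node f j))%:R <= Mv * N0%:R.
        by rewrite ler_wpM2l// ler_nat leq_subLR.
      lra.
    rewrite -(subnKC (ltnW lt)) birkhoffD.
    have := birkhoff_le (size (node f j) - meet_length xi zeta)
      (iter (meet_length xi zeta) (@left_shift G) xi) v0.
    rewrite mul0r; have : 0 <= Mv * N0%:R by rewrite mulr_ge0.
    lra.
  lra.
rewrite -[leLHS]adde0 leeD// ?lee_fin ?(ltW e0)//.
rewrite (hausdorff_weightE _ _ Fxi).
apply: (@le_trans _ _ ((expR (r * (Dv + Mv * N0%:R)))%:E * (du xi zeta)%:E `^ r)%E).
  rewrite poweR_EFin -EFinM lee_fin duE// -expRM -expRD ler_expR.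
  have := ler_wpM2l (ltW r0) key; lra.
rewrite lee_pmul2l ?lte_fin ?expR_gt0//.
apply: gt0_ler_poweR; rewrite ?(ltW r0) ?in_itv/= ?leey ?andbT ?lee_fin ?du_ge0//.
  by rewrite (le_trans _ (le_diam _ Fxi Fxi))// lee_fin du_ge0.
exact: le_diam.
Qed.

Lemma hausdorff_measure_branches_neq0 : hausdorff_measure du r branches <> 0%E.
Proof.
move=> /hausdorff_measure0P H.
pose C := expR (r * (Dv + Mv * N0%:R)).
have C0 : 0 < C by exact: expR_gt0.
(* The nodes replacing the cover weigh at most [C / (4 * C)] plus errors of sum 1/2, that is 3/4,
   less than the root, which weighs at least 1. *)
have e0 : 0 < (4 * C)^-1 by rewrite invr_gt0 mulr_gt0.
have [F [FK F1 Fe]] := H 1 _ ltr01 e0.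
pose P i := `[< exists2 xi, branches xi & F i xi >].
have cover i : exists u, P i -> [/\ exists f j, (forall j, W (f j)) /\ u = node f j,
    forall zeta, branches zeta -> F i zeta -> cylinder u zeta &
    ((wt u)%:E <= C%:E * hausdorff_weight du r (F i) + ((1 / 2) / (2 ^ i.+1)%:R)%:E)%E].
  have [/asboolP Pi|n] := boolP (P i); last by exists [::].
  have p0 : 0 < (1 / 2) / (2 ^ i.+1)%:R :> R by rewrite divr_gt0// ltr0n expn_gt0.
  by have [u h] := node_cover p0 Pi (F1 i); exists u.
have [c cP] := choice cover.
have Cw0 i : (0 <= C%:E * hausdorff_weight du r (F i))%E.
  by rewrite mule_ge0// ?lee_fin ?(ltW C0)// hausdorff_weight_ge0.
have small : (\sum_(0 <= i <oo) (if P i then (wt (c i))%:E else 0) < (wt [::])%:E)%E.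
  apply: (@le_lt_trans _ _ (3 / 4)%:E).
    apply: (@le_trans _ _ (\sum_(0 <= i <oo)
        (C%:E * hausdorff_weight du r (F i) + ((1 / 2) / (2 ^ i.+1)%:R)%:E))%E).
      apply: lee_nneseries => [i _ _|i _].
        by case: ifP => // _; rewrite lee_fin expR_ge0.
      case: ifPn => [/cP[]//|_]; rewrite adde_ge0// lee_fin divr_ge0//.
    apply: (le_trans (epsilon_trick xpredT Cw0 _)) => //.
    rewrite nneseriesZl; last by move=> i _; exact: hausdorff_weight_ge0.
    apply: (@le_trans _ _ (C%:E * ((4 * C)^-1)%:E + (1 / 2)%:E)%E).
      by rewrite leeD2r// lee_pmul2l.
    rewrite -EFinM -EFinD lee_fin.
    have -> : C * (4 * C)^-1 = 1 / 4 by field; rewrite gt_eqF.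
    lra.
  rewrite lte_fin; apply: (@lt_le_trans _ _ 1); first by lra.
  rewrite -expR0 ler_expR mulr_ge0 ?(ltW r0)//.
  have := sup_birkhoff_bounds vM vD (cylinder_initial_word (point : Sigma) 0).
  by rewrite size_initial_word birkhoff0 => /andP[].
have [|xi xK avoid] := branch_avoiding (P := P) (c := c) _ small; first by move=> i /cP[].
have [i _ Fi] := FK _ xK.
have Pi : P i by apply/asboolP; exists xi.
by apply: (avoid i Pi); have [_ h _] := cP i Pi; exact: h.
Qed.

End trees_of_words.

Lemma lt_limn_einf {R : realType} (u : nat -> R) (a : R) :
  (limn_einf (EFin \o u) < a%:E)%E ->
  exists2 b, b < a & forall N, exists2 n, (N <= n)%N & u n < b.
Proof.
move=> ua; have [b ba ub] : exists2 b : R, b < a & (limn_einf (EFin \o u) < b%:E)%E.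
  move: ua; case: (limn_einf _) => [l| |].
  - rewrite lte_fin => la; exists ((l + a) / 2); rewrite ?lte_fin; lra.
  - by rewrite ltNge leey.
  - by move=> _; exists (a - 1); rewrite ?ltNyr//; lra.
exists b => // N; apply: contrapT => none; move: ub; apply/negP; rewrite -leNgt.
rewrite limn_einf_lim; apply: lime_ge; first exact: is_cvg_einfs.
near=> n; apply: le_ereal_inf_tmp => _ [j /= nj <-].
rewrite lee_fin leNgt; apply/negP => h; apply: none; exists j => //.
by apply: leq_trans nj; near: n; exact: nbhs_infty_ge.
Unshelve. all: by end_near. Qed.

Lemma exists_natr_ge {R : realType} (C a : R) : 0 < a ->
  exists N, forall n, (N <= n)%N -> C <= a * n%:R.
Proof.
move=> a0; have : \forall n \near \oo, C / a <= n%:R by exact: nbhs_infty_ger.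
by move=> [N _ h]; exists N => n /h; rewrite /= ler_pdivrMr// mulrC.
Qed.

(** * Large positive and negative sums of phi *)

Section unbounded_sums.
Context {R : realType} {G : scgraph}.
Notation Sigma := (Sigma G).

Lemma birkhoffN (f : Sigma -> R) n xi : birkhoff (fun z => - f z) n xi = - birkhoff f n xi.
Proof. by rewrite /birkhoff sumrN. Qed.

(** The denominator is negative, so a ratio below [b < alpha] makes [S_n phi] at least
    [(alpha - b) * m * n]: small ratios give large positive sums. *)
Lemma unbounded_above (psi v : Sigma -> R) (alpha m : R) xi : 0 < m ->
  (forall z, v z <= - m) -> (limn_einf (EFin \o birkhoff_ratio psi v xi) < alpha%:E)%E ->
  forall X, exists n, X <= birkhoff psi n xi - alpha * birkhoff v n xi.
Proof.
move=> m0 vm /lt_limn_einf[b ba H] X.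
have c0 : 0 < (alpha - b) * m by rewrite mulr_gt0// subr_gt0.
have [N NX] := exists_natr_ge X c0; have [n nN un] := H N.+1; exists n.
have n0 : (0 < n)%N by exact: leq_trans nN.
have fn : birkhoff v n xi <= - m * n%:R by exact: birkhoff_le.
have mn : 0 < m * n%:R by rewrite mulr_gt0// ltr0n.
have f0 : birkhoff v n xi < 0 by lra.
have h1 : b * birkhoff v n xi <= birkhoff psi n xi.
  by rewrite -ler_ndivrMr// ltW.
have h2 : (alpha - b) * (m * n%:R) <= (alpha - b) * - birkhoff v n xi.
  by rewrite ler_wpM2l ?subr_ge0 ?(ltW ba)//; lra.
have := NX n (ltnW nN); lra.
Qed.

(** A point of the level set puts [alpha] between the two extremes, and the exclusions make both
    inequalities strict. The upper extreme is reduced to the lower one by changing the signs of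
    [psi] and [alpha]. *)
Lemma unbounded_both (psi v : Sigma -> R) (alpha m : R) : 0 < m ->
  (forall z, v z <= - m) -> level_set psi v alpha !=set0 ->
  alpha%:E <> alpha_minus psi v -> alpha%:E <> alpha_plus psi v ->
  (exists xi, forall X, exists n, X <= birkhoff psi n xi - alpha * birkhoff v n xi) /\
  (exists xi, forall X, exists n, birkhoff psi n xi - alpha * birkhoff v n xi <= - X).
Proof.
move=> m0 vm [xi0 xi0l] am ap.
have cv : (EFin \o birkhoff_ratio psi v xi0) x @[x --> \oo] --> alpha%:E.
  by apply: cvg_EFin => //; near=> n.
have [e1 e2] := cvg_limn_einf_sup cv.
have lt1 : (alpha_minus psi v < alpha%:E)%E.
  rewrite lt_neqAle; apply/andP; split; first by apply/eqP => h; exact: am (esym h).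
  by rewrite -e1; apply: ereal_inf_lbound; exists xi0.
have lt2 : (alpha%:E < alpha_plus psi v)%E.
  rewrite lt_neqAle; apply/andP; split; first exact/eqP.
  by rewrite -e2; apply: ereal_sup_ubound; exists xi0.
split.
  have [_ [xi _ <-] h] := ereal_inf_lt lt1; exists xi; exact: (unbounded_above m0 vm h).
have [_ [xi _ <-] h] := ereal_sup_gt lt2; exists xi => X.
pose npsi z := - psi z.
have : (limn_einf (EFin \o birkhoff_ratio npsi v xi) < (- alpha)%:E)%E.
  have -> : EFin \o birkhoff_ratio npsi v xi =
      (fun x => (- x)%E) \o (EFin \o birkhoff_ratio psi v xi).
    by apply/funext => n /=; rewrite /birkhoff_ratio birkhoffN mulNr.
  by rewrite limn_einfN EFinN lteN2.
move=> /(unbounded_above m0 vm)/(_ X)[n hn]; exists n.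
move: hn; rewrite (birkhoffN psi) mulNr; lra.
Unshelve. all: by end_near. Qed.

End unbounded_sums.

Section construction.
Context {R : realType} {G : scgraph}.
Notation Sigma := (Sigma G).
Notation shift := (@left_shift G).
Notation word := (seq (edge G)).
Implicit Types (p q : vertex G) (u w : word) (xi : Sigma).

Section word_sums.
Variables (f : Sigma -> R) (M D : R).
Hypothesis fM : bounded_by M f.
Hypothesis fD : bounded_distortion D f.
Notation b := (sup_birkhoff f).

Lemma sup_birkhoff_dist w xi : cylinder w xi -> `|birkhoff f (size w) xi - b w| <= D.
Proof.
move=> /(sup_birkhoff_bounds fM fD) /andP[h1 h2].
by rewrite ler_norml; apply/andP; split; lra.
Qed.

(** Each of the three suprema is within [D] of a sum along one common sequence. *)
Lemma sup_birkhoff_cat p u w : walk p (u ++ w) -> `|b (u ++ w) - b u - b w| <= 3 * D.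
Proof.
move=> /walk_cylinder[xi xuw _]; have /cylinder_cat[xu xw] := xuw.
have := sup_birkhoff_dist xuw; have := sup_birkhoff_dist xu; have := sup_birkhoff_dist xw.
rewrite size_cat birkhoffD !ler_norml => /andP[? ?] /andP[? ?] /andP[? ?].
by apply/andP; split; lra.
Qed.

Lemma sup_birkhoff_cat_dist p u w : walk p (u ++ w) ->
  `|b (u ++ w) - b u| <= M * (size w)%:R + 2 * D.
Proof.
move=> /walk_cylinder[xi xuw _]; have /cylinder_cat[xu xw] := xuw.
have := sup_birkhoff_dist xuw; have := sup_birkhoff_dist xu.
have := norm_birkhoff_le (size w) (iter (size u) shift xi) fM.
rewrite size_cat birkhoffD !ler_norml => /andP[? ?] /andP[? ?] /andP[? ?].
by apply/andP; split; lra.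
Qed.

End word_sums.

Lemma connect_walk_bounded : exists L : nat, forall p q, exists w,
  [/\ walk p w, walk_end p w = q & (size w <= L)%N].
Proof.
have H (pq : vertex G * vertex G) : exists w, walk pq.1 w /\ walk_end pq.1 w = pq.2.
  by have [w ww we] := connect_walk pq.1 pq.2; exists w.
have [c cP] := choice H.
exists (\max_pq size (c pq)) => p q; exists (c (p, q)); have [h1 h2] := cP (p, q).
by split=> //; exact: (leq_bigmax (p, q)).
Qed.

Lemma exists_loop (f : Sigma -> R) (M D : R) xi q : bounded_by M f -> bounded_distortion D f ->
  (forall X, exists n, X <= birkhoff f n xi) -> forall X, exists w,
  [/\ walk q w, walk_end q w = q & X <= sup_birkhoff f w].
Proof.
move=> fM fD unb X; have [L HL] := connect_walk_bounded.
have M0 := bounded_by_ge0 fM.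
have [c1 [w1 e1 s1]] := HL q (start xi).
(* The two connecting words cost [M * L + 2 * D] each, the junction [3 * D], and the passages
   between suprema and sums [2 * D]. *)
have [n hn] := unb (X + 2 * (M * L%:R) + 9 * D).
have [c2 [w2 e2 s2]] := HL (start (iter n shift xi)) q.
exists (c1 ++ initial_word xi n ++ c2).
have W : walk q (c1 ++ initial_word xi n).
  by rewrite walk_cat w1 e1 walk_initial_word.
have We : walk_end q (c1 ++ initial_word xi n) = start (iter n shift xi).
  by rewrite walk_end_cat e1 walk_end_initial_word.
have W' : walk q ((c1 ++ initial_word xi n) ++ c2) by rewrite walk_cat W We.
rewrite catA; split=> //; first by rewrite walk_end_cat We.
have h1 := sup_birkhoff_cat_dist fM fD W'; have h2 := sup_birkhoff_cat fM fD W.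
have h3 := sup_birkhoff_cat_dist fM fD (w1 : walk q ([::] ++ c1)).
have h4 := sup_birkhoff_dist fM fD (cylinder_initial_word xi n).
have h5 := sup_birkhoff_dist fM fD (cylinder_initial_word xi 0).
move: h1 h2 h3 h4 h5; rewrite /= size_initial_word !birkhoff0 !ler_norml.
have l1 : M * (size c1)%:R <= M * L%:R by rewrite ler_wpM2l// ler_nat.
have l2 : M * (size c2)%:R <= M * L%:R by rewrite ler_wpM2l// ler_nat.
move=> /andP[? _] /andP[? _] /andP[? _] /andP[_ ?] /andP[_ ?]; lra.
Qed.

End construction.

Section corrections.
Context {R : realType} {G : scgraph}.
Notation Sigma := (Sigma G).
Notation word := (seq (edge G)).
Implicit Types (p q : vertex G) (u w : word) (xi : Sigma).

(** Greedy choice: append [ln] when the sum is too high and [lp] when it is too low. A loop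
    outweighs the junction error [3 * D] by at least 1, so the excess over [B0] drops by 1 each
    time, and [B0] is so large that a step past 0 stays within it. *)
Lemma exists_correction (f : Sigma -> R) (M D : R) q lp ln :
  bounded_by M f -> bounded_distortion D f ->
  walk q lp -> walk_end q lp = q -> 3 * D + 1 <= sup_birkhoff f lp ->
  walk q ln -> walk_end q ln = q -> sup_birkhoff f ln <= - (3 * D + 1) ->
  let B0 := `|sup_birkhoff f lp| + `|sup_birkhoff f ln| + 3 * D in
  forall X u, walk q u -> walk_end q u = q -> `|sup_birkhoff f u| <= B0 + X%:R ->
  exists c, [/\ walk q c, walk_end q c = q, (size c <= (size lp + size ln) * X)%N &
    `|sup_birkhoff f (u ++ c)| <= B0].
Proof.
move=> fM fD wp ep bp wn en bn B0; elim=> [|X IH] u wu eu hu.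
  by exists [::]; rewrite cats0; split=> //; rewrite addr0 in hu.
have D0 := bounded_distortion_ge0 fD.
have [small|big] := leP `|sup_birkhoff f u| B0.
  by exists [::]; rewrite cats0.
have B00 : 0 <= B0 by rewrite /B0 !addr_ge0// mulr_ge0.
have step l : walk q l -> walk_end q l = q -> (size l <= size lp + size ln)%N ->
    `|sup_birkhoff f (u ++ l)| <= B0 + X%:R ->
    exists c, [/\ walk q c, walk_end q c = q, (size c <= (size lp + size ln) * X.+1)%N &
      `|sup_birkhoff f (u ++ c)| <= B0].
  move=> wl el sl hl; have [||//|c [wc ec sc hc]] := IH (u ++ l).
  - by rewrite walk_cat wu eu.
  - by rewrite walk_end_cat eu.
  exists (l ++ c); split.
  - by rewrite walk_cat wl el.
  - by rewrite walk_end_cat el.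
  - by rewrite size_cat mulnS leq_add.
  - by rewrite catA.
move: hu; rewrite -natr1 => hu.
have X0 : 0 <= X%:R :> R by exact: ler0n.
have [u0|u0] := leP 0 (sup_birkhoff f u).
  rewrite ger0_norm// in big hu.
  apply: (step ln) => //; first exact: leq_addl.
  have W : walk q (u ++ ln) by rewrite walk_cat wu eu.
  have := sup_birkhoff_cat fM fD W; rewrite ler_norml => /andP[h1 h2].
  have := ler_norm (- sup_birkhoff f ln); rewrite normrN => h3.
  have := normr_ge0 (sup_birkhoff f lp) => h4.
  by rewrite ler_norml; move: big hu; rewrite /B0 => big hu; apply/andP; split; lra.
rewrite ltr0_norm// in big hu.
apply: (step lp) => //; first exact: leq_addr.
have W : walk q (u ++ lp) by rewrite walk_cat wu eu.
have := sup_birkhoff_cat fM fD W; rewrite ler_norml => /andP[h1 h2].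
have := ler_norm (sup_birkhoff f lp) => h3.
have := normr_ge0 (sup_birkhoff f ln) => h4.
by rewrite ler_norml; move: big hu; rewrite /B0 => big hu; apply/andP; split; lra.
Qed.

(** The block is [c1 ++ t ++ c2 ++ c ++ Th]: [c1] and [c2] connect, [c] corrects the sum, and [Th]
    is read from [q] at the end. [A + y] bounds the sum of [f] before the correction, [y] being the
    share of [t]. As [c1] is given beforehand, it can be the same for all [t], and different [t] of
    one length yield disjoint cylinders. *)
Lemma exists_extension (f v : Sigma -> R) (M D Mv Dv B0 : R) (L Lc : nat) q Th :
  bounded_by M f -> bounded_distortion D f -> bounded_by Mv v -> bounded_distortion Dv v ->
  0 <= B0 -> (forall p p', exists w, [/\ walk p w, walk_end p w = p' & (size w <= L)%N]) ->
  (forall X u, walk q u -> walk_end q u = q -> `|sup_birkhoff f u| <= B0 + X%:R ->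
    exists c, [/\ walk q c, walk_end q c = q, (size c <= Lc * X)%N &
    `|sup_birkhoff f (u ++ c)| <= B0]) ->
  walk q Th -> walk_end q Th = q ->
  let B1 := B0 + M * (size Th)%:R + 2 * D in
  let A := B1 + 2 * (M * L%:R + 2 * D) + 4 * D in
  forall p0 c1 (X : nat) (y : R) t u,
  walk q c1 -> walk_end q c1 = p0 -> (size c1 <= L)%N -> A + y <= X%:R ->
  walk p0 t -> t != [::] -> (exists2 xi, cylinder t xi & `|birkhoff f (size t) xi| <= y) ->
  walk q u -> walk_end q u = q -> `|sup_birkhoff f u| <= B1 ->
  exists z z', [/\ c1 ++ t ++ z = z' ++ Th,
    walk q (u ++ z' ++ Th) /\ walk_end q (u ++ z' ++ Th) = q, walk_end q (u ++ z') = q,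
    (size (z' ++ Th) <= 2 * L + size t + Lc * X + size Th)%N /\
    `|sup_birkhoff f (u ++ z' ++ Th)| <= B1 &
    sup_birkhoff v u + sup_birkhoff v t -
      (Mv * (2 * L + Lc * X + size Th)%:R + 7 * Dv) <= sup_birkhoff v (u ++ z' ++ Th)].
Proof.
move=> fM fD vM vD B00 HL corr wTh eTh B1 A p0 c1 X y t u wc1 ec1 sc1 AX wt t0 [xi xt xy] wu eu hu.
have D0 := bounded_distortion_ge0 fD.
have Dv0 := bounded_distortion_ge0 vD.
have M0 := bounded_by_ge0 fM.
have Mv0 := bounded_by_ge0 vM.
have [c2 [wc2 ec2 sc2]] := HL (walk_end p0 t) q.
have W1 : walk q (u ++ c1) by rewrite walk_cat wu eu.
have E1 : walk_end q (u ++ c1) = p0 by rewrite walk_end_cat eu.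
have W2 : walk q ((u ++ c1) ++ t) by rewrite walk_cat W1 E1.
have E2 : walk_end q ((u ++ c1) ++ t) = walk_end p0 t by rewrite walk_end_cat E1.
have W3 : walk q (((u ++ c1) ++ t) ++ c2) by rewrite walk_cat W2 E2.
have E3 : walk_end q (((u ++ c1) ++ t) ++ c2) = q by rewrite walk_end_cat E2.
have l1 (a : R) (w : word) : 0 <= a -> (size w <= L)%N -> a * (size w)%:R <= a * L%:R.
  by move=> a0 wL; rewrite ler_wpM2l// ler_nat.
have h1 := sup_birkhoff_cat_dist fM fD W1; have h2 := sup_birkhoff_cat fM fD W2.
have h3 := sup_birkhoff_cat_dist fM fD W3; have h4 := sup_birkhoff_dist fM fD xt.
have m1 := l1 _ _ M0 sc1; have m2 := l1 _ _ M0 sc2.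
have [|c [wc ec sc hc]] := corr X (((u ++ c1) ++ t) ++ c2) W3 E3.
  move: h1 h2 h3 h4 hu xy AX; rewrite !ler_norml /A.
  move=> /andP[? ?] /andP[? ?] /andP[? ?] /andP[? ?] /andP[? ?] /andP[? ?] ?.
  by apply/andP; split; lra.
have W4 : walk q ((((u ++ c1) ++ t) ++ c2) ++ c) by rewrite walk_cat W3 E3.
have E4 : walk_end q ((((u ++ c1) ++ t) ++ c2) ++ c) = q by rewrite walk_end_cat E3.
have W5 : walk q (((((u ++ c1) ++ t) ++ c2) ++ c) ++ Th) by rewrite walk_cat W4 E4.
have E5 : walk_end q (((((u ++ c1) ++ t) ++ c2) ++ c) ++ Th) = q by rewrite walk_end_cat E4.
exists (c2 ++ c ++ Th), (c1 ++ t ++ c2 ++ c).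
have assoc : u ++ (c1 ++ t ++ c2 ++ c) ++ Th = ((((u ++ c1) ++ t) ++ c2) ++ c) ++ Th.
  by rewrite !catA.
have assoc' : u ++ (c1 ++ t ++ c2 ++ c) = (((u ++ c1) ++ t) ++ c2) ++ c by rewrite !catA.
rewrite assoc assoc'; split=> //.
- by rewrite !catA.
- split; first by move: sc1 sc2 sc; rewrite !size_cat; clear; lia.
  have := sup_birkhoff_cat_dist fM fD W5; move: hc; rewrite !ler_norml /B1.
  move=> /andP[? ?] /andP[? ?].
  by apply/andP; split; lra.
have k1 := sup_birkhoff_cat_dist vM vD W1; have k2 := sup_birkhoff_cat vM vD W2.
have W6 : walk q (((u ++ c1) ++ t) ++ (c2 ++ c ++ Th)).
  by move: W5; rewrite -!catA.
have k3 := sup_birkhoff_cat_dist vM vD W6.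
have -> : ((((u ++ c1) ++ t) ++ c2) ++ c) ++ Th = ((u ++ c1) ++ t) ++ (c2 ++ c ++ Th).
  by rewrite -!catA.
have n1 : Mv * (size c1)%:R + Mv * (size (c2 ++ c ++ Th))%:R <= Mv * (2 * L + Lc * X + size Th)%:R.
  rewrite -mulrDr -natrD ler_wpM2l// ler_nat; move: sc1 sc2 sc; rewrite !size_cat; clear; lia.
move: k1 k2 k3; rewrite !ler_norml => /andP[? ?] /andP[? ?] /andP[? ?]; lra.
Qed.

End corrections.

(** * The tree inside the level set *)

Section symbolic_tree.
Context {R : realType} {G : scgraph}.
Notation Sigma := (Sigma G).
Notation word := (seq (edge G)).
Implicit Types (p q : vertex G) (u w : word) (xi zeta : Sigma).

(** Three words, because the cell in the middle is the one with neighbours on both sides. *)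
Definition distinct_walks q w1 w2 w3 := [/\ [/\ walk q w1, walk q w2 & walk q w3],
  [/\ w1 != [::], size w1 = size w2 & size w2 = size w3] &
  [/\ w1 <> w2, w2 <> w3 & w1 <> w3]].

Definition source w : vertex G := if w is e :: _ then init e else start (point : Sigma).

Lemma walk_source w xi : w != [::] -> cylinder w xi -> walk (source w) w.
Proof.
case: w => // e w _ wx; have := cylinder_walk wx; rewrite /= eqxx.
by move=> /andP[].
Qed.

Variables (psi v : Sigma -> R) (alpha m Mp Dp Mv Dv r s : R).
Hypothesis m0 : 0 < m.
Hypothesis vm : forall z, v z <= - m.
Hypothesis vM : bounded_by Mv v.
Hypothesis vD : bounded_distortion Dv v.
Hypothesis psiM : bounded_by Mp psi.
Hypothesis psiD : bounded_distortion Dp psi.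
Hypothesis r0 : 0 < r.
Hypothesis rs : r < s.
Notation du := (du (fun z => - v z)).
Hypothesis Hs : hausdorff_measure du s (level_set psi v alpha) <> 0%E.

Let d := (s - r) * m / 2.
Let d0 : 0 < d. Proof. by rewrite divr_gt0// mulr_gt0// subr_gt0. Qed.

Let exp_big (C : R) : exists N : nat, forall n, (N <= n)%N -> C <= expR (d * n%:R).
Proof.
have [N h] := exists_natr_ge C d0; exists N => n /h/le_trans; apply.
apply: le_trans (expR_ge1Dx _); lra.
Qed.

(** A word contributes at most 1 to a sum that exceeds [2 * #|vertex G|], so some vertex starts at
    least three good words of the same length. *)
Lemma three_words : exists q w1 w2 w3, distinct_walks q w1 w2 w3.
Proof.
have [N hN] := exp_big (2 * #|vertex G|%:R).
have [n nN] := many_good_words m0 vm vM vD N.+1 (ltW r0) rs ltr01 Hs.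
rewrite -/d => big.
have n0 : (0 < n)%N by exact: leq_trans nN.
have t0 (t : n.-tuple (edge G)) : tval t != [::] by rewrite -size_eq0 size_tuple -lt0n.
have [q hq] : exists q, (2 < #|[pred t : n.-tuple (edge G) | good psi v alpha 1 t && (source t == q)]|)%N.
  apply: contrapT => none; move: big; apply/negP; rewrite -leNgt.
  apply: le_trans (hN n (ltnW nN)).
  apply: (@le_trans _ _ (\sum_(t : n.-tuple (edge G) | good psi v alpha 1 t) 1)).
    apply: ler_sum => t /asboolP[xi wx _].
    rewrite -expR0 ler_expR pmulr_rle0//.
    apply: (le_trans (sup_birkhoff_le vm wx)).
    by rewrite mulNr oppr_le0 mulr_ge0 ?ler0n// ltW.
  rewrite (partition_big (fun t : n.-tuple (edge G) => source t) xpredT)//=.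
  apply: (@le_trans _ _ (\sum_(p : vertex G) 2)).
    apply: ler_sum => p _; rewrite sumr_const (ler_nat _ _ 2).
    rewrite leqNgt; apply/negP => h; apply: none; exists p.
    exact: h.
  by rewrite sumr_const -[leLHS]mulr_natr.
move/card_gt2P: hq => [w1 [w2 [w3 [[]]]]]; rewrite !inE.
move=> /andP[/asboolP[x1 c1 _] /eqP q1] /andP[/asboolP[x2 c2 _] /eqP q2] /andP[/asboolP[x3 c3 _] /eqP q3].
move=> [n12 n23 n31].
have W1 := walk_source (t0 w1) c1; have W2 := walk_source (t0 w2) c2.
have W3 := walk_source (t0 w3) c3.
rewrite q1 in W1; rewrite q2 in W2; rewrite q3 in W3.
exists q, w1, w2, w3; split=> //.
  by split; rewrite ?size_tuple.
split.
- by move=> /val_inj/eqP; apply/negP.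
- by move=> /val_inj/eqP; apply/negP.
- by move=> /val_inj/esym/eqP; apply/negP.
Qed.

Variable T : vertex G -> word -> Prop.
Hypothesis HT : forall q w1 w2 w3, distinct_walks q w1 w2 w3 ->
  exists2 th, walk q th & T q th.
Hypothesis above : exists xi, forall X, exists n, X <= birkhoff psi n xi - alpha * birkhoff v n xi.
Hypothesis below : exists xi, forall X, exists n,
  birkhoff psi n xi - alpha * birkhoff v n xi <= - X.

Let phi z := psi z - alpha * v z.
Let M := Mp + `|alpha| * Mv.
Let D := Dp + `|alpha| * Dv.
Let phiM : bounded_by M phi. Proof. exact: bounded_by_sub_scale. Qed.
Let phiD : bounded_distortion D phi. Proof. exact: bounded_distortion_sub_scale. Qed.

(** Geometry enters only through [T], later instantiated by the property of being flanked by two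
    cells; the construction itself handles words and Birkhoff sums. *)
Lemma symbolic_tree : exists q th (N : nat) (B : R) (K : set Sigma),
  [/\ T q th, hausdorff_measure du r K <> 0%E & forall xi, K xi ->
    [/\ start xi = q, recurrent q th N xi &
        forall n, `|birkhoff psi n xi - alpha * birkhoff v n xi| <= B]].
Proof.
have [q [w1 [w2 [w3 W]]]] := three_words.
have [th wth Tth] := HT W; exists q, th.
have [L HL] := connect_walk_bounded (G := G).
have [cth [wcth ecth _]] := HL (walk_end q th) q.
pose Th := th ++ cth.
have wTh : walk q Th by rewrite walk_cat wth.
have eTh : walk_end q Th = q by rewrite walk_end_cat ecth.
have D0 := bounded_distortion_ge0 phiD.
have M0 := bounded_by_ge0 phiM.
have Mv0 := bounded_by_ge0 vM.
have Dv0 := bounded_distortion_ge0 vD.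
have [lp [wlp elp blp]] : exists w, [/\ walk q w, walk_end q w = q & 3 * D + 1 <= sup_birkhoff phi w].
  have [xi h] := above; apply: (exists_loop q phiM phiD (xi := xi)) => X.
  by have [n hn] := h X; exists n; rewrite birkhoffB_scale.
have [ln [wln eln bln]] : exists w, [/\ walk q w, walk_end q w = q & sup_birkhoff phi w <= - (3 * D + 1)].
  have [xi h] := below.
  pose nphi z := - phi z.
  have nM : bounded_by M nphi by move=> z; rewrite normrN.
  have nD : bounded_distortion D nphi.
    by move=> n x y E; rewrite !birkhoffN -opprD normrN; exact: phiD.
  (* The extra [2 * D] pays for turning the supremum of sums of [- phi] into minus the supremum of
     sums of [phi]. *)
  have [|w [ww ew bw]] := @exists_loop _ _ nphi M D xi q nM nD _ (3 * D + 1 + 2 * D).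
    by move=> X; have [n hn] := h X; exists n; rewrite birkhoffN birkhoffB_scale lerNr.
  exists w; split=> //; have [zeta wz _] := walk_cylinder ww.
  have := sup_birkhoff_dist nM nD wz; have := sup_birkhoff_dist phiM phiD wz.
  by rewrite birkhoffN !ler_norml => /andP[? ?] /andP[? ?]; lra.
have corr := exists_correction phiM phiD wlp elp blp wln eln bln.
set B0 := _ + 3 * D in corr.
have B00 : 0 <= B0 by rewrite /B0 !addr_ge0// mulr_ge0.
set Lc := (size lp + size ln)%N in corr; clearbody Lc.
have step := exists_extension phiM phiD vM vD B00 HL corr wTh eTh.
cbv zeta in step.
set B1 := B0 + M * (size Th)%:R + 2 * D in step.
set A := B1 + 2 * (M * L%:R + 2 * D) + 4 * D in step.
have B10 : 0 <= B1 by rewrite /B1; have := mulr_ge0 M0 (ler0n R (size Th)); lra.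
have A0 : 0 <= A by rewrite /A; have := mulr_ge0 M0 (ler0n R L); lra.
(* The correcting loops cost [eps * n] in the exponent, up to constants; [eps]
   is small enough for the growth rate [d] to pay for them. *)
pose k0 := r * Mv * Lc%:R + 1.
have k00 : 0 < k0 by rewrite /k0 ltr_wpDl// !mulr_ge0// ltW.
pose eps := d / (2 * k0).
have eps0 : 0 < eps by rewrite divr_gt0// mulr_gt0.
pose C0 := r * (Mv * (2 * L + size Th)%:R + 7 * Dv) + r * Mv * Lc%:R * (A + 1).
pose V : R := #|vertex G|%:R.
have V0 : 0 < V.
  by rewrite /V ltr0n; apply/card_gt0P; exists q.
have d20 : 0 < d / 2 by exact: divr_gt0.
have [N hN] := exists_natr_ge (C0 + (1 + `|exp.ln V|)) d20.
have [n nN big] := many_good_words m0 vm vM vD N.+1 (ltW r0) rs eps0 Hs.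
rewrite -/d in big.
have n0 : (0 < n)%N by exact: leq_trans nN.
have t0 (t : n.-tuple (edge G)) : tval t != [::] by rewrite -size_eq0 size_tuple -lt0n.
(* The words from a suitable vertex carry the share [1 / V] of the sum, and all of them can be
   preceded by the same connecting word [c1]. *)
have [p0 hp0] : exists p0, expR (d * n%:R) / V <=
    \sum_(t : n.-tuple (edge G) | good psi v alpha eps t && (source t == p0)) expR (r * sup_birkhoff v t).
  apply: contrapT => none; move: big; apply/negP; rewrite -leNgt.
  rewrite (partition_big (fun t : n.-tuple (edge G) => source t) xpredT)//=.
  apply: (@le_trans _ _ (\sum_(p : vertex G) expR (d * n%:R) / V)).
    apply: ler_sum => p _; rewrite leNgt; apply/negP => h; apply: none; exists p; exact: ltW.
  by rewrite sumr_const -[leLHS]mulr_natr divfK ?gt_eqF.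
have [c1 [wc1 ec1 sc1]] := HL q p0.
pose y := eps * n%:R.
have y0 : 0 <= y by rewrite mulr_ge0// ltW.
(* [X] loops correct a sum of size [A + y]; up to a constant this number is [eps * n]. *)
pose X := (Num.truncn (A + y)).+1.
have [X1 X2] : A + y <= X%:R /\ X%:R <= A + y + 1.
  have /andP[h1 h2] : (Num.truncn (A + y))%:R <= A + y < X%:R by apply: truncn_itv; rewrite addr_ge0.
  by split; [exact: ltW|rewrite /X -natr1 lerD2r].
clearbody X.
pose I := n.-tuple (edge G) : finType.
pose Wt : pred I := fun t => good psi v alpha eps t && (source t == p0).
pose Inv u := [/\ walk q u, walk_end q u = q & `|sup_birkhoff phi u| <= B1].
pose Cw := Mv * (2 * L + Lc * X + size Th)%:R + 7 * Dv.
pose N0 := (2 * L + n + Lc * X + size Th)%N.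
pose extends (u : word) (t : I) (z' w : word) := exists z, [/\ c1 ++ t ++ z = w,
    walk q (u ++ w) /\ walk_end q (u ++ w) = q, walk_end q (u ++ z') = q,
    (size w <= N0)%N /\ `|sup_birkhoff phi (u ++ w)| <= B1 &
    sup_birkhoff v u + sup_birkhoff v t - Cw <= sup_birkhoff v (u ++ w)].
have ext1 (ut : word * I) : exists z' : word, Inv ut.1 -> Wt ut.2 ->
    extends ut.1 ut.2 z' (z' ++ Th).
  case: ut => u t /=.
  have [[[wu eu hu] /andP[/asboolP[xi tx xt] /eqP st]]|none] := pselect (Inv u /\ Wt t); last first.
    by exists [::] => h1 h2; case: none.
  have wt : walk p0 t by rewrite -st; exact: walk_source tx.
  have good_t : exists2 xi, cylinder t xi & `|birkhoff phi (size t) xi| <= y.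
    by exists xi; rewrite // (le_trans xt)// size_tuple.
  have [z [z' h]] := step p0 c1 X y t u wc1 ec1 sc1 X1 wt (t0 t) good_t wu eu hu.
  by exists z' => _ _; exists z; rewrite size_tuple in h.
have [ext' ext'P] := choice ext1.
pose ext u t := ext' (u, t) ++ Th.
have extP u t : Inv u -> Wt t -> extends u t (ext' (u, t)) (ext u t) by exact: (ext'P (u, t)).
have Inv0 : Inv [::].
  split=> //; have := sup_birkhoff_dist phiM phiD (cylinder_initial_word (point : Sigma) 0).
  rewrite size_initial_word birkhoff0 sub0r normrN => /le_trans; apply.
  by rewrite /B1; have := mulr_ge0 M0 (ler0n R (size Th)); lra.
have InvS u t : Inv u -> Wt t -> Inv (u ++ ext u t).
  by move=> uI tW; have [z [_ [h1 h2] _ [_ h3] _]] := extP u t uI tW.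
have Inv_walk u : Inv u -> walk q u by case.
have ext_size u t : Inv u -> Wt t -> (0 < size (ext u t) <= N0)%N.
  move=> uI tW; have [z [E _ _ [-> _] _]] := extP u t uI tW.
  rewrite andbT -E !size_cat size_tuple; clear -n0; lia.
(* The words [i] and [j] have equal length and stand at the same place, after [u ++ c1]. *)
have ext_disjoint u i j xi : Inv u -> Wt i -> Wt j ->
    cylinder (u ++ ext u i) xi -> cylinder (u ++ ext u j) xi -> i = j.
  move=> uI iW jW /cylinder_cat[_ +] /cylinder_cat[_ +].
  have [z [<- _ _ _ _]] := extP u i uI iW; have [z2 [<- _ _ _ _]] := extP u j uI jW.
  move=> /cylinder_cat[_ /cylinder_cat[+ _]] /cylinder_cat[_ /cylinder_cat[+ _]].
  by rewrite /cylinder/= !size_tuple => h1 h2; apply: val_inj; rewrite -[LHS]h1 -[RHS]h2.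
have wt_children u : Inv u -> expR (r * sup_birkhoff v u) <=
    \sum_(t : I | Wt t) expR (r * sup_birkhoff v (u ++ ext u t)).
  move=> uI.
  apply: (@le_trans _ _ (\sum_(t : I | Wt t)
      (expR (r * sup_birkhoff v u - r * Cw) * expR (r * sup_birkhoff v t)))); last first.
    apply: ler_sum => t tW; rewrite -expRD ler_expR.
    by have [z [_ _ _ _ h]] := extP u t uI tW; have := ler_wpM2l (ltW r0) h; lra.
  rewrite -mulr_sumr.
  apply: (@le_trans _ _ (expR (r * sup_birkhoff v u - r * Cw) * (expR (d * n%:R) / V))); last first.
    by rewrite ler_pM2l ?expR_gt0.
  rewrite -{1}(@lnK _ V) ?posrE// -expRN -!expRD ler_expR.
  (* Half of [d * n] covers [C0] and [ln V] by the choice of [N], the other half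
     [r * Mv * Lc * eps * n] by the choice of [eps]. *)
  suff : r * Cw + exp.ln V <= d * n%:R by lra.
  have h1 : exp.ln V <= `|exp.ln V| by exact: ler_norm.
  have rMv : 0 <= r * Mv * Lc%:R by rewrite !mulr_ge0// ltW.
  have h2 : r * Cw <= C0 + r * Mv * Lc%:R * y.
    have := ler_wpM2l rMv X2; rewrite /Cw /C0 !natrD !natrM; lra.
  have h3 : r * Mv * Lc%:R * y <= d / 2 * n%:R.
    rewrite /y mulrA ler_wpM2r//.
    apply: (@le_trans _ _ (k0 * eps)); first by rewrite ler_pM2r// /k0 lerDl.
    by rewrite /eps le_eqVlt; apply/orP; left; apply/eqP; field; rewrite gt_eqF.
  have h4 := hN n (ltnW nN); lra.
(* Some node ends within [N0] letters after any given time, and the next block brings an occurrence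
   of [Th] within [N0] more. *)
exists (2 * N0)%N, (B1 + D + M * N0%:R), (branches Wt ext); split=> //.
  exact: (hausdorff_measure_branches_neq0 Inv0 InvS Inv_walk ext_size ext_disjoint wt_children m0 r0 vm vM vD).
move=> xi [f [Wf xf]].
have InvN j : Inv (node ext f j) by exact: (Inv_node Inv0 InvS).
have sizeN j : (j <= size (node ext f j))%N by exact: (size_node Inv0 InvS ext_size).
have sizeS j : (size (node ext f j.+1) <= size (node ext f j) + N0)%N.
  exact: (size_nodeS Inv0 InvS ext_size).
have sx : start xi = q.
  have [w1' _ _] := InvN 1%N.
  by apply: (cylinder_start (xf 1%N) w1'); rewrite -size_eq0 -lt0n; exact: sizeN.
have at_time i : exists j, (i <= size (node ext f j) <= i + N0)%N.
  have ex : exists j, (i <= size (node ext f j))%N by exists i; exact: sizeN.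
  case: (ex_minnP ex) => -[|j] ij minj.
    by exists 0%N; rewrite ij.
  exists j.+1; rewrite ij /=; apply: (leq_trans (sizeS j)); rewrite leq_add2r.
  by rewrite leqNgt; apply/negP => /ltnW /minj; rewrite ltnn.
split=> //.
- move=> i; have [j /andP[ij ji]] := at_time i.
  have [z [_ _ e' [sz _] _]] := extP (node ext f j) (f j) (InvN j) (Wf j).
  pose u := node ext f j ++ ext' (node ext f j, f j).
  have xu : cylinder (u ++ Th) xi by have := xf j.+1; rewrite /= /ext catA.
  exists (size u); have /cylinder_cat[cu /cylinder_cat[cth' _]] := xu; split=> //.
    apply/andP; split; first by rewrite size_cat (leq_trans ij)// leq_addr.
    rewrite size_cat mulSn mul1n addnA leq_add//.
    by apply: leq_trans sz; rewrite size_cat leq_addr.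
  by rewrite -(cylinder_walk_end cu) sx.
- move=> i; have [j ji] := at_time i; rewrite -birkhoffB_scale -/phi.
  have h1 := birkhoff_dist_le xi phiM ji.
  have h2 := sup_birkhoff_dist phiM phiD (xf j).
  have [_ _ h3] := InvN j.
  move: h1 h2 h3; rewrite !ler_norml => /andP[? ?] /andP[? ?] /andP[? ?].
  by apply/andP; split; lra.
Qed.

End symbolic_tree.

(** * Arcs, lifts and derivatives *)

Section trigonometric_bounds.
Variable R : realType.
Implicit Types x y t : R.

Lemma sin_mvt x : 0 <= x -> exists2 c, 0 <= c <= x & sin x = cos c * x.
Proof.
move=> x0.
have [c|c] := @MVT_segment R sin cos 0 x x0 (fun z _ => is_derive_sin z).
  by apply: continuous_subspaceT => z; exact: continuous_sin.
by rewrite in_itv/= sin0 !subr0 => cx ->; exists c.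
Qed.

Lemma norm_sin_norm x : `|sin `|x| | = `|sin x|.
Proof. by have [//|_] := ger0P x; rewrite sinN normrN. Qed.

Lemma le_norm_sin x : `|sin x| <= `|x|.
Proof.
have [c _ E] := sin_mvt (normr_ge0 x).
by rewrite -norm_sin_norm E normrM normr_id ler_piMl// ler_norml cos_geN1 cos_le1.
Qed.

Lemma cos_piquarter_sqr : cos (pi / 4 : R) ^+ 2 = 1 / 2.
Proof.
have h : cos (pi / 4 + pi / 4 : R) = 0.
  rewrite (_ : _ + _ = pi / 2); last by lra.
  exact: cos_pihalf.
move: h; rewrite cosD -!expr2 => h.
have := cos2Dsin2 (pi / 4 : R); lra.
Qed.

(** By [sin x = 2 * sin (x / 2) * cos (x / 2)] and the mean value theorem, [sin x] is [x] times two
    cosines of angles at most [pi / 4], each of square at least 1/2. *)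
Lemma le_sin_half x : 0 <= x <= pi / 2 -> x / 2 <= sin x.
Proof.
move=> /andP[x0 xpi].
have [c /andP[c0 cx] e] := @sin_mvt (x / 2) (divr_ge0 x0 (ler0n _ _)).
have pi0 := pi_gt0 R.
have q0 : 0 <= cos (pi / 4 : R).
  by apply: cos_ge0_pihalf; apply/andP; split; lra.
have cosge y : 0 <= y <= x / 2 -> cos (pi / 4) <= cos y.
  move=> /andP[y0 yx].
  have yy : y <= pi / 4 by lra.
  by rewrite leNgt ltr_cos -?leNgt ?in_itv//=; apply/andP; split; lra.
have h1 := cosge c; have h2 := cosge (x / 2).
rewrite (_ : x = x / 2 + x / 2) 1?sinD; last by lra.
have {}h1 : cos (pi / 4) <= cos c by apply: h1; rewrite c0.
have {}h2 : cos (pi / 4) <= cos (x / 2) by apply: h2; apply/andP; split; lra.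
rewrite e.
have h3 : 1 / 2 <= cos c * cos (x / 2).
  by rewrite -cos_piquarter_sqr expr2 ler_pM.
have : 0 <= (cos c * cos (x / 2) - 1 / 2) * x by rewrite mulr_ge0// subr_ge0.
lra.
Qed.

Lemma le_norm_sin_half x : `|x| <= pi / 2 -> `|x| / 2 <= `|sin x|.
Proof.
by move=> xpi; rewrite -norm_sin_norm (le_trans _ (ler_norm _))// le_sin_half// normr_ge0.
Qed.

Lemma sin_near_linear (rho : R) : rho < 1 ->
  exists2 eta, 0 < eta & forall x, `|x| < eta -> rho * `|x| <= `|sin x|.
Proof.
move=> rho1.
have : \forall t \near (0 : R), rho < cos t.
  have /(_ (0 : R))/cvgr_gt := @continuous_cos R.
  by apply; rewrite cos0.
move=> /nbhs_ballP[eta /= eta0 h].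
exists eta => // x xeta; have [c /andP[c0 cx] E] := sin_mvt (normr_ge0 x).
rewrite -norm_sin_norm E (le_trans _ (ler_norm _))// ler_wpM2r// ltW//; apply: h.
by rewrite /ball/= sub0r normrN ger0_norm// (le_lt_trans cx).
Qed.

Lemma mdist_angle s t : mdist (angle s) (angle t) = 2 * `|sin ((s - t) / 2)|.
Proof.
rewrite /mdist/= /circle_dist/=.
apply: (@pexpIrn _ 2) => //; rewrite ?nnegrE ?sqrtr_ge0 ?mulr_ge0//.
rewrite sqr_sqrtr ?addr_ge0 ?sqr_ge0// exprMn real_normK ?num_real//.
have -> : s = t + ((s - t) / 2 + (s - t) / 2) by field.
set h := (s - t) / 2.
have -> : (t + (h + h) - t) / 2 = h by field.
rewrite cosD sinD cosD sinD -!expr2.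
have := cos2Dsin2 t; have := cos2Dsin2 h.
move: (cos t) (sin t) (cos h) (sin h) => a b c d h1 h2.
have hc : c ^+ 2 = 1 - d ^+ 2 by rewrite -h1 addrK.
have hb : b ^+ 2 = 1 - a ^+ 2 by rewrite -h2 addrAC subrr add0r.
rewrite hc; set e := d * c + c * d.
have he : e ^+ 2 = 4 * d ^+ 2 * (1 - d ^+ 2) by rewrite /e -hc; ring.
rewrite (_ : (a * _ - _ - a) ^+ 2 + _ = (a ^+ 2 + b ^+ 2) * ((1 - d^+2 - d ^+2 - 1)^+2 + e ^+ 2)); last by ring.
by rewrite he h2; ring.
Qed.

Lemma angle_onto (z : circle R) t :
  exists2 h, `|h| <= pi & angle (t + h) = z.
Proof.
case: z => -[x y] /= xy; have /eqP /= xy1 := xy.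
(* [(u, w)] are the coordinates of [z] in the frame rotated by [t]; the sign of [w] decides between
   [acos u] and its opposite. *)
pose u := x * cos t + y * sin t; pose w := y * cos t - x * sin t.
have uw : u ^+ 2 + w ^+ 2 = 1.
  rewrite -[RHS]mul1r -{1}xy1 -(cos2Dsin2 t) /u /w; ring.
have u1 : -1 <= u <= 1.
  by rewrite -ler_norml -(@expr_le1 _ 2)// real_normK ?num_real// -uw lerDl sqr_ge0.
have cosu : cos (acos u) = u by rewrite acosK// in_itv/=.
have sinu : sin (acos u) ^+ 2 = w ^+ 2.
  have := cos2Dsin2 (acos u); rewrite cosu; lra.
have [h hpi [ch sh]] : exists2 h : R, `|h| <= pi & cos h = u /\ sin h = w.
  have acospi : `|acos u| <= pi by rewrite ger0_norm ?acos_ge0// acos_lepi.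
  move/eqP: sinu; rewrite eqf_sqr => /orP[/eqP sw|/eqP sw].
    by exists (acos u).
  by exists (- acos u); rewrite ?normrN// cosN sinN sw opprK.
exists h => //; apply: val_inj => /=.
rewrite cosD sinD ch sh /u /w.
congr (_, _).
- rewrite [RHS](_ : _ = x * (cos t ^+ 2 + sin t ^+ 2)); first by ring.
  by rewrite cos2Dsin2 mulr1.
- rewrite [RHS](_ : _ = y * (cos t ^+ 2 + sin t ^+ 2)); first by ring.
  by rewrite cos2Dsin2 mulr1.
Qed.

End trigonometric_bounds.

Lemma mdist_line {R : realType} (s t : M1 R Line) : mdist s t = `|(s : R) - t|.
Proof. exact: distrC. Qed.

Section parametrization.
Context {R : realType} {k : one_manifold}.
Notation M := (M1 R k).
Notation par := (@par R k).

Lemma par_lipschitz (s t : R) : mdist (par s) (par t) <= `|s - t|.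
Proof.
case: k => /=; first by rewrite mdist_line.
rewrite mdist_angle; have := le_norm_sin ((s - t) / 2).
rewrite normrM (@ger0_norm _ (2^-1))//; lra.
Qed.

(** With [rho] arbitrarily close to 1, a contraction ratio measured on chords passes to derivatives
    without loss. *)
Lemma par_near_isometric (rho : R) : rho < 1 -> exists2 eta : R, 0 < eta &
  forall s t, `|s - t| < eta -> rho * `|s - t| <= mdist (par s) (par t).
Proof.
move=> rho1; case: k => /=.
  by exists 1 => // s t _; rewrite mdist_line ler_piMl// ltW.
have [eta eta0 h] := sin_near_linear rho1.
exists eta => // s t st; rewrite mdist_angle.
have := h ((s - t) / 2); rewrite normrM (@ger0_norm _ (2^-1))//.
have := normr_ge0 (s - t) => ? /(_ _)/wrap[]; lra.
Qed.

Lemma par_arc (a b : R) : @simple_arc R k a b -> exists2 c : R, 0 < c &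
  forall s t, a <= s <= b -> a <= t <= b ->
    c * `|s - t| <= mdist (par s) (par t).
Proof.
rewrite /simple_arc; case: k => /=.
  by move=> _; exists 1 => // s t _ _; rewrite mdist_line mul1r.
move=> /(_ erefl) ab; have pi0 := pi_gt0 R.
(* The danger is [s - t] close to a full turn. There [sin x = sin (pi - x)], and [pi - x] is at
   least half of the missing arc, [(2 * pi - (b - a)) / 2]. *)
pose c := (2 * pi - (b - a)) / (4 * pi).
have c0 : 0 < c by rewrite divr_gt0//; lra.
have [ba0|ba0] := ltP (b - a) 0.
  by exists 1 => // s t; lra.
have c1 : c <= 1 / 2.
  rewrite /c ler_pdivrMr; lra.
exists c => // s t sab tab; rewrite mdist_angle.
wlog ts : s t sab tab / t <= s.
  move=> h; have [|/ltW] := leP t s; first exact: h.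
  rewrite distrC (_ : (s - t) / 2 = - ((t - s) / 2)); last by lra.
  rewrite sinN normrN; exact: h.
set x := (s - t) / 2; have hx : x = (s - t) / 2 by [].
have x0 : 0 <= x by rewrite /x; lra.
rewrite ger0_norm ?subr_ge0//.
have [xpi|xpi] := leP x (pi / 2).
  have h : x / 2 <= sin x by apply: le_sin_half; rewrite x0.
  rewrite (@le_trans _ _ (2 * sin x)) ?ler_pM2l ?ler_norm//.
  rewrite (@le_trans _ _ (1 / 2 * (s - t)))//; last by lra.
  by rewrite ler_wpM2r// subr_ge0.
have h : (pi - x) / 2 <= sin (pi - x) by apply: le_sin_half; apply/andP; split; lra.
have sx : sin (pi - x) = sin x by rewrite sinB sinpi cospi; lra.
rewrite sx in h.
rewrite (@le_trans _ _ (2 * sin x)) ?ler_pM2l ?ler_norm//.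
apply: (@le_trans _ _ (pi - x)); last by lra.
apply: (@le_trans _ _ (c * (2 * pi))); first by rewrite ler_pM2l//; lra.
have -> : c * (2 * pi) = (2 * pi - (b - a)) / 2 by rewrite /c; field; lra.
lra.
Qed.

Lemma par_onto_near (z : M) (t : R) :
  exists2 t', par t' = z & `|t' - t| <= 2 * mdist (par t) z.
Proof.
case: k z => /=.
  move=> z; exists z => //; rewrite mdist_line distrC.
  by rewrite ler_peMl ?normr_ge0// ler1n.
move=> z; have [h hpi <-] := angle_onto z t; exists (t + h) => //.
have -> : t + h - t = h by ring.
rewrite mdist_angle; have -> : (t - (t + h)) / 2 = - (h / 2) by field.
rewrite sinN normrN.
have := @le_norm_sin_half R (h / 2); rewrite normrM (@ger0_norm _ (2^-1))//.
move=> /(_ _)/wrap[]; lra.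
Qed.

Lemma par_translate (s t h : R) : par s = par t -> par (s + h) = par (t + h).
Proof.
case: k => /=; first by move->.
move=> st; have [cst sst] : cos s = cos t /\ sin s = sin t.
  by have := congr1 val st => /= -[].
by apply: val_inj; rewrite /= !cosD !sinD cst sst.
Qed.

End parametrization.

Section slopes.
Context {R : realType}.
Implicit Types (f d : R -> R) (l r a t : R).

Lemma is_derive_slope f t a : is_derive t 1 f a ->
  forall eps, 0 < eps -> exists2 eta, 0 < eta &
    forall h, `|h| < eta -> `|f (t + h) - f t - a * h| <= eps * `|h|.
Proof.
move=> [df da] eps eps0.
have : h^-1 *: (f (h *: 1 + t) - f t) @[h --> (0:R)^'] --> a.
  by rewrite -da; exact: df.
move=> /cvgrPdist_le/(_ _ eps0); rewrite near_withinE.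
move=> /nbhs_ballP[eta /= eta0 H]; exists eta => // h heta.
have [->|h0] := eqVneq h 0; first by rewrite addr0 subrr mulr0 subr0 normr0 mulr0.
have := H h; rewrite /ball/= sub0r normrN => /(_ heta h0).
rewrite /GRing.scale/= mulr1 (addrC h t).
set D := f (t + h) - f t => HD.
have -> : D - a * h = (h^-1 * D - a) * h by rewrite mulrBl mulrAC mulVf ?mul1r.
by rewrite normrM ler_wpM2r// distrC.
Qed.

(** Differentiability relative to the interval, one-sided at its ends: it suits lifts that exist on
    a compact interval only, and gives continuity up to the ends and the mean value theorem. *)
Definition has_slopes l r f d := forall t, l <= t <= r ->
  forall eps, 0 < eps -> exists2 eta, 0 < eta &
    forall s, l <= s <= r -> `|s - t| < eta ->
      `|f s - f t - d t * (s - t)| <= eps * `|s - t|.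

Lemma within_continuous_dist l r f :
  (forall t, l <= t <= r -> forall eps, 0 < eps -> exists2 eta, 0 < eta &
    forall s, l <= s <= r -> `|s - t| < eta -> `|f s - f t| <= eps) ->
  {within `[l, r], continuous f}.
Proof.
move=> h; apply/subspace_continuousP => t; rewrite /= in_itv/= => lr.
apply/cvgrPdist_le => eps eps0; rewrite near_withinE.
have [eta eta0 H] := h _ lr _ eps0.
apply/nbhs_ballP; exists eta => //= s; rewrite /ball/= in_itv/= => st sl.
by rewrite distrC H// distrC.
Qed.

Lemma has_slopes_continuous l r f d : has_slopes l r f d ->
  {within `[l, r], continuous f}.
Proof.
move=> H; apply: within_continuous_dist => t lr eps eps0.
have [eta eta0 h] := H t lr 1 ltr01.
have p0 : 0 < 1 + `|d t| by rewrite ltr_pwDl.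
exists (Num.min eta (eps / (1 + `|d t|))).
  by rewrite lt_min eta0 divr_gt0.
move=> s sl; rewrite lt_min => /andP[/(h _ sl) {}h]; rewrite ltr_pdivlMr// => st.
rewrite -(subrK (d t * (s - t)) (f s - f t)).
rewrite (le_trans (ler_normD _ _))// (le_trans _ (ltW st))//.
rewrite [leRHS]mulrDr mulr1; apply: lerD; first by rewrite -[leRHS]mul1r.
by rewrite normrM mulrC.
Qed.

Lemma has_slopes_derive l r f d t : has_slopes l r f d -> l < t < r ->
  is_derive t 1 f (d t).
Proof.
move=> H /andP[lt tr].
have lim : h^-1 *: (f (h *: 1 + t) - f t) @[h --> (0:R)^'] --> d t.
  apply/cvgrPdist_le => eps eps0; rewrite near_withinE.
  have ltr : l <= t <= r by rewrite !ltW.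
  have [eta eta0 h] := H t ltr eps eps0.
  apply/nbhs_ballP; exists (Num.min eta (Num.min (t - l) (r - t))) => /=.
    by rewrite !lt_min eta0 !subr_gt0 lt.
  move=> x; rewrite /ball/= sub0r normrN !lt_min => /and3P[xe].
  rewrite !ltr_norml => /andP[x1 x2] /andP[x3 x4] x0.
  rewrite /GRing.scale/= mulr1.
  have := h (x + t); rewrite addrK => /(_ _ xe).
  have -> : l <= x + t <= r by apply/andP; split; lra.
  move=> /(_ isT) {}h.
  rewrite -(@ler_pM2r _ `|x|) ?normr_gt0//; rewrite distrC -normrM.
  by rewrite mulrBl mulrAC mulVf// mul1r.
apply: DeriveDef; first exact: cvgP lim.
exact: cvg_lim lim.
Qed.

Lemma has_slopes_mvt l r f d s t : has_slopes l r f d ->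
  l <= s <= r -> l <= t <= r -> s <= t ->
  exists2 tau, s <= tau <= t & f t - f s = d tau * (t - s).
Proof.
move=> H /andP[ls sr] /andP[lt tr] st.
have [||tau] := @MVT_segment R f d s t st.
- move=> x; rewrite in_itv/= => /andP[sx xt].
  apply: (has_slopes_derive H); apply/andP; split.
    exact: le_lt_trans sx.
  exact: lt_le_trans tr.
- apply: continuous_subspaceW (has_slopes_continuous H) => x /=.
  rewrite !in_itv/= => /andP[sx xt].
  by rewrite (le_trans ls)//= (le_trans xt).
- by rewrite in_itv/= => H1 H2; exists tau.
Qed.

End slopes.

(** * Derivatives of maps of the manifold *)

Section relational_derivative.
Context {R : realType} {k : one_manifold}.
Notation M := (M1 R k).
Notation par := (@par R k).

(* A lift of [f] near [t] is read off pointwise here, so that the base points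
   [t] and [y] can be replaced by any other parameters of the same points. *)
Lemma has_deriv_slope (f : M -> M) (t y a : R) :
  has_deriv f (par t) a -> par y = f (par t) ->
  forall eps, 0 < eps -> exists2 eta, 0 < eta & forall h, `|h| < eta ->
    exists2 j, par (y + j) = f (par (t + h)) & `|j - a * h| <= eps * `|h|.
Proof.
move=> [t0 [g [tt0 lg dg]]] yf eps eps0.
have [eta eta0 H] := is_derive_slope dg eps0.
move: lg => /nbhs_ballP[eta' /= eta'0 H'].
exists (Num.min eta eta'); first by rewrite lt_min eta0.
move=> h; rewrite lt_min => /andP[heta heta'].
exists (g (t0 + h) - g t0); last exact: H.
have -> : par (y + (g (t0 + h) - g t0)) = par (g t0 + (g (t0 + h) - g t0)).
  apply: par_translate; rewrite yf -tt0; apply/esym/H'; exact: ballxx.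
rewrite addrC subrK H'; last by rewrite /ball/= opprD addNKr normrN.
by congr f; apply: par_translate.
Qed.

Lemma par_inj_near : exists2 eta : R, 0 < eta &
  forall s t, `|s - t| < eta -> par s = par t -> s = t.
Proof.
have [eta eta0 H] := @par_near_isometric R k (1 / 2) ltac:(lra).
exists eta => // s t st e; have := H _ _ st; rewrite e mdistxx => h.
have : `|s - t| <= 0 by lra.
by rewrite normr_le0 subr_eq0 => /eqP.
Qed.

(** Chords and parameters agree to first order, so the bound for chords becomes one for the slope.
    The set [A] only has to accumulate at [t], which allows the ends of an interval. *)
Lemma has_deriv_contraction (f : M -> M) (t y a c : R) (A : set R) :
  has_deriv f (par t) a -> par y = f (par t) -> 0 <= c ->
  (forall eta : R, 0 < eta -> exists h : R, [/\ h != 0, `|h| < eta & A (t + h)]) ->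
  (forall h, A (t + h) ->
    mdist (f (par t)) (f (par (t + h))) <= c * mdist (par t) (par (t + h))) ->
  `|a| <= c.
Proof.
move=> fa yf c0 Anear contr.
rewrite leNgt; apply/negP => ca.
(* With this [e] one has [c = (1 - 2 * e) * |a|], while relative errors [e / 2] in slope and chord
   would give [(1 - e / 2) ^ 2 * |a| <= c]. *)
pose e := (`|a| - c) / (2 * `|a|) .
have a0 : 0 < `|a| by exact: le_lt_trans ca.
have [e0 e1] : 0 < e /\ e < 1.
  by rewrite divr_gt0 ?subr_gt0 ?mulr_gt0// ltr_pdivrMr ?mulr_gt0//; split=> //; lra.
have [eta1 eta10 H1] := @par_near_isometric R k (1 - e / 2) ltac:(lra).
have ea0 : 0 < e * `|a| / 2 by rewrite divr_gt0// mulr_gt0.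
have [eta2 eta20 H2] := has_deriv_slope fa yf ea0.
pose q := `|a| + e * `|a| / 2.
have q0 : 0 < q by rewrite addr_gt0.
have [|h [h0 hlt Ah]] := Anear (Num.min eta2 (eta1 / q)).
  by rewrite lt_min eta20 divr_gt0.
move: hlt; rewrite lt_min ltr_pdivlMr// => /andP[h2 h1].
have [j jf jh] := H2 _ h2.
have hh : 0 < `|h| by rewrite normr_gt0.
have jle : `|j| <= q * `|h|.
  rewrite -(subrK (a * h) j) (le_trans (ler_normD _ _))// normrM /q mulrDl.
  by rewrite addrC lerD2l.
have jge : (`|a| - e * `|a| / 2) * `|h| <= `|j|.
  have := ler_normB (a * h) (a * h - j); rewrite opprB addrC subrK => H.
  have : `|a * h| <= `|j| + `|j - a * h|.
    by rewrite (distrC j) -{1}(subrK j (a * h)) addrC ler_normD.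
  rewrite normrM mulrBl; lra.
have := H1 (y + j) y; rewrite addrAC subrr add0r.
rewrite mulrC in h1.
move=> /(_ (le_lt_trans jle h1)).
have := contr _ Ah; rewrite -yf -jf (metric_sym (par y)).
have := @par_lipschitz R k t (t + h); rewrite opprD addNKr normrN => L1 L2 L3.
have L4 : c * mdist (par t) (par (t + h)) <= c * `|h| by rewrite ler_wpM2l.
have L5 : (1 - e / 2) * ((`|a| - e * `|a| / 2) * `|h|) <= c * `|h|.
  rewrite (le_trans _ (le_trans L3 (le_trans L2 L4)))// ler_pM2l//; lra.
have {}L5 : (1 - e / 2) * (`|a| - e * `|a| / 2) <= c by rewrite -(ler_pM2r hh) -[leLHS]mulrA.
move: L5.
have : e * (2 * `|a|) = `|a| - c by rewrite /e divfK// gt_eqF// mulr_gt0.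
have := mulr_gt0 (mulr_gt0 e0 e0) a0.
lra.
Qed.

(** If [a = 0], then [f] turns a small step [h] into one of size at most [e * h], and [g] multiplies
    this by at most [1 + |b|], so the composite makes a step of at most [h / 2]. But it is the
    identity, and [par] is injective at short distances. *)
Lemma has_deriv_inverse_neq0 (f g : M -> M) (t y a b : R) :
  has_deriv f (par t) a -> par y = f (par t) -> has_deriv g (par y) b ->
  (\forall s \near t, g (f (par s)) = par s) -> a <> 0.
Proof.
move=> fa yf gb gf a0.
have ty : par t = g (par y) by rewrite yf; exact/esym/(nbhs_singleton gf).
have [eta0 eta00 inj] := par_inj_near.
pose e := (2 * (1 + `|b|))^-1.
have b0 : 0 < 2 * (1 + `|b|) by rewrite mulr_gt0// ltr_pwDl.
have e0 : 0 < e by rewrite invr_gt0.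
have [eta1 eta10 H1] := has_deriv_slope fa yf e0.
have [eta2 eta20 H2] := has_deriv_slope gb ty ltr01.
move: gf => /nbhs_ballP[eta3 /= eta30 H3].
pose h := Num.min (Num.min eta0 eta1) (Num.min (eta2 / e) eta3) / 3.
have h0 : 0 < h.
  by rewrite divr_gt0// !lt_min eta00 eta10 eta30 divr_gt0.
have : h < Num.min (Num.min eta0 eta1) (Num.min (eta2 / e) eta3) / 2.
  by rewrite /h ltr_pM2l ?ltf_pV2 ?posrE ?ltr_nat// !lt_min eta00 eta10 eta30 divr_gt0.
rewrite ltr_pdivlMr// !lt_min => /andP[/andP[hA hB] /andP[hC hD]].
have h1 : `|h| < eta1 by rewrite gtr0_norm//; lra.
have [j jf] := H1 h h1.
rewrite (gtr0_norm h0) a0 mul0r subr0 => jh.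
move: hC; rewrite ltr_pdivlMr// => hC.
have j2 : `|j| < eta2.
  rewrite (le_lt_trans jh)// (le_lt_trans _ hC)// mulrC ler_pM2r//; lra.
have [i ig ij] := H2 j j2.
have ib : `|i| <= h / 2.
  rewrite -(subrK (b * j) i) (le_trans (ler_normD _ _))// normrM.
  rewrite (@le_trans _ _ ((1 + `|b|) * `|j|))//.
    by rewrite mulrDl lerD2r.
  rewrite (@le_trans _ _ ((1 + `|b|) * (e * h)))// ?ler_wpM2l ?addr_ge0//.
  have : 1 + `|b| != 0 by rewrite gt_eqF// ltr_pwDl.
  by move=> ?; rewrite le_eqVlt; apply/orP; left; apply/eqP; rewrite /e; field.
have : t + i = t + h.
  apply: inj.
    rewrite (_ : t + i - (t + h) = i - h); last by ring.
    rewrite (le_lt_trans (ler_normB _ _))// (gtr0_norm h0); lra.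
  rewrite ig jf H3// /ball/= opprD addNKr normrN gtr0_norm//; lra.
move=> /addrI ih; move: ib; rewrite ih gtr0_norm//; lra.
Qed.

End relational_derivative.

Section finite_bounds.
Context {R : realType} {T : finType}.
Implicit Type f : T -> R.

Lemma finite_ubound f : exists2 M, 0 < M & forall x, f x <= M.
Proof.
exists (1 + \sum_x `|f x|); first by rewrite ltr_pwDl// sumr_ge0.
move=> x; rewrite (bigD1 x)//= addrCA (le_trans (ler_norm _))//.
by rewrite lerDl addr_ge0// sumr_ge0.
Qed.

Lemma finite_lbound f : (forall x, 0 < f x) ->
  exists2 m, 0 < m & forall x, m <= f x.
Proof.
move=> f0; have [M M0 h] := finite_ubound (fun x => (f x)^-1).
exists M^-1; first by rewrite invr_gt0.
by move=> x; rewrite -(invrK (f x)) lef_pV2 ?posrE ?invr_gt0.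
Qed.

Lemma finite_ubound_lt1 f : (forall x, f x < 1) ->
  exists2 m, 0 < m < 1 & forall x, f x <= m.
Proof.
move=> f0; have [|m m0 h] := @finite_lbound (fun x => 1 - f x).
  by move=> x; rewrite subr_gt0.
exists (Num.max (1 / 2) (1 - m)).
  by rewrite lt_max gt_max; apply/andP; split; [apply/orP; left; lra|apply/andP; split; lra].
by move=> x; rewrite le_max; apply/orP; right; have := h x; lra.
Qed.

End finite_bounds.

Lemma ln_dist_le {R : realType} (m x y : R) : 0 < m -> m <= x -> m <= y ->
  `|ln x - ln y| <= `|x - y| / m.
Proof.
move=> m0; wlog yx : x y / y <= x.
  move=> h mx my; have [|/ltW] := leP y x; first by move/h; exact.
  by move=> /h; rewrite distrC (distrC x); exact.
move=> mx my; have y0 : 0 < y by exact: lt_le_trans my.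
have x0 : 0 < x by exact: lt_le_trans mx.
have lnyx : ln y <= ln x by rewrite ler_ln.
rewrite !ger0_norm ?subr_ge0// -ln_div ?posrE//.
have -> : x / y = 1 + (x - y) / y by rewrite mulrBl divff ?gt_eqF// addrC subrK.
have h : 0 <= (x - y) / y by rewrite divr_ge0 ?subr_ge0// ltW.
rewrite (le_trans (le_ln1Dx _))//; first by rewrite (lt_le_trans _ h)// ltrN10.
by rewrite ler_wpM2l ?subr_ge0// lef_pV2.
Qed.

Lemma exists_near_between {R : realFieldType} (y z r : R) : y != z -> 0 < r ->
  exists s, [/\ s != y, `|s - y| < r & Num.min y z < s < Num.max y z].
Proof.
move=> yz r0; have d0 : 0 < `|z - y| by rewrite normr_gt0 subr_eq0 eq_sym.
pose c := Num.min (1 / 2) (r / (2 * `|z - y|)).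
have c0 : 0 < c by rewrite lt_min !divr_gt0// mulr_gt0.
have c1 : c <= 1 / 2 by rewrite ge_min lexx.
have cr : c * (2 * `|z - y|) <= r by rewrite -ler_pdivlMr ?mulr_gt0// ge_min lexx orbT.
exists (y + c * (z - y)); split.
- by rewrite -subr_eq0 addrAC subrr add0r mulf_eq0 gt_eqF//= subr_eq0 eq_sym.
- by rewrite addrAC subrr add0r normrM gtr0_norm//; lra.
clear d0 cr; case: (ltgtP y z) yz => // yz _; rewrite -subr_gt0 in yz;
  by have := mulr_gt0 c0 yz; have := ler_wpM2r (ltW yz) c1; move=> *; apply/andP; split; lra.
Qed.

Lemma ex2_of {T : Type} (P Q : T -> Prop) :
  (exists2 x, P x & Q x) -> exists x, P x /\ Q x.
Proof. by move=> [x Px Qx]; exists x. Qed.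

(** * Coordinates on the vertex intervals *)

Section charts.
Context {R : realType} {k : one_manifold} (Phi : cgdms R k).
Notation M := (M1 R k).
Notation par := (@par R k).

Definition log_slope (e : edge Phi) (s : R) : R := ln `|Defs.deriv (branch e) (par s)|.

(* Coordinates on the intervals [Ivert p], in which the branches become maps
   of compact intervals of the line; [slope] is a contraction ratio. *)
Record charts := Charts {
  lo : vertex Phi -> R ;
  hi : vertex Phi -> R ;
  lift : edge Phi -> R -> R ;
  slope : R ;
  lo_lt_hi : forall p, lo p < hi p ;
  lo_hi_arc : forall p, @simple_arc R k (lo p) (hi p) ;
  Ivert_par : forall p : vertex Phi, Ivert p = par @` `[lo p, hi p] ;
  par_lower : exists2 c : R, 0 < c & forall p s t,
    lo p <= s <= hi p -> lo p <= t <= hi p -> c * `|s - t| <= mdist (par s) (par t) ;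
  slope_itv : 0 < slope < 1 ;
  lift_dom : forall (e : edge Phi) s, lo (term e) <= s <= hi (term e) ->
    lo (init e) <= lift e s <= hi (init e) ;
  par_lift : forall (e : edge Phi) s, lo (term e) <= s <= hi (term e) ->
    par (lift e s) = branch e (par s) ;
  lift_mvt : forall (e : edge Phi) s t, lo (term e) <= s -> s <= t -> t <= hi (term e) ->
    exists2 tau, s <= tau <= t &
      `|lift e s - lift e t| = expR (log_slope e tau) * `|s - t| ;
  log_slope_le : forall (e : edge Phi) s, lo (term e) <= s <= hi (term e) ->
    log_slope e s <= ln slope ;
  log_slope_ge : exists m, forall (e : edge Phi) s, lo (term e) <= s <= hi (term e) ->
    - m <= log_slope e s ;
  log_slope_dist : forall D : R, 0 < D ->
    exists C rho : R, [/\ 0 < C, 0 < rho < 1 & forall (e : edge Phi) s t n,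
      lo (term e) <= s <= hi (term e) -> lo (term e) <= t <= hi (term e) ->
      `|s - t| <= D * slope ^+ n ->
      `|log_slope e s - log_slope e t| <= C * rho ^+ n] ;
  lift_mono : forall e : edge Phi,
    (forall s t, lo (term e) <= s -> s <= t -> t <= hi (term e) ->
       lift e s <= lift e t) \/
    (forall s t, lo (term e) <= s -> s <= t -> t <= hi (term e) ->
       lift e t <= lift e s) ;
  lift_ivt : forall (e : edge Phi) s t y, lo (term e) <= s -> s <= t -> t <= hi (term e) ->
    Num.min (lift e s) (lift e t) <= y <= Num.max (lift e s) (lift e t) ->
    exists2 x, s <= x <= t & lift e x = y
}.

Lemma deriv_branchP (e : edge Phi) x : nbhd e x -> has_deriv (branch e) x (Defs.deriv (branch e) x).
Proof.
have [[_ h _] _] := branch_diffeo e.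
by move=> /h ex; exact: (xgetPex 0 ex).
Qed.

Lemma par_continuous : continuous par.
Proof.
move=> t A /nbhs_ballP[r /= r0 h]; apply/nbhs_ballP; exists r => //= s st.
apply: h; rewrite ballEmdist/=; apply: le_lt_trans st.
exact: par_lipschitz.
Qed.

Lemma near_par (U : set M) t : open U -> U (par t) -> \forall s \near t, U (par s).
Proof. by move=> oU Ut; apply: par_continuous; exact: open_nbhs_nbhs. Qed.

Lemma deriv_branch_neq0 (e : edge Phi) t : nbhd e (par t) -> Defs.deriv (branch e) (par t) <> 0.
Proof.
move=> Ut; have [[oU _ _] [g [[_ h _] gf]]] := branch_diffeo e.
have [y yf _] := @par_onto_near R k (branch e (par t)) 0.
have [b gb] : exists b, has_deriv g (par y) b.
  by apply: h; exists (par t).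
apply: (has_deriv_inverse_neq0 (deriv_branchP Ut) yf gb).
by apply: filterS (near_par oU Ut) => s; exact: gf.
Qed.

Section coordinates.
Variables (l h : vertex Phi -> R) (L : edge Phi -> R -> R) (c0 c : R).
Hypothesis lh : forall p, l p < h p.
Hypothesis lh_arc : forall p, @simple_arc R k (l p) (h p).
Hypothesis Ilh : forall p : vertex Phi, Ivert p = par @` `[l p, h p].
Hypothesis c00 : 0 < c0.
Hypothesis par_lo : forall p s t,
  l p <= s <= h p -> l p <= t <= h p -> c0 * `|s - t| <= mdist (par s) (par t).
Hypothesis Ldom : forall (e : edge Phi) s, l (term e) <= s <= h (term e) ->
  l (init e) <= L e s <= h (init e).
Hypothesis Lpar : forall (e : edge Phi) s, l (term e) <= s <= h (term e) ->
  par (L e s) = branch e (par s).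
Hypothesis c01 : 0 < c < 1.
Hypothesis contr : forall (e : edge Phi) x y, Ivert (term e) x -> Ivert (term e) y ->
      mdist (branch e x) (branch e y) <= c * mdist x y.

Let c_ge0 : 0 <= c. Proof. by rewrite ltW//; case/andP: c01. Qed.

Let Ipar (p : vertex Phi) s : l p <= s <= h p -> Ivert p (par s).
Proof. by move=> sp; rewrite Ilh; exists s => //=; rewrite in_itv. Qed.

Let d (e : edge Phi) s := Defs.deriv (branch e) (par s).

Let lip (e : edge Phi) s t : l (term e) <= s <= h (term e) -> l (term e) <= t <= h (term e) ->
  `|L e s - L e t| <= c / c0 * `|s - t|.
Proof.
move=> se te; rewrite mulrAC ler_pdivlMr// mulrC.
apply: (le_trans (par_lo (Ldom se) (Ldom te))).
rewrite !Lpar//; apply: (le_trans (contr (Ipar se) (Ipar te))).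
by rewrite ler_wpM2l// par_lipschitz.
Qed.

(** [has_deriv_slope] yields some parameter of the image point. Both it and [L e s] are near
    [L e t], the latter by the Lipschitz bound, so local injectivity of [par] identifies them. *)
Let slopes (e : edge Phi) : has_slopes (l (term e)) (h (term e)) (L e) (d e).
Proof.
move=> t te eps eps0.
have [eta0 eta00 inj] := @par_inj_near R k.
have Ut := Ivert_nbhd (Ipar te).
have [eta1 eta10 H1] := has_deriv_slope (deriv_branchP Ut) (Lpar te) eps0.
pose q := c / c0 + `|d e t| + eps.
have q0 : 0 < q by rewrite ltr_wpDl// addr_ge0// divr_ge0// ltW.
exists (Num.min eta1 (eta0 / q)); first by rewrite lt_min eta10 divr_gt0.
move=> s se; rewrite lt_min ltr_pdivlMr// => /andP[st1 st0].
have [j] := H1 _ st1; rewrite (_ : t + (s - t) = s) -?Lpar//; last by ring.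
move=> js jd.
suff -> : L e s = L e t + j by rewrite (_ : L e t + j - L e t = j)//; ring.
apply/esym/inj => //.
have -> : L e t + j - L e s = (j - d e t * (s - t)) + (d e t * (s - t) - (L e s - L e t)).
  by ring.
rewrite (le_lt_trans _ st0)// (le_trans (ler_normD _ _))//.
rewrite (le_trans (lerD jd (ler_normB _ _)))// normrM.
have := lip se te; rewrite /q; move: `|s - t| => u; lra.
Qed.

Let dle (e : edge Phi) t : l (term e) <= t <= h (term e) -> `|d e t| <= c.
Proof.
move=> te.
have Ut := Ivert_nbhd (Ipar te).
apply: (has_deriv_contraction (A := [set s | l (term e) <= s <= h (term e)])
  (deriv_branchP Ut) (Lpar te)) => //.
  (* [t] may be an end of the interval; it is approached from the side of another point [z]. *)
  move=> eta eta0; have [z ze tz] : exists2 z, l (term e) <= z <= h (term e) & t != z.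
    have lhe := lh (term e); have [->|ne] := eqVneq t (l (term e)).
      by exists (h (term e)); rewrite ?lexx ?andbT ?ltW ?lt_eqF.
    by exists (l (term e)); rewrite ?lexx ?ltW.
  have [s [st sr b]] := exists_near_between tz eta0; exists (s - t).
  rewrite subr_eq0; split=> //; rewrite /= addrC subrK.
  by move: te ze b; case: (leP t z) => _ /andP[? ?] /andP[? ?] /andP[? ?]; apply/andP; split; lra.
by move=> x xe; apply: contr; apply: Ipar.
Qed.

Let d_neq0 (e : edge Phi) t : l (term e) <= t <= h (term e) -> 0 < `|d e t|.
Proof.
by move=> te; rewrite normr_gt0; apply/eqP/deriv_branch_neq0/Ivert_nbhd/Ipar.
Qed.

Let hoelder (e : edge Phi) : exists C beta : R, [/\ 0 < C, 0 < beta & forall s t,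
  l (term e) <= s <= h (term e) -> l (term e) <= t <= h (term e) ->
  `|d e s - d e t| <= C * `|s - t| `^ beta].
Proof.
have [beta [C [beta0 H]]] := branch_hoelder e.
exists (`|C| + 1), beta; split=> //.
move=> s t se te.
apply: (le_trans (H _ _ (Ivert_nbhd (Ipar se)) (Ivert_nbhd (Ipar te)))).
apply: (@le_trans _ _ ((`|C| + 1) * mdist (par s) (par t) `^ beta)).
  by rewrite ler_wpM2r ?powR_ge0// (le_trans (ler_norm _))// lerDl.
rewrite ler_wpM2l ?addr_ge0//; apply: ge0_ler_powR;
  by rewrite ?nnegrE ?mdist_ge0 ?par_lipschitz ?(ltW beta0).
Qed.

Let d_lower (e : edge Phi) : exists2 m, 0 < m & forall s, l (term e) <= s <= h (term e) ->
  m <= `|d e s|.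
Proof.
have [C [beta [C0 beta0 H]]] := hoelder e.
have cont : {within `[l (term e), h (term e)], continuous (fun s => `|d e s|)}.
  apply: within_continuous_dist => t te eps eps0.
  exists ((eps / C) `^ beta^-1); first by rewrite powR_gt0// divr_gt0.
  move=> s se st; apply: (le_trans (ler_dist_dist _ _)).
  apply: (le_trans (H _ _ se te)); rewrite mulrC -ler_pdivlMr//.
  apply: (@le_trans _ _ (((eps / C) `^ beta^-1) `^ beta)).
    by apply: ge0_ler_powR; rewrite ?nnegrE ?powR_ge0 ?(ltW beta0) ?(ltW st).
  by rewrite -powRrM mulVf ?gt_eqF// powRr1// divr_ge0 ?ltW.
have [s0 s0e h0] := EVT_min (ltW (lh (term e))) cont.
exists `|d e s0|; first by apply: d_neq0; rewrite in_itv in s0e.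
by move=> s se; apply: h0; rewrite in_itv.
Qed.

Let logd_dist (e : edge Phi) : exists C beta : R, [/\ 0 < C, 0 < beta & forall s t,
  l (term e) <= s <= h (term e) -> l (term e) <= t <= h (term e) ->
  `|log_slope e s - log_slope e t| <= C * `|s - t| `^ beta].
Proof.
have [C [beta [C0 beta0 H]]] := hoelder e.
have [m m0 hm] := d_lower e.
exists (C / m), beta; split; rewrite ?divr_gt0// => s t se te.
apply: (le_trans (ln_dist_le m0 (hm _ se) (hm _ te))).
rewrite mulrAC ler_pM2r ?invr_gt0//.
by apply: (le_trans (ler_dist_dist _ _)); exact: H.
Qed.

Lemma charts_of_coordinates : inhabited charts.
Proof.
have cont e := has_slopes_continuous (@slopes e).
have mvt e s t : l (term e) <= s -> s <= t -> t <= h (term e) ->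
    exists2 tau, s <= tau <= t &
      `|L e s - L e t| = expR (log_slope e tau) * `|s - t|.
  move=> ls st th; have sh := le_trans st th; have lt := le_trans ls st.
  have [||tau /andP[st1 t1t] E] := has_slopes_mvt (@slopes e) _ _ st; first by rewrite ls.
    by rewrite lt.
  exists tau; first by rewrite st1.
  rewrite distrC E normrM (distrC t) /log_slope lnK// posrE.
  by apply: d_neq0; rewrite (le_trans ls)//= (le_trans t1t).
have inj e : {in `[l (term e), h (term e)] &, injective (L e)}.
  move=> s t; rewrite !in_itv/= => /andP[s1 s2] /andP[t1 t2].
  wlog st : s t s1 s2 t1 t2 / s <= t.
    move=> H; have [/H|/ltW /H H' E] := leP s t; first exact.
    by apply/esym/H'.
  have [tau _ +] := mvt e s t s1 st t2.
  move=> + E; rewrite E subrr normr0 => /esym/eqP.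
  by rewrite mulf_eq0 gt_eqF ?expR_gt0//= normr_eq0 subr_eq0 => /eqP.
have lnc e s : l (term e) <= s <= h (term e) -> log_slope e s <= ln c.
  by move=> se; rewrite /log_slope ler_ln ?posrE ?dle//; [exact: d_neq0|case/andP: c01].
have [m mP] : exists m, forall (e : edge Phi) s, l (term e) <= s <= h (term e) ->
    - m <= log_slope e s.
  have [mm mmP] := choice (fun e => ex2_of (d_lower e)).
  have [m _ hm] := finite_ubound (fun e => - ln (mm e)).
  exists m => e s se; rewrite lerNl (le_trans _ (hm e))// lerN2.
  by have [mm0 mmle] := mmP e; rewrite ler_ln ?posrE ?mmle// d_neq0.
(* The Hoelder exponents depend on the edge. Along the scales [D * c ^+ n] they turn into ratios,
   which have a common bound [rho < 1]. *)
have dist (D : R) : 0 < D -> exists C rho : R, [/\ 0 < C, 0 < rho < 1 & forall (e : edge Phi) s t n,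
    l (term e) <= s <= h (term e) -> l (term e) <= t <= h (term e) ->
    `|s - t| <= D * c ^+ n ->
    `|log_slope e s - log_slope e t| <= C * rho ^+ n].
  move=> D0.
  have [CC CCP] := choice logd_dist.
  have [bb bbP] := choice CCP.
  have [C C0 hC] := finite_ubound (fun e => CC e * D `^ bb e).
  have [|rho rho01 hrho] := @finite_ubound_lt1 R _ (fun e => c `^ bb e).
    move=> e; have [_ b0 _] := bbP e.
    have <- : 1 `^ bb e = 1 :> R by rewrite powR1.
    by rewrite gt0_ltr_powR ?nnegrE//; case/andP: c01 => // /ltW.
  exists C, rho; split=> // e s t n se te st.
  have [Ce0 be0 He] := bbP e.
  apply: (le_trans (He _ _ se te)).
  apply: (@le_trans _ _ (CC e * (D * c ^+ n) `^ bb e)).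
    rewrite ler_pM2l//; apply: ge0_ler_powR; rewrite ?nnegrE//; first exact: ltW.
    by rewrite mulr_ge0 ?exprn_ge0 ?(ltW D0).
  rewrite powRM ?exprn_ge0 ?(ltW D0)// mulrA.
  apply: ler_pM => //; rewrite ?mulr_ge0 ?powR_ge0 ?(ltW Ce0)//.
  have -> : (c ^+ n) `^ bb e = (c `^ bb e) ^+ n.
    by rewrite -(powR_mulrn _ c_ge0) -(powR_mulrn _ (powR_ge0 _ _)) -!powRrM mulrC.
  by rewrite lerXn2r ?nnegrE ?powR_ge0//; case/andP: rho01 => /ltW.
apply: inhabits; apply: (@Charts l h L c) => //; first by exists c0.
  by exists m.
- move=> e; have [le|/ltW le] := leP (L e (l (term e))) (L e (h (term e))).
    left=> s t ls st th; have := segment_continuous_inj_le le (cont e) (inj e).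
    move=> /(_ s t) ->//; rewrite in_itv/= ?ls ?th ?andbT//=.
      exact: le_trans th.
    exact: le_trans st.
  right=> s t ls st th; have := segment_continuous_inj_ge le (cont e) (inj e).
  move=> /(_ t s) ->//; rewrite in_itv/= ?ls ?th ?andbT//=.
    exact: le_trans st.
  exact: le_trans th.
- move=> e s t y ls st th y1.
  have [|x] := @IVT _ (L e) _ _ y st _ y1.
    apply: continuous_subspaceW (cont e) => x /=; rewrite !in_itv/= => /andP[sx xt].
    by rewrite (le_trans ls)//= (le_trans xt).
  by rewrite in_itv/= => xst E; exists x.
Qed.

End coordinates.

Lemma charts_exist : inhabited charts.
Proof.
have [l lP] := choice (@Ivert_interval _ _ Phi).
have [h lhP] := choice lP.
have lh p : l p < h p by have [] := lhP p.
have arclh p : @simple_arc R k (l p) (h p) by have [] := lhP p.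
have Ilh p : Ivert p = par @` `[l p, h p] by have [] := lhP p.
have arc p : exists c : R, 0 < c /\ forall s t,
    l p <= s <= h p -> l p <= t <= h p -> c * `|s - t| <= mdist (par s) (par t).
  by have [_ /par_arc /ex2_of] := lhP p.
have [cc ccP] := choice arc.
have [c0 c00 c0P] := finite_lbound (fun p => (ccP p).1).
have [c c1 contr] := branch_contraction Phi.
have lifts (es : edge Phi * R) : exists y, l (term es.1) <= es.2 <= h (term es.1) ->
    l (init es.1) <= y <= h (init es.1) /\ par y = branch es.1 (par es.2).
  case: es => e s /=.
  have [se|] := boolP (l (term e) <= s <= h (term e)); last by exists 0.
  have : Ivert (init e) (branch e (par s)).
    by apply: branch_maps; exists (par s) => //; rewrite Ilh; exists s => //=; rewrite in_itv.
  by rewrite Ilh => -[y /=]; rewrite in_itv/= => yI ye; exists y.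
have [L LP] := choice lifts.
(* The given contraction constant might not be positive, whereas [slope] must be. *)
apply: (@charts_of_coordinates l h (fun e s => L (e, s)) c0 (Num.max c (1 / 2))) => //.
- move=> p s t sp tp; apply: le_trans ((ccP p).2 _ _ sp tp).
  by rewrite ler_wpM2r// c0P.
- by move=> e s se; have [] := LP (e, s) se.
- by move=> e s se; have [] := LP (e, s) se.
- by rewrite lt_max gt_max c1; apply/andP; split; [apply/orP; right; lra|lra].
- move=> e x y xe ye; apply: (le_trans (contr _ _ _ xe ye)).
  by rewrite ler_wpM2r ?mdist_ge0// le_max lexx.
Qed.

End charts.

(** * Cells and bounded distortion *)

Section lifted_words.
Context {R : realType} {k : one_manifold} (Phi : cgdms R k) (ch : charts Phi).
Notation par := (@par R k).
Notation Sigma := (Sigma Phi).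
Notation shift := (@left_shift Phi).
Notation lo := (lo ch).
Notation hi := (hi ch).
Notation lift := (lift ch).
Notation slope := (slope ch).
Implicit Types (p q : vertex Phi) (e : edge Phi) (u w : seq (edge Phi)) (xi zeta : Sigma).

Definition dom p (s : R) : bool := lo p <= s <= hi p.

Definition wlift w (s : R) : R := foldr lift s w.

Definition cell p w : set R := wlift w @` [set s | dom (walk_end p w) s].

Lemma lo_dom p : dom p (lo p).
Proof. by rewrite /dom lexx ltW// lo_lt_hi. Qed.

Lemma hi_dom p : dom p (hi p).
Proof. by rewrite /dom lexx ltW// lo_lt_hi. Qed.

Lemma cell_lo p w : cell p w (wlift w (lo (walk_end p w))).
Proof. by exists (lo (walk_end p w)) => //=; exact: lo_dom. Qed.

Lemma cell_hi p w : cell p w (wlift w (hi (walk_end p w))).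
Proof. by exists (hi (walk_end p w)) => //=; exact: hi_dom. Qed.

Lemma dom_itv p s t r : dom p s -> dom p t -> s <= r <= t -> dom p r.
Proof.
by move=> /andP[ls _] /andP[_ th] /andP[sr rt]; rewrite /dom (le_trans ls)//= (le_trans rt).
Qed.

Lemma wlift_cat u w s : wlift (u ++ w) s = wlift u (wlift w s).
Proof. by rewrite /wlift foldr_cat. Qed.

Lemma wlift_dom p w s : walk p w -> dom (walk_end p w) s -> dom p (wlift w s).
Proof.
by elim: w p => //= e w IH p /andP[/eqP <- ew] sw; apply: lift_dom; exact: IH.
Qed.

Lemma par_wlift p w s : walk p w -> dom (walk_end p w) s ->
  par (wlift w s) = fword w (par s).
Proof.
elim: w p => //= e w IH p /andP[_ ew] sw.
by rewrite par_lift ?(IH (term e))//; exact: wlift_dom ew sw.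
Qed.

Lemma wlift_mono p w : walk p w ->
  (forall s t, dom (walk_end p w) s -> dom (walk_end p w) t -> s <= t ->
     wlift w s <= wlift w t) \/
  (forall s t, dom (walk_end p w) s -> dom (walk_end p w) t -> s <= t ->
     wlift w t <= wlift w s).
Proof.
elim: w p => [p _|e w IH p /= /andP[_ ew]]; first by left.
have d s : dom (walk_end (term e) w) s -> dom (term e) (wlift w s) by exact: wlift_dom.
have [le|le] := lift_mono ch e; have [H|H] := IH _ ew; [left|right|right|left];
  move=> s t sd td st; have := H _ _ sd td st; have := d _ sd; have := d _ td;
  move=> /andP[? ?] /andP[? ?] ?; exact: le.
Qed.

Lemma cell_dom p w y : walk p w -> cell p w y -> dom p y.
Proof. by move=> pw [s sw <-]; exact: wlift_dom. Qed.

Lemma cell_cons p e w y : walk p (e :: w) ->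
  cell p (e :: w) y <-> exists2 x, cell (term e) w x & lift e x = y.
Proof.
move=> /andP[_ ew]; split=> [[s sw <-]|[_ [s sw <-] <-]]; last by exists s.
by exists (wlift w s) => //; exists s.
Qed.

Lemma cell_cat p u w y : cell p (u ++ w) y <->
  exists2 x, cell (walk_end p u) w x & wlift u x = y.
Proof.
split=> [[s]|[_ [s sw <-] <-]]; rewrite /= ?walk_end_cat ?wlift_cat.
  by move=> sw <-; exists (wlift w s) => //; exists s.
by exists s; rewrite ?wlift_cat//= walk_end_cat.
Qed.

Lemma cell_catl p u w y : walk p (u ++ w) -> cell p (u ++ w) y -> cell p u y.
Proof.
rewrite walk_cat => /andP[pu uw] /cell_cat[x xw <-]; exists x => //.
exact: cell_dom xw.
Qed.

Lemma lift_between e s t y : dom (term e) s -> dom (term e) t ->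
  lift e s <= y <= lift e t ->
  exists2 x, Num.min s t <= x <= Num.max s t & lift e x = y.
Proof.
move=> /andP[ls sh] /andP[lt th] yst.
have [st|ts] := leP s t.
  apply: (lift_ivt (c := ch)) => //.
  by case/andP: yst => ? ?; rewrite ge_min le_max; apply/andP; split; apply/orP; [left|right].
apply: (lift_ivt (c := ch)) => //; first exact: ltW.
by case/andP: yst => ? ?; rewrite ge_min le_max; apply/andP; split; apply/orP; [right|left].
Qed.

Lemma cell_itv p w x y z : walk p w -> cell p w x -> cell p w z ->
  x <= y <= z -> cell p w y.
Proof.
elim: w p x y z => [p x y z _ [s sp <-] [t tp <-] xyz|e w IH p x y z pw].
  by exists y => //=; exact: dom_itv xyz.
move=> /(cell_cons _ pw)[s sw <-] /(cell_cons _ pw)[t tw <-] xyz.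
have ew : walk (term e) w by case/andP: pw.
apply/(cell_cons _ pw).
have [r rst ry] := lift_between (cell_dom ew sw) (cell_dom ew tw) xyz.
exists r => //; move: rst; case: (leP s t) => _ rst; exact: IH rst.
Qed.

Lemma cell_between p w x y z : walk p w -> cell p w x -> cell p w z ->
  Num.min x z < y < Num.max x z -> cell p w y.
Proof.
move=> pw xc zc; case: (leP x z) => _ /andP[a b].
  by apply: (cell_itv pw xc zc); rewrite !ltW.
by apply: (cell_itv pw zc xc); rewrite !ltW.
Qed.

Lemma wlift_neq p w : walk p w -> forall s t,
  dom (walk_end p w) s -> dom (walk_end p w) t -> s != t -> wlift w s != wlift w t.
Proof.
elim: w p => //= e w IH p /andP[_ ew] s t sw tw st.
have {}st := IH _ ew _ _ sw tw st.
have := wlift_dom ew sw; have := wlift_dom ew tw.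
move: (wlift w s) (wlift w t) st => {}s {}t {sw tw} + tw sw.
wlog st : s t sw tw / s <= t.
  by move=> h; case: (leP s t) => [|/ltW] st; [exact: h|rewrite eq_sym (eq_sym _ (lift _ _)); exact: h].
move: sw tw => /andP[sw _] /andP[_ tw] ne.
have [tau _ E] := lift_mvt sw st tw.
by rewrite -subr_eq0 -normr_eq0 E mulf_neq0 ?normr_eq0 ?subr_eq0// gt_eqF ?expR_gt0.
Qed.

Lemma slope_gt0 : 0 < slope. Proof. by case/andP: (slope_itv ch). Qed.
Lemma slope_lt1 : slope < 1. Proof. by case/andP: (slope_itv ch). Qed.

Lemma lift_contraction e s t : dom (term e) s -> dom (term e) t ->
  `|lift e s - lift e t| <= slope * `|s - t|.
Proof.
move=> sd td; wlog st : s t sd td / s <= t.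
  by move=> h; case: (leP s t) => [|/ltW] st; [exact: h|rewrite distrC (distrC s); exact: h].
have [ls _] := andP sd; have [_ th] := andP td.
have [tau /(dom_itv sd td) taud ->] := lift_mvt ls st th.
rewrite ler_wpM2r// -[leRHS]lnK ?posrE ?slope_gt0// ler_expR.
exact: log_slope_le.
Qed.

Lemma diam_ex : exists2 L : R, 0 < L & forall p s t, dom p s -> dom p t -> `|s - t| <= L.
Proof.
have [L L0 h] := finite_ubound (fun p => hi p - lo p).
exists L => // p s t /andP[? ?] /andP[? ?]; apply: le_trans (h p).
by rewrite ler_norml; apply/andP; split; lra.
Qed.

Lemma wlift_contraction p w s t : walk p w ->
  dom (walk_end p w) s -> dom (walk_end p w) t ->
  `|wlift w s - wlift w t| <= slope ^+ size w * `|s - t|.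
Proof.
elim: w p => [|e w IH] p /=; first by rewrite expr0 mul1r.
move=> /andP[_ ew] sw tw; rewrite exprS -mulrA.
apply: (le_trans (lift_contraction (wlift_dom ew sw) (wlift_dom ew tw))).
by rewrite ler_pM2l ?slope_gt0// (IH (term e)).
Qed.

Lemma geometric_small (C eps : R) : 0 < eps -> exists n, C * slope ^+ n < eps.
Proof.
move=> eps0; have s1 : `|slope| < 1 by rewrite gtr0_norm ?slope_gt0 ?slope_lt1.
have := @cvg_geometric _ C _ s1.
move=> /cvgrPdist_lt/(_ _ eps0)[n _ /(_ n (leqnn n))].
rewrite /= sub0r normrN => /(le_lt_trans (ler_norm _)) h.
by exists n.
Qed.

Lemma IwordE p w : walk p w -> w != [::] -> Iword w = par @` cell p w.
Proof.
case: w => // e w pw _; rewrite /Iword.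
have -> : term (last e w) = walk_end p (e :: w) by rewrite /walk_end/= last_map.
rewrite (Ivert_par ch); apply/seteqP; split => [_ [_ [s sw <-] <-]|_ [_ [s sw <-] <-]].
  have sw' : dom (walk_end p (e :: w)) s by rewrite /dom; move: sw => /=; rewrite in_itv.
  by exists (wlift (e :: w) s); [exists s|rewrite (par_wlift pw)].
exists (par s); first by exists s => //=; rewrite in_itv.
by rewrite (par_wlift pw).
Qed.

Lemma cell_extrema p w : walk p w ->
  exists a b, [/\ cell p w a, cell p w b & forall y, cell p w y -> a <= y <= b].
Proof.
move=> pw; set q := walk_end p w.
have L : cell p w (wlift w (lo q)) := cell_lo p w.
have H : cell p w (wlift w (hi q)) := cell_hi p w.
have [h|h] := wlift_mono pw.
- exists (wlift w (lo q)), (wlift w (hi q)); split => // _ [s sq <-].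
  have /andP[ls sh] := sq.
  by apply/andP; split; apply: h => //; [exact: lo_dom|exact: hi_dom].
- exists (wlift w (hi q)), (wlift w (lo q)); split => // _ [s sq <-].
  have /andP[ls sh] := sq.
  by apply/andP; split; apply: h => //; [exact: hi_dom|exact: lo_dom].
Qed.

Lemma cell_initial_word_sub xi m n y : (m <= n)%N ->
  cell (start xi) (initial_word xi n) y -> cell (start xi) (initial_word xi m) y.
Proof.
move=> mn; rewrite -(subnKC mn) initial_wordD; apply: cell_catl.
by rewrite -initial_wordD; exact: walk_initial_word.
Qed.

(** A parameter of [coding xi] in the chart of the vertex where [xi] starts; coordinates of two
    sequences are comparable when they start at the same vertex. *)
Definition coord xi : R := xget 0 [set y | forall n, cell (start xi) (initial_word xi n) y].

Lemma coordP xi n : cell (start xi) (initial_word xi n) (coord xi).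
Proof.
suff ex : exists y, [set y | forall n, cell (start xi) (initial_word xi n) y] y.
  exact: (xgetPex 0 ex).
have [a aP] := choice (fun n => cell_extrema (walk_initial_word xi n)).
have [b abP] := choice aP.
have ab m j : a m <= b j.
  have [am bm mP] := abP m; have [an bn nP] := abP j.
  have [mn|/ltnW nm] := leqP m j.
    by have /mP /andP[] := cell_initial_word_sub mn bn.
  by have /nP /andP[] := cell_initial_word_sub nm am.
exists (sup (range a)) => {}n; have [an bn _] := abP n.
apply: (cell_itv (walk_initial_word xi n) an bn); apply/andP; split.
  apply: ub_le_sup; last by exists n.
  by exists (b 0%N) => _ [m _ <-].
apply: ge_sup; first by exists (a 0%N), 0%N.
by move=> _ [m _ <-].
Qed.

Lemma cell_dist_le p w (L : R) s t : walk p w ->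
  (forall q s t, dom q s -> dom q t -> `|s - t| <= L) ->
  cell p w s -> cell p w t -> `|s - t| <= L * slope ^+ size w.
Proof.
move=> pw HL [s' sw <-] [t' tw <-].
apply: (le_trans (wlift_contraction pw sw tw)).
by rewrite mulrC ler_wpM2r ?exprn_ge0 ?(ltW slope_gt0)// (HL _ _ _ sw tw).
Qed.

Lemma coord_dom xi : dom (start xi) (coord xi).
Proof. by have [s sd <-] := coordP xi 0. Qed.

(** [coding xi] is some point of the intersection of the cells, which shrink to a single point. *)
Lemma par_coord xi : par (coord xi) = coding xi.
Proof.
set A := \bigcap_n Iword (initial_word xi n.+1).
have IE n : Iword (initial_word xi n.+1) = par @` cell (start xi) (initial_word xi n.+1).
  by apply: IwordE; [exact: walk_initial_word|rewrite initial_wordS].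
have Ac : A (par (coord xi)).
  by move=> n _; rewrite IE; exists (coord xi) => //; exact: coordP.
have : A (coding xi) by apply: (xgetPex (par 0)); exists (par (coord xi)).
move=> h; apply/mdist_positivity/eqP; apply/negPn/negP => y0.
have {}y0 : 0 < mdist (par (coord xi)) (coding xi) by rewrite lt_neqAle eq_sym y0/= mdist_ge0.
have [L L0 HL] := diam_ex; have [n] := geometric_small L y0.
apply/negP; rewrite -leNgt.
have := h n Logic.I; rewrite IE => -[y yc <-].
apply: (le_trans (par_lipschitz _ _)).
have := cell_dist_le (walk_initial_word xi n.+1) HL (coordP xi n.+1) yc.
move=> /le_trans; apply; rewrite size_initial_word ler_pM2l//.
by rewrite exprS ler_piMl ?exprn_ge0 ?(ltW slope_gt0)// ltW// slope_lt1.
Qed.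

Notation v := (@geometric_potential R k Phi).

Lemma geometric_potentialE xi : v xi = log_slope (letter xi 0) (coord (shift xi)).
Proof. by rewrite /geometric_potential -par_coord. Qed.

Lemma coord_shift_dom xi : dom (term (letter xi 0)) (coord (shift xi)).
Proof. by rewrite -start_shift; exact: coord_dom. Qed.

Lemma geometric_potential_le xi : v xi <= ln slope.
Proof. by rewrite geometric_potentialE; apply: log_slope_le; exact: coord_shift_dom. Qed.

Lemma geometric_potential_ge : exists m, forall xi, - m <= v xi.
Proof.
have [m h] := log_slope_ge ch.
by exists m => xi; rewrite geometric_potentialE; apply: h; exact: coord_shift_dom.
Qed.

(** The first letter stretches by [exp (log_slope e tau)] at an intermediate point [tau], while
    [v xi] is the value at [coord (shift xi)]. Both points lie in the cell of the remaining word, so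
    the two logarithms differ by [C * rho] to the power of its length, and the errors add up
    geometrically. *)
Lemma wlift_distortion : exists2 D : R, 0 < D & forall p w s t xi, walk p w ->
  dom (walk_end p w) s -> dom (walk_end p w) t -> cylinder w xi ->
  expR (birkhoff v (size w) xi - D) * `|s - t| <= `|wlift w s - wlift w t| <=
    expR (birkhoff v (size w) xi + D) * `|s - t|.
Proof.
have [L L0 HL] := diam_ex.
have [C [rho [C0 /andP[rho0 rho1] H]]] := log_slope_dist ch L0.
have rr : 0 < 1 - rho by rewrite subr_gt0.
pose K := C / (1 - rho); have K0 : 0 < K by rewrite divr_gt0.
have KE n : K * (1 - rho ^+ n.+1) = K * (1 - rho ^+ n) + C * rho ^+ n.
  by rewrite /K exprS; field; rewrite gt_eqF.
suff h p w s t xi : walk p w ->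
    dom (walk_end p w) s -> dom (walk_end p w) t -> cylinder w xi ->
    expR (birkhoff v (size w) xi - K * (1 - rho ^+ size w)) * `|s - t| <=
      `|wlift w s - wlift w t| <=
    expR (birkhoff v (size w) xi + K * (1 - rho ^+ size w)) * `|s - t|.
  exists K => // p w s t xi pw sw tw wx.
  have /andP[h1 h2] := h p w s t xi pw sw tw wx.
  have KK : K * (1 - rho ^+ size w) <= K.
    by rewrite ler_piMr ?(ltW K0)// gerBl exprn_ge0// ltW.
  apply/andP; split; [apply: le_trans h1|apply: (le_trans h2)];
    rewrite ler_wpM2r// ler_expR; lra.
elim: w p s t xi => [p s t xi _ _ _ _|e w IH p s t xi /= /andP[_ ew] sw tw exi].
  by rewrite /= birkhoff0 expr0 subrr mulr0 subr0 addr0 expR0 mul1r lexx.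
have [e0 wx] : letter xi 0 = e /\ cylinder w (shift xi).
  by move: exi; rewrite /cylinder/= initial_wordS => -[-> ->].
have {IH} := IH _ _ _ _ ew sw tw wx.
have sc : cell (term e) w (wlift w s) by exists s.
have tc : cell (term e) w (wlift w t) by exists t.
have xc : cell (term e) w (coord (shift xi)).
  by rewrite -wx -e0 -start_shift; exact: coordP.
move: (wlift w s) (wlift w t) sc tc => x y; move: `|s - t| (normr_ge0 (s - t)) => r r0.
wlog xy : x y / x <= y.
  move=> h xw yw; have [|/ltW] := leP x y; first by move=> /h; exact.
  by move=> /h; rewrite (distrC y) (distrC (lift e y)); exact.
move=> xw yw /andP[h1 h2].
have /andP[lx _] := cell_dom ew xw; have /andP[_ yh] := cell_dom ew yw.
have [tau txy ->] := lift_mvt lx xy yh.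
have tauc := cell_itv ew xw yw txy.
have := H _ _ _ _ (cell_dom ew tauc) (cell_dom ew xc) (cell_dist_le ew HL tauc xc).
rewrite -{2}e0 -geometric_potentialE birkhoffS KE.
set V := v xi; set S := birkhoff _ _ _; set N := K * _; set eps := C * _ => hV.
have [V1 V2] : V - eps <= log_slope e tau /\ log_slope e tau <= V + eps.
  by move: hV; rewrite ler_norml => /andP[? ?]; split; lra.
apply/andP; split.
  rewrite (_ : V + S - (N + eps) = (V - eps) + (S - N)); last by ring.
  rewrite expRD -mulrA; apply: ler_pM; rewrite ?mulr_ge0 ?expR_ge0 ?ler_expR//.
rewrite (_ : V + S + (N + eps) = (V + eps) + (S + N)); last by ring.
by rewrite expRD -mulrA; apply: ler_pM; rewrite ?expR_ge0 ?ler_expR.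
Qed.

(** The length of one and the same cell is estimated through [xi] and through [zeta], hence twice
    the constant. *)
Lemma geometric_potential_distortion : exists2 D : R, 0 < D & bounded_distortion D v.
Proof.
have [D D0 h] := wlift_distortion.
exists (D + D); first by rewrite addr_gt0.
move=> n; suff H xi zeta : initial_word xi n = initial_word zeta n ->
    birkhoff v n xi - birkhoff v n zeta <= D + D.
  by move=> xi zeta E; rewrite ler_norml lerNl opprB !H.
move=> E; set w := initial_word xi n; set q := walk_end (start xi) w.
have pw : walk (start xi) w by exact: walk_initial_word.
have xw : cylinder w xi by exact: cylinder_initial_word.
have zw : cylinder w zeta by rewrite /w E; exact: cylinder_initial_word.
have /andP[h1 _] := h _ _ _ _ _ pw (hi_dom q) (lo_dom q) xw.
have /andP[_ h2] := h _ _ _ _ _ pw (hi_dom q) (lo_dom q) zw.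
have := le_trans h1 h2; rewrite ler_pM2r; last first.
  by rewrite normr_gt0 subr_eq0 gt_eqF// lo_lt_hi.
rewrite ler_expR size_initial_word; lra.
Qed.

End lifted_words.

(** * The open set condition for cells *)

Section separation.
Context {R : realType} {k : one_manifold} (Phi : cgdms R k) (ch : charts Phi).
Notation M := (M1 R k).
Notation par := (@par R k).
Notation Sigma := (Sigma Phi).
Notation lo := (lo ch).
Notation hi := (hi ch).
Notation dom := (dom ch).
Notation wlift := (wlift ch).
Notation cell := (cell ch).
Implicit Types (p q : vertex Phi) (e : edge Phi) (u w : seq (edge Phi)).

Lemma interior_mdistP (A : set M) x :
  A° x <-> exists2 r : R, 0 < r & forall z, mdist x z < r -> A z.
Proof.
split=> [/nbhs_ballP[r /= r0 h]|[r r0 h]]; last first.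
  by apply/nbhs_ballP; exists r => //= z; rewrite ballEmdist; exact: h.
by exists r => // z xz; apply: h; rewrite ballEmdist.
Qed.

Lemma interior_par (A : set M) (s a b : R) : a < s < b ->
  (forall t, a <= t <= b -> A (par t)) -> A° (par s).
Proof.
move=> /andP[as_ sb] h; apply/interior_mdistP.
exists (Num.min (s - a) (b - s) / 2).
  by rewrite divr_gt0// lt_min !subr_gt0 as_.
move=> z; have [t <- ts] := @par_onto_near R k z s => sz.
apply: h; move: ts; rewrite ler_norml => /andP[t1 t2].
have m1 : Num.min (s - a) (b - s) <= s - a by rewrite ge_min lexx.
have m2 : Num.min (s - a) (b - s) <= b - s by rewrite ge_min lexx orbT.
by apply/andP; split; lra.
Qed.

Lemma par_inj_dom p s t : dom p s -> dom p t -> par s = par t -> s = t.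
Proof.
have [c c0 h] := par_lower ch => sp tp st.
have := h p s t sp tp; rewrite st mdistxx pmulr_rle0// normr_le0 subr_eq0.
by move=> /eqP.
Qed.

Lemma cell_nondegenerate p w y : walk p w -> exists2 z, cell p w z & z != y.
Proof.
move=> pw; set q := walk_end p w.
have L : cell p w (wlift w (lo q)) := cell_lo ch p w.
have H : cell p w (wlift w (hi q)) := cell_hi ch p w.
have ne : wlift w (lo q) != wlift w (hi q).
  by apply: (wlift_neq pw (lo_dom _ _) (hi_dom _ _)); rewrite lt_eqF// lo_lt_hi.
have [<-|] := eqVneq (wlift w (lo q)) y; last by exists (wlift w (lo q)).
by exists (wlift w (hi q)) => //; rewrite eq_sym.
Qed.

Lemma walk_single e : walk (init e) [:: e]. Proof. by rewrite /= eqxx. Qed.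

Lemma IedgeE e : Iedge e = par @` cell (init e) [:: e].
Proof. by apply: IwordE => //; exact: walk_single. Qed.

Lemma near_segment_interior p w y z (U : set M) : walk p w -> w != [::] ->
  cell p w y -> cell p w z -> y != z -> open U -> U (par y) ->
  exists2 s, (Iword w)° (par s) & U (par s).
Proof.
move=> pw w0 yw zw yz oU Uy.
have [r r0 h] : exists2 r : R, 0 < r & forall s, `|s - y| < r -> U (par s).
  have /nbhs_ballP[r /= r0 h] := near_par oU Uy.
  by exists r => // s sy; apply: h; rewrite /ball/= distrC.
have [s [_ sr ys]] := exists_near_between yz r0; exists s; last exact: h.
apply: (interior_par ys) => t /andP[t1 t2]; rewrite (IwordE ch pw w0); exists t => //.
by move: t1 t2; case: (leP y z) => _ t1 t2; [apply: (cell_itv pw yw zw)|apply: (cell_itv pw zw yw)];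
  rewrite t1.
Qed.

(** An interval of positive length that meets an open set has interior points there, so the two
    interiors would meet, contrary to the open set condition. *)
Lemma interior_Iedge_disjoint e e' x : (Iedge e)° x -> Iedge e' x -> e = e'.
Proof.
move=> xe xe'; apply: contrapT => ne.
move: (xe'); rewrite IedgeE => -[y yw yx].
have [z zw zy] := cell_nondegenerate y (walk_single e').
have yz : y != z by rewrite eq_sym.
have yU : (Iedge e)° (par y) by rewrite yx.
have [s s1 s2] := near_segment_interior (walk_single e') isT yw zw yz (@open_interior _ _) yU.
have : ((Iedge e)° `&` (Iedge e')°) (par s) by split.
by rewrite /Iedge (open_set_condition ne).
Qed.

Lemma branch_inj e s t : dom (term e) s -> dom (term e) t ->
  branch e (par s) = branch e (par t) -> par s = par t.
Proof.
move=> sd td E; have [_ [g [_ gf]]] := branch_diffeo e.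
have U r : dom (term e) r -> nbhd e (par r).
  by move=> rd; apply: Ivert_nbhd; rewrite (Ivert_par ch); exists r => //=; rewrite in_itv.
by rewrite -(gf _ (U _ sd)) E gf//; exact: U.
Qed.

(* Open set condition for words: the inside of a cell does not meet the other
   cells of the same generation, whatever chart they are seen in. *)
Lemma cell_interior_disjoint p p' w w' y1 y y2 y' : walk p w -> walk p' w' ->
  size w = size w' -> cell p w y1 -> cell p w y2 -> y1 < y < y2 ->
  cell p' w' y' -> par y = par y' -> w = w'.
Proof.
elim: w w' p p' y1 y y2 y' => [|e w IH] [|e' w']//= p p' y1 y y2 y'.
move=> pw pw' [sw] y1c y2c yy yc' E.
have e0 : p = init e by case/andP: pw => /eqP.
have e0' : p' = init e' by case/andP: pw' => /eqP.
have sub q f u z : q = init f -> walk q (f :: u) -> cell q (f :: u) z -> cell (init f) [:: f] z.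
  by move=> -> qu; exact: (@cell_catl _ _ _ ch (init f) [:: f] u).
have ee : e = e'.
  apply: (@interior_Iedge_disjoint _ _ (par y)).
    apply: (@interior_par _ y y1 y2) => // t ty; rewrite IedgeE; exists t => //.
    by apply: (cell_itv (walk_single e)) ty; apply: sub; eassumption.
  by rewrite E IedgeE; exists y' => //; apply: sub; eassumption.
subst e'; congr cons.
have ew : walk (term e) w by case/andP: pw.
have ew' : walk (term e) w' by case/andP: pw'.
move: y1c y2c yc' => /(cell_cons ch _ pw)[x1 x1c x1y] /(cell_cons ch _ pw)[x2 x2c x2y].
move=> /(cell_cons ch _ pw')[x' xc' xy'].
case/andP: yy => yy1 yy2.
have [|x x12 xy] := @lift_between _ _ _ ch e x1 x2 y (cell_dom ew x1c) (cell_dom ew x2c).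
  by rewrite x1y x2y !ltW.
have xx : par x = par x'.
  have xd : dom (term e) x.
    by move: x12; case: (leP x1 x2) => _ /(dom_itv _ _); apply; exact: cell_dom ew _.
  have xd' := cell_dom ew' xc'.
  by apply: (branch_inj xd xd'); rewrite -!(par_lift (c := ch))// xy xy'.
have x1x : x1 != x by apply: contraTneq yy1 => x1x; rewrite -x1y x1x xy ltxx.
have x2x : x2 != x by apply: contraTneq yy2 => x2x; rewrite -x2y x2x xy ltxx.
move: x12; case: (leP x1 x2) => _ /andP[a b].
  by apply: (IH w' (term e) (term e) x1 x x2 x') => //; rewrite !lt_neqAle x1x a b eq_sym x2x.
by apply: (IH w' (term e) (term e) x2 x x1 x') => //; rewrite !lt_neqAle x2x a b eq_sym x1x.
Qed.

Definition before p w w' := forall y y', cell p w y -> cell p w' y' -> y <= y'.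

(** If neither cell lies to the left of the other, they share a segment of positive length, and its
    midpoint [m] is inside one cell and belongs to the other. *)
Lemma before_total p w w' : walk p w -> walk p w' -> size w = size w' -> w <> w' ->
  before p w w' \/ before p w' w.
Proof.
move=> pw pw' sw ne; apply: contrapT => /not_orP[n1 n2].
have [y1 [y1' [c1 [c1' l1]]]] : exists y y', cell p w y /\ cell p w' y' /\ y' < y.
  apply: contrapT => h; apply: n1 => y y' c c'; rewrite leNgt; apply/negP => yy.
  by apply: h; exists y, y'.
have [y2 [y2' [c2 [c2' l2]]]] : exists y y', cell p w y /\ cell p w' y' /\ y < y'.
  apply: contrapT => h; apply: n2 => y y' c c'; rewrite leNgt; apply/negP => yy.
  by apply: h; exists y', y.
have out y y' z : cell p w y -> cell p w z -> cell p w' y' -> ~ (y < y' < z).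
  move=> cy cz cy' yyz; apply: ne.
  exact: (cell_interior_disjoint pw pw' sw cy cz yyz cy' erefl).
have out' y y' z : cell p w' y -> cell p w' z -> cell p w y' -> ~ (y < y' < z).
  move=> cy cz cy' yyz; apply/ne/esym.
  exact: (cell_interior_disjoint pw' pw (esym sw) cy cz yyz cy' erefl).
pose m := (Num.max y1' y2 + Num.min y1 y2') / 2.
have y12' : y1' < y2'.
  rewrite ltNge; apply/negP => le21.
  have := out y2 y1' y1 c2 c1 c1'; rewrite l1 (lt_le_trans l2 le21).
  by move/(_ isT).
have y21 : y2 < y1.
  rewrite ltNge; apply/negP => le21.
  by have := out' y1' y1 y2' c1' c2' c1; rewrite l1 (le_lt_trans le21 l2) => /(_ isT).
have m1 : Num.max y1' y2 < Num.min y1 y2'.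
  by rewrite gt_max !lt_min l1 y12' y21 l2.
have m2 : y2 <= Num.max y1' y2 by rewrite le_max lexx orbT.
have m3 : y1' <= Num.max y1' y2 by rewrite le_max lexx.
have m4 : Num.min y1 y2' <= y1 by rewrite ge_min lexx.
have m5 : Num.min y1 y2' <= y2' by rewrite ge_min lexx orbT.
have mc : cell p w' m.
  by apply: (cell_itv pw' c1' c2'); rewrite /m; apply/andP; split; lra.
by apply: (out y2 m y1 c2 c1 mc); rewrite /m; apply/andP; split; lra.
Qed.

End separation.

(** * Flanked words, segments and measurability *)

Section flanks.
Context {R : realType} {k : one_manifold} (Phi : cgdms R k) (ch : charts Phi).
Notation M := (M1 R k).
Notation par := (@par R k).
Notation Sigma := (Sigma Phi).
Notation dom := (dom ch).
Notation cell := (cell ch).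
Notation coord := (coord ch).
Notation before := (before ch).
Notation coding := (@coding R k Phi).
Implicit Types (p q : vertex Phi) (e : edge Phi) (u w : seq (edge Phi)) (xi zeta : Sigma).

Definition flanked p a t b := [/\ walk p a, walk p t, walk p b, before p a t & before p t b].

(** Which of the three words comes to lie in the middle is unknown; [P] carries their common
    properties over to the middle one and its neighbours. *)
Lemma exists_flanked q (P : seq (edge Phi) -> Prop) w1 w2 w3 :
  walk q w1 -> walk q w2 -> walk q w3 ->
  size w1 = size w2 -> size w2 = size w3 -> w1 <> w2 -> w2 <> w3 -> w1 <> w3 ->
  P w1 -> P w2 -> P w3 -> exists a t b, [/\ flanked q a t b, P a, P t & P b].
Proof.
move=> q1 q2 q3 s12 s23 n12 n23 n13 P1 P2 P3.
have s13 : size w1 = size w3 by rewrite s12.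
have [b12|b21] := before_total ch q1 q2 s12 n12;
have [b23|b32] := before_total ch q2 q3 s23 n23;
have [b13|b31] := before_total ch q1 q3 s13 n13.
- by exists w1, w2, w3.
- by exists w1, w2, w3.
- by exists w1, w3, w2.
- by exists w3, w1, w2.
- by exists w2, w1, w3.
- by exists w2, w3, w1.
- by exists w3, w2, w1.
- by exists w3, w2, w1.
Qed.

(** A decreasing lift reverses the order, so prepending [u] may exchange the two neighbours. *)
Lemma flanked_cat p u q a t b : walk p u -> walk_end p u = q -> flanked q a t b ->
  flanked p (u ++ a) (u ++ t) (u ++ b) \/ flanked p (u ++ b) (u ++ t) (u ++ a).
Proof.
move=> pu uq [qa qt qb at_ tb].
have W w : walk q w -> walk p (u ++ w) by rewrite walk_cat pu uq.
have d w y : walk q w -> cell q w y -> dom (walk_end p u) y.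
  by move=> qw yw; rewrite uq; exact: cell_dom yw.
have [h|h] := wlift_mono ch pu; [left|right]; split; rewrite ?W//;
  move=> y y' /cell_cat[x + <-] /cell_cat[x' + <-]; rewrite uq => xc xc';
  apply: h; by first [exact: d qa xc|exact: d qt xc|exact: d qb xc
    |exact: d qa xc'|exact: d qt xc'|exact: d qb xc'|exact: at_|exact: tb].
Qed.

Lemma flanked_strict p a t b y : flanked p a t b -> cell p t y ->
  exists y1 y2, [/\ cell p a y1, cell p b y2 & y1 < y < y2].
Proof.
move=> [pa pt pb at_ tb] yt.
have [y1 y1a n1] := cell_nondegenerate ch y pa.
have [y2 y2b n2] := cell_nondegenerate ch y pb.
exists y1, y2; split=> //; rewrite !lt_neqAle n1 eq_sym n2 /=.
by rewrite at_// tb.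
Qed.

(** At an end of a cell a point may be coded from the neighbouring cell; inside, all its codings
    begin with [w]. This is how the mass of a segment gets bounded by that of a cylinder. *)
Lemma coding_interior p w zeta y1 y y2 : walk p w -> cell p w y1 -> cell p w y2 ->
  y1 < y < y2 -> par y = coding zeta -> cylinder w zeta.
Proof.
move=> pw c1 c2 yy E; rewrite /cylinder/=; apply/esym.
apply: (@cell_interior_disjoint _ _ _ ch p (start zeta) w _ y1 y y2 (coord zeta)) => //.
- exact: walk_initial_word.
- by rewrite size_initial_word.
- exact: coordP.
- by rewrite E par_coord.
Qed.

Lemma segment_sym e (x y : M) : segment e x y = segment e y x.
Proof.
by apply/seteqP; split=> z h A [AI Ae Ax Ay]; apply: h.
Qed.

Lemma continuous_par_preimage p (f : R -> R) (a b : R) :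
  (forall t, a <= t <= b -> dom p (f t) /\ par (f t) = par t) ->
  {within `[a, b], continuous f}.
Proof.
move=> h; have [c c0 lower] := par_lower ch.
apply: within_continuous_dist => t tab eps eps0.
exists (c * eps); first by rewrite mulr_gt0.
move=> s sab st; rewrite -(ler_pM2l c0).
have [fs fsE] := h _ sab; have [ft ftE] := h _ tab.
apply: (le_trans (lower _ _ _ fs ft)); rewrite fsE ftE.
by rewrite (le_trans (par_lipschitz _ _))// ltW.
Qed.

(** On the circle a competing compact interval may use parameters other than those of the chart. The
    map [f] changes parameters; it is continuous because [par] has a Lipschitz inverse on the chart,
    and the intermediate value theorem shows that nothing between [s] and [t] is left out. *)
Lemma par_range_itv p (a b s t r : R) (x y : R) :
  (forall z, a <= z <= b -> exists2 f, dom p f & par f = par z) ->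
  dom p s -> dom p t -> a <= x <= b -> a <= y <= b -> par x = par s -> par y = par t ->
  s <= r <= t -> exists2 z, a <= z <= b & par z = par r.
Proof.
move=> h sp tp xab yab xs yt srt.
have [f fP] : exists f : R -> R, forall z, a <= z <= b -> dom p (f z) /\ par (f z) = par z.
  have h' z : exists f, a <= z <= b -> dom p f /\ par f = par z.
    have [zab|] := boolP (a <= z <= b); last by exists 0.
    by have [f fp fz] := h z zab; exists f.
  by have [f fP] := choice h'; exists f.
have cont := continuous_par_preimage fP.
have fx : f x = s by have [fp E] := fP x xab; apply: (par_inj_dom fp sp); rewrite E.
have fy : f y = t by have [fp E] := fP y yab; apply: (par_inj_dom fp tp); rewrite E.
have sub (u w : R) : a <= u <= b -> a <= w <= b -> u <= w ->
    Num.min (f u) (f w) <= r <= Num.max (f u) (f w) ->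
    exists2 z, a <= z <= b & par z = par r.
  move=> /andP[au ub] /andP[aw wb] uw ruw.
  have [|z] := @IVT _ f _ _ r uw _ ruw.
    apply: continuous_subspaceW cont => z /=; rewrite !in_itv/= => /andP[uz zw].
    by rewrite (le_trans au)//= (le_trans zw).
  rewrite in_itv/= => /andP[uz zw] fz.
  have zab : a <= z <= b by rewrite (le_trans au uz) (le_trans zw wb).
  by exists z => //; rewrite -fz; have [_ ->] := fP z zab.
case/andP: srt => sr rt.
have [xy|/ltW yx] := leP x y; [apply: (sub x y)|apply: (sub y x)] => //;
  by rewrite fx fy ge_min le_max sr rt ?orbT.
Qed.

Lemma segmentE e s t : cell (init e) [:: e] s -> cell (init e) [:: e] t -> s <= t ->
  segment e (par s) (par t) = par @` `[s, t].
Proof.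
move=> sc tc st; have W := walk_single e.
have sd := cell_dom W sc; have td := cell_dom W tc.
apply/seteqP; split.
  move=> z; apply; split.
  - exists s, t; split=> // kC; have := lo_hi_arc ch (init e) kC.
    by case/andP: sd => ? _; case/andP: td => _ ?; lra.
  - rewrite (IedgeE ch) => z' [r /=]; rewrite in_itv/= => rst <-; exists r => //.
    exact: cell_itv rst.
  - by exists s => //=; rewrite in_itv/= lexx.
  - by exists t => //=; rewrite in_itv/= lexx andbT.
move=> z' [r /=]; rewrite in_itv/= => rst <- A [[a [b [ab _ AE]]] Ae As At].
move: As At; rewrite AE => -[x /=]; rewrite in_itv/= => xab xs [y /=].
rewrite in_itv/= => yab yt.
have [|z zab <-] := @par_range_itv (init e) a b s t r x y _ sd td xab yab xs yt rst.
  move=> z zab; have : Iedge e (par z) by apply: Ae; rewrite AE; exists z => //=; rewrite in_itv.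
  rewrite (IedgeE ch) => -[f fc fz]; exists f => //; exact: cell_dom fc.
by exists z => //=; rewrite in_itv.
Qed.

Notation bS := (@borel_Sigma R Phi).

Lemma measurable_open_cylinders (A : set bS) :
  (forall xi : Sigma, A xi -> exists n, cylinder (initial_word xi n) `<=` A) ->
  measurable A.
Proof.
move=> h; apply: sub_sigma_algebra => xi /h[n nA].
exists (expR (- n%:R)); first exact: expR_gt0.
move=> zeta /=; rewrite /d1; case: asboolP => [<- _|ne]; first exact/nA/cylinder_initial_word.
rewrite ltr_expR ltrN2 ltr_nat => /ltnW nm; apply: nA.
rewrite /cylinder/= size_initial_word.
have [E _] := meet_lengthP ne.
by rewrite -(take_initial_word _ nm) -E take_initial_word.
Qed.

Lemma measurable_cylinder w : measurable (cylinder w : set bS).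
Proof.
apply: measurable_open_cylinders => xi wx; exists (size w).
by rewrite wx.
Qed.

Lemma cylinder_coord w xi p : walk p w -> w != [::] -> cylinder w xi ->
  start xi = p /\ cell p w (coord xi).
Proof.
move=> pw w0 wx; have sp := cylinder_start wx pw w0; split=> //.
by rewrite -[X in cell _ X]wx -sp; exact: coordP.
Qed.

Lemma measurable_coding_closed (C : set M) : closed C ->
  measurable (coding @^-1` C : set bS).
Proof.
move=> cC; rewrite -(setCK (_ @^-1` _)); apply: measurableC.
apply: measurable_open_cylinders => xi /= nC.
have oC : open (~` C) by exact: closed_openC.
have /nbhs_ballP[r /= r0 h] : nbhs (coding xi) (~` C) by exact: open_nbhs_nbhs.
have [L L0 HL] := diam_ex ch.
have [n hn] := geometric_small ch L r0.
exists n.+1 => zeta zx; apply: h; rewrite ballEmdist/= -!(par_coord ch).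
apply: (le_lt_trans (par_lipschitz _ _)); apply: le_lt_trans hn.
have W := walk_initial_word xi n.+1.
have [|_ zc] := cylinder_coord W _ zx; first by rewrite initial_wordS.
apply: (le_trans (cell_dist_le W HL (coordP ch xi n.+1) zc)).
rewrite size_initial_word ler_pM2l// exprS ler_piMl ?exprn_ge0 ?(ltW (slope_gt0 ch))//.
exact: ltW (slope_lt1 ch).
Qed.

Lemma closed_par_itv (s t : R) : closed (par @` `[s, t]).
Proof.
apply: compact_closed; first exact: metric_hausdorff.
apply: continuous_compact; last exact: segment_compact.
apply: continuous_subspaceT; exact: par_continuous.
Qed.

End flanks.

(** * Hoelder derivatives *)

Section right_limits_of_extrema.
Context {R : realType} (H : R -> set (\bar R)).
Hypothesis H_mono : forall e e', e <= e' -> H e `<=` H e'.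

Lemma cvg_inf_at_right : cvg (ereal_inf (H e) @[e --> 0^'+]).
Proof.
apply: nonincreasing_at_right_is_cvge; near=> x => s t _ _ st.
by apply: ereal_inf_le_tmp; exact: H_mono.
Unshelve. all: by end_near. Qed.

Lemma cvg_sup_at_right : cvg (ereal_sup (H e) @[e --> 0^'+]).
Proof.
apply: nondecreasing_at_right_is_cvge; near=> x => s t _ _ st.
by apply: ereal_sup_le; exact: H_mono.
Unshelve. all: by end_near. Qed.

Lemma lim_inf_gt0 : (0 < lim (ereal_inf (H e) @[e --> 0^'+]))%E ->
  exists c e : R, [/\ 0 < c, 0 < e & forall q, H e q -> (c%:E <= q)%E].
Proof.
move=> h; have [e [e0 he]] : exists e : R, 0 < e /\ (0 < ereal_inf (H e))%E.
  apply: contrapT => n; move: h; apply/negP; rewrite -leNgt.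
  apply: lime_le; first exact: cvg_inf_at_right.
  near=> e; rewrite leNgt; apply/negP => he; apply: n.
  by exists e.
have [c c0 hc] : exists2 c : R, 0 < c & (c%:E <= ereal_inf (H e))%E.
  move: he; case: (ereal_inf _) => [c c0| _|//]; first by exists c.
  by exists 1 => //; rewrite leey.
exists c, e; split=> // q qH; apply: (le_trans hc); exact: ereal_inf_lbound.
Unshelve. all: by end_near. Qed.

Lemma lim_sup_ltpinfty : (lim (ereal_sup (H e) @[e --> 0^'+]) < +oo)%E ->
  exists C e : R, [/\ 0 < C, 0 < e & forall q, H e q -> (q <= C%:E)%E].
Proof.
move=> h; have [e [e0 he]] : exists e : R, 0 < e /\ (ereal_sup (H e) < +oo)%E.
  apply: contrapT => n; move: h; apply/negP; rewrite -leNgt.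
  apply: lime_ge; first exact: cvg_sup_at_right.
  near=> e; rewrite leNgt; apply/negP => he; apply: n.
  by exists e.
have [c c0 hc] : exists2 c : R, 0 < c & (ereal_sup (H e) <= c%:E)%E.
  move: he; case: (ereal_sup _) => [c _|//|_]; last by exists 1 => //; rewrite leNye.
  by exists (`|c| + 1); rewrite ?ltr_wpDl// lee_fin (le_trans (ler_norm _))// lerDl.
exists c, e; split=> // q qH; apply: le_trans hc; exact: ereal_sup_ubound.
Unshelve. all: by end_near. Qed.

Lemma lim_extrema_bounds (c C e0 : R) : 0 < e0 ->
  (forall q, H e0 q -> (c%:E <= q <= C%:E)%E) -> (forall e, 0 < e -> H e !=set0) ->
  let lower := lim (ereal_inf (H e) @[e --> 0^'+]) in
  let upper := lim (ereal_sup (H e) @[e --> 0^'+]) in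
  [/\ (c%:E <= lower)%E, (lower <= upper)%E & (upper <= C%:E)%E].
Proof.
move=> e00 h ne /=; split.
- apply: lime_ge; first exact: cvg_inf_at_right.
  near=> e; apply: le_ereal_inf_tmp => q qH.
  have ee : e <= e0 by near: e; exact: nbhs_right_le.
  by have /andP[] := h q (H_mono ee qH).
- apply: lee_lim; [exact: cvg_inf_at_right|exact: cvg_sup_at_right|].
  near=> e; have [|q qH] := ne e; first by [].
  by apply: (@le_trans _ _ q); [exact: ereal_inf_lbound|exact: ereal_sup_ubound].
- apply: lime_le; first exact: cvg_sup_at_right.
  near=> e; apply: ge_ereal_sup => q qH.
  have ee : e <= e0 by near: e; exact: nbhs_right_le.
  by have /andP[] := h q (H_mono ee qH).
Unshelve. all: by end_near. Qed.

End right_limits_of_extrema.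

Section densities.
Context {R : realType} {k : one_manifold} (Phi : cgdms R k) (ch : charts Phi).
Variable nu : probability (@borel_Sigma R Phi) R.
Notation M := (M1 R k).
Notation par := (@par R k).
Notation Sigma := (Sigma Phi).
Notation bS := (@borel_Sigma R Phi).
Notation dom := (dom ch).
Notation wlift := (wlift ch).
Notation cell := (cell ch).
Notation coord := (coord ch).
Notation coding := (@coding R k Phi).
Notation v := (@geometric_potential R k Phi).
Implicit Types (p q : vertex Phi) (e : edge Phi) (w : seq (edge Phi)) (xi : Sigma).

Definition mass (X : set bS) : R := fine (nu X).

Lemma massE (X : set bS) : measurable X -> nu X = (mass X)%:E.
Proof. by move=> mX; rewrite fineK// fin_num_measure. Qed.

Lemma mass_ge0 (X : set bS) : 0 <= mass X.
Proof. exact: fine_ge0. Qed.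

Lemma mass_le1 (X : set bS) : measurable X -> mass X <= 1.
Proof. by move=> mX; rewrite -lee_fin -massE// probability_le1. Qed.

Lemma mass_le (X Y : set bS) : measurable X -> measurable Y -> X `<=` Y -> mass X <= mass Y.
Proof.
by move=> mX mY XY; rewrite -lee_fin -!massE// le_measure ?inE.
Qed.

Lemma mass_leU (X Y Z : set bS) : measurable X -> measurable Y -> measurable Z ->
  X `<=` Y `|` Z -> mass X <= mass Y + mass Z.
Proof.
move=> mX mY mZ XYZ; rewrite -lee_fin EFinD -!massE//.
apply: (@le_trans _ _ (nu (Y `|` Z))); first by rewrite le_measure ?inE//; exact: measurableU.
exact: measureU2.
Qed.

Definition seg (t s : R) : set M := par @` `[Num.min t s, Num.max t s].

Definition seg_mass (t s : R) : R := mass (coding @^-1` seg t s).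

Lemma segP t s (y : M) : seg t s y <->
  exists2 r, Num.min t s <= r <= Num.max t s & par r = y.
Proof.
by split=> -[r /= h <-]; exists r => //=.
Qed.

Lemma measurable_seg t s : measurable (coding @^-1` seg t s : set bS).
Proof. by apply: (measurable_coding_closed ch); exact: closed_par_itv. Qed.

Lemma segment_seg e t s : cell (init e) [:: e] t -> cell (init e) [:: e] s ->
  segment e (par t) (par s) = seg t s.
Proof.
move=> tc sc; rewrite /seg; case: (leP t s) => [ts|/ltW st]; first exact: segmentE tc sc ts.
by rewrite segment_sym; exact: segmentE sc tc st.
Qed.

Variable alpha : R.
Hypothesis alpha0 : 0 <= alpha.

Lemma hoelder_quotientsE e t eps : cell (init e) [:: e] t ->
  hoelder_quotients nu alpha e (par t) eps =
  [set (seg_mass t s / mdist (par t) (par s) `^ alpha)%:E | s in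
    [set s | cell (init e) [:: e] s /\ 0 < mdist (par t) (par s) < eps]].
Proof.
move=> tc; apply/seteqP; split=> q.
  move=> [y [+ yd] <-]; rewrite (IedgeE ch) => -[s sc sy]; subst y.
  exists s => //; rewrite segment_seg// /push massE; last exact: measurable_seg.
  by [].
move=> [s [sc sd] <-]; exists (par s).
  by split=> //; rewrite (IedgeE ch); exists s.
rewrite segment_seg// /push massE; last exact: measurable_seg.
by [].
Qed.

Lemma hoelder_quotients_mono e (x : M) (d d' : R) : d <= d' ->
  hoelder_quotients nu alpha e x d `<=` hoelder_quotients nu alpha e x d'.
Proof.
move=> dd q [y [ye /andP[y0 yd]] <-]; exists y => //; split=> //.
by rewrite y0 (lt_le_trans yd).
Qed.

Lemma mdist_par_gt0 p s t : dom p s -> dom p t -> s != t -> 0 < mdist (par t) (par s).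
Proof.
have [c c0 h] := par_lower ch => sp tp st; rewrite metric_sym.
by rewrite (lt_le_trans _ (h _ _ _ sp tp))// mulr_gt0// normr_gt0 subr_eq0.
Qed.

(** In coordinates distances change by a factor between [l] and 1, so the density bounds keep their
    form, the lower one at the price of [l] to the power [alpha]. *)
Lemma UD_density x : UD nu alpha x -> exists e t, [/\ x = par t, limit_set Phi x, (Iedge e)° x,
  cell (init e) [:: e] t & exists A eps : R, [/\ 0 < A, 0 < eps & forall s,
    cell (init e) [:: e] s -> s != t -> `|s - t| < eps ->
    A^-1 * `|s - t| `^ alpha <= seg_mass t s <= A * `|s - t| `^ alpha]].
Proof.
move=> [[xl _] [e [xe lower0 _ upper1]]].
have : Iedge e x by exact: interior_subset.
rewrite (IedgeE ch) => -[t tc tx]; subst x; exists e, t; split=> //.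
have [c [e1 [c0 e10 H1]]] := lim_inf_gt0 (@hoelder_quotients_mono e (par t)) lower0.
have [C [e2 [C0 e20 H2]]] := lim_sup_ltpinfty (@hoelder_quotients_mono e (par t)) upper1.
have [l l0 Hl] := par_lower ch.
have td := cell_dom (walk_single e) tc.
exists (Num.max C (c * l `^ alpha)^-1), (Num.min e1 e2); split.
- by rewrite lt_max C0.
- by rewrite lt_min e10.
move=> s sc st; rewrite lt_min => /andP[s1 s2].
have sd := cell_dom (walk_single e) sc.
have d0 := mdist_par_gt0 sd td st.
have dle : mdist (par t) (par s) <= `|s - t| by rewrite metric_sym; exact: par_lipschitz.
have hq d : `|s - t| < d ->
    hoelder_quotients nu alpha e (par t) d (seg_mass t s / mdist (par t) (par s) `^ alpha)%:E.
  by move=> sd'; rewrite hoelder_quotientsE//; exists s => //; split=> //; rewrite d0 (le_lt_trans dle).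
have p0 : 0 < mdist (par t) (par s) `^ alpha by rewrite powR_gt0.
have := H1 _ (hq _ s1); rewrite lee_fin ler_pdivlMr// => h1.
have := H2 _ (hq _ s2); rewrite lee_fin ler_pdivrMr// => h2.
have dge : l * `|s - t| <= mdist (par t) (par s) by rewrite metric_sym; exact: (Hl _ _ _ sd td).
have n0 : 0 < `|s - t| by rewrite normr_gt0 subr_eq0.
have cl : 0 < c * l `^ alpha by rewrite mulr_gt0// powR_gt0.
apply/andP; split.
  apply: le_trans h1; apply: (@le_trans _ _ (c * l `^ alpha * `|s - t| `^ alpha)).
    rewrite ler_wpM2r ?powR_ge0// -[leRHS]invrK lef_pV2 ?posrE ?invr_gt0//.
      by rewrite le_max lexx orbT.
    by rewrite lt_max C0.
  rewrite -mulrA -powRM ?(ltW l0)// ler_pM2l//; apply: ge0_ler_powR => //;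
    rewrite nnegrE ?mdist_ge0// mulr_ge0// ltW//.
apply: (le_trans h2); apply: ler_pM; rewrite ?powR_ge0 ?(ltW C0)//.
  by rewrite le_max lexx.
by apply: ge0_ler_powR => //; rewrite nnegrE// mdist_ge0.
Qed.

Lemma density_UD xi y1 y2 (A eps : R) :
  let e := letter xi 0 in let t := coord xi in
  cell (init e) [:: e] y1 -> cell (init e) [:: e] y2 -> y1 < t < y2 ->
  0 < A -> 0 < eps ->
  (forall s, cell (init e) [:: e] s -> s != t -> `|s - t| < eps ->
    A^-1 * `|s - t| `^ alpha <= seg_mass t s <= A * `|s - t| `^ alpha) ->
  UD nu alpha (coding xi).
Proof.
move=> e t y1c y2c yy A0 eps0 H.
have tc : cell (init e) [:: e] t by exact: (coordP ch xi 1).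
have td := cell_dom (walk_single e) tc.
have xI : (Iedge e)° (par t).
  apply: (@interior_par _ _ _ t y1 y2) => // r ry; rewrite (IedgeE ch); exists r => //.
  exact: cell_itv (walk_single e) y1c y2c ry.
rewrite -(par_coord ch) -/t.
have [l l0 Hl] := par_lower ch.
have la0 : 0 < l `^ alpha by rewrite powR_gt0.
have [|||hl hlu hu] := @lim_extrema_bounds _ (hoelder_quotients nu alpha e (par t))
  (@hoelder_quotients_mono e (par t)) (A^-1) (A / l `^ alpha) (l * eps).
- by rewrite mulr_gt0.
- move=> q; rewrite hoelder_quotientsE// => -[s [sc /andP[s0 s1]] <-].
  have sd := cell_dom (walk_single e) sc.
  have st : s != t by apply: contraTneq s0 => ->; rewrite mdistxx ltxx.
  have dge : l * `|s - t| <= mdist (par t) (par s) by rewrite metric_sym; exact: (Hl _ _ _ sd td).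
  have dle : mdist (par t) (par s) <= `|s - t| by rewrite metric_sym; exact: par_lipschitz.
  have /andP[h1 h2] : A^-1 * `|s - t| `^ alpha <= seg_mass t s <= A * `|s - t| `^ alpha.
    by apply: H => //; rewrite -(ltr_pM2l l0) (le_lt_trans dge).
  have p0 : 0 < mdist (par t) (par s) `^ alpha by rewrite powR_gt0.
  rewrite !lee_fin ler_pdivlMr// ler_pdivrMr//; apply/andP; split.
    apply: le_trans h1; rewrite ler_pM2l ?invr_gt0//.
    by apply: ge0_ler_powR => //; rewrite nnegrE// mdist_ge0.
  apply: (le_trans h2); rewrite -mulrA ler_pM2l// ler_pdivlMl// -powRM ?(ltW l0)//.
  by apply: ge0_ler_powR => //; rewrite nnegrE ?mdist_ge0// mulr_ge0// ltW.
- move=> d d0; have /andP[ty1 ty2] := yy.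
  (* Points of the cell near [t] make the sets of quotients non-empty, as the inequality between
     infimum and supremum demands. *)
  have [s [st sd' ys]] := exists_near_between (ltac:(by rewrite lt_eqF) : t != y2) d0.
  have sc := cell_between (walk_single e) tc y2c ys.
  have sd := cell_dom (walk_single e) sc.
  exists (seg_mass t s / mdist (par t) (par s) `^ alpha)%:E.
  rewrite hoelder_quotientsE//; exists s => //; split=> //.
  rewrite (mdist_par_gt0 sd td st)/= (le_lt_trans (par_lipschitz _ _))//.
  by rewrite distrC.
split.
  split; first by rewrite (par_coord ch); exists xi.
  (* [Iedge e'] is closed, so a point of its boundary belongs to it; being interior to [Iedge e] it
     forces [e = e'], and is then interior to [Iedge e']. *)
  move=> [e' _ [be' nbe']]; apply: nbe'.
  have cI : closed (Iedge e').
    have [a [b [ac bc ab]]] := cell_extrema ch (walk_single e').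
    rewrite (IedgeE ch) (_ : cell _ _ = `[a, b]%classic); first exact: closed_par_itv.
    apply/seteqP; split=> r /=; rewrite in_itv/=; first exact: ab.
    by move=> rab; exact: cell_itv (walk_single e') ac bc rab.
  have xe' : Iedge e' (par t) by move: be'; rewrite -((closure_id _).1 cI).
  by rewrite -(interior_Iedge_disjoint ch xI xe').
exists e; split=> //.
  by apply: lt_le_trans hl; rewrite lte_fin invr_gt0.
by apply: (le_lt_trans hu); rewrite ltry.
Qed.

Lemma cell_width : exists2 D : R, 0 < D & forall xi n,
  (forall y z, cell (start xi) (initial_word xi n) y -> cell (start xi) (initial_word xi n) z ->
    `|y - z| <= expR (birkhoff v n xi + D)) /\
  (exists y z, [/\ cell (start xi) (initial_word xi n) y,
    cell (start xi) (initial_word xi n) z & expR (birkhoff v n xi - D) <= `|y - z|]).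
Proof.
have [D D0 H] := wlift_distortion ch.
have [L L0 HL] := diam_ex ch.
have [l l0 Hl] := @finite_lbound R _ (fun p => hi ch p - lo ch p) ltac:(by move=> p; rewrite subr_gt0 lo_lt_hi).
pose K := D + `|ln L| + `|ln l|.
exists K; first by rewrite /K -addrA ltr_wpDr// addr_ge0.
move=> xi n; set w := initial_word xi n.
have W : walk (start xi) w by exact: walk_initial_word.
have sw : size w = n by exact: size_initial_word.
have xw : cylinder w xi by exact: cylinder_initial_word.
have K1 : D + ln L <= K.
  by have := ler_norm (ln L); have := normr_ge0 (ln l); rewrite /K; lra.
have K2 : D - ln l <= K.
  have := ler_norm (- ln l); have := normr_ge0 (ln L); rewrite normrN /K; lra.
split.
  move=> _ _ [s sd <-] [t td <-].
  have /andP[_ h] := H _ _ _ _ _ W sd td xw; apply: (le_trans h); rewrite sw.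
  apply: (@le_trans _ _ (expR (birkhoff v n xi + D) * L)).
    by rewrite ler_wpM2l ?expR_ge0// (HL _ _ _ sd td).
  rewrite -{1}(@lnK _ L) ?posrE// -expRD ler_expR; lra.
set q := walk_end (start xi) w.
exists (wlift w (hi ch q)), (wlift w (lo ch q)); split.
- exact: cell_hi.
- exact: cell_lo.
have /andP[h _] := H _ _ _ _ _ W (hi_dom ch q) (lo_dom ch q) xw.
apply: le_trans h; rewrite sw.
apply: (@le_trans _ _ (expR (birkhoff v n xi - D) * l)); last first.
  by rewrite ler_wpM2l ?expR_ge0// (le_trans (Hl q))// ler_norm.
rewrite -{1}(@lnK _ l) ?posrE// -expRD ler_expR; lra.
Qed.

End densities.

(** * From [UD] to the level set *)

Section UD_level_set.
Context {R : realType} {k : one_manifold} (Phi : cgdms R k) (ch : charts Phi).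
Variable nu : probability (@borel_Sigma R Phi) R.
Notation Sigma := (Sigma Phi).
Notation bS := (@borel_Sigma R Phi).
Notation cell := (cell ch).
Notation coord := (coord ch).
Notation coding := (@coding R k Phi).
Notation v := (@geometric_potential R k Phi).
Notation mass := (mass nu).
Notation seg_mass := (seg_mass nu).
Implicit Types (e : edge Phi) (w : seq (edge Phi)) (xi zeta eta : Sigma).

Lemma letter_interior e xi : (Iedge e)° (coding xi) -> e = letter xi 0.
Proof.
move=> xe; apply: (interior_Iedge_disjoint ch xe).
rewrite (IedgeE ch) -(par_coord ch); exists (coord xi) => //.
exact: (coordP ch xi 1).
Qed.

Lemma coding_coord xi zeta : start xi = start zeta -> coding xi = coding zeta ->
  coord xi = coord zeta.
Proof.
move=> sxz xz; apply: (@par_inj_dom _ _ _ ch (start xi)); rewrite ?par_coord//.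
  exact: coord_dom.
rewrite sxz; exact: coord_dom.
Qed.

(** Three distinct codings give, at a late generation, three different cells through the same
    coordinate; the middle one, squeezed between the others, would be a single point. The interior
    hypothesis puts all three in the same chart. *)
Lemma coding_le2 e xi zeta eta : (Iedge e)° (coding xi) -> coding xi = coding zeta ->
  coding zeta = coding eta -> [\/ xi = zeta, zeta = eta | xi = eta].
Proof.
move=> xe xz ze; apply: contrapT => n.
have n1 : xi <> zeta by move=> h; apply: n; constructor 1.
have n2 : zeta <> eta by move=> h; apply: n; constructor 2.
have n3 : xi <> eta by move=> h; apply: n; constructor 3.
pose N := (maxn (meet_length xi zeta) (maxn (meet_length zeta eta) (meet_length xi eta))).+1.
have ne a b : a <> b -> (meet_length a b < N)%N -> initial_word a N <> initial_word b N.
  by move=> ab abN E; have := le_meet_length ab E; rewrite leqNgt abN.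
have s1 : start xi = start zeta.
  by rewrite /start -(letter_interior xe) -(@letter_interior e zeta)// -xz.
have s2 : start xi = start eta.
  by rewrite /start -(letter_interior xe) -(@letter_interior e eta)// -ze -xz.
have c1 : coord xi = coord zeta by exact: coding_coord.
have c2 : coord xi = coord eta by apply: coding_coord => //; rewrite xz.
have W1 := walk_initial_word xi N.
have W2 : walk (start xi) (initial_word zeta N) by rewrite s1; exact: walk_initial_word.
have W3 : walk (start xi) (initial_word eta N) by rewrite s2; exact: walk_initial_word.
have := @exists_flanked _ _ _ ch (start xi) (fun w => cell (start xi) w (coord xi)) _ _ _ W1 W2 W3.
rewrite !size_initial_word => /(_ erefl erefl).
case.
- by apply: ne => //; rewrite ltnS leq_maxl.
- by apply: ne => //; rewrite ltnS leq_max leq_maxl orbT.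
- by apply: ne => //; rewrite ltnS !leq_max leqnn !orbT.
- exact: coordP.
- by rewrite s1 c1; exact: coordP.
- by rewrite s2 c2; exact: coordP.
move=> a [t [b [[pa pt pb at_ tb] ac tc bc]]].
have [z zc zn] := cell_nondegenerate ch (coord xi) pt.
by move: zn; rewrite eq_le (at_ _ _ ac zc) (tb _ _ zc bc).
Qed.

Lemma initial_cylinder_sub xi m n : (m <= n)%N ->
  cylinder (initial_word xi n) `<=` cylinder (initial_word xi m).
Proof.
move=> mn zeta; rewrite /cylinder/= !size_initial_word => E.
by rewrite -(take_initial_word _ mn) E take_initial_word.
Qed.

Lemma level_set_of_bounded (psi f : Sigma -> R) (alpha m K : R) (N : nat) xi : 0 < m ->
  (forall z, f z <= - m) ->
  (forall n, (N <= n)%N -> `|birkhoff psi n xi - alpha * birkhoff f n xi| <= K) ->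
  level_set psi f alpha xi.
Proof.
move=> m0 fm H; apply/cvgrPdist_le => eps eps0.
near=> n.
have n0 : (0 < n)%N by near: n; exact: nbhs_infty_gt.
have nN : (N <= n)%N by near: n; exact: nbhs_infty_ge.
have nK : K <= eps * m * n%:R.
  rewrite mulrC -ler_pdivrMr ?mulr_gt0//; near: n; exact: nbhs_infty_ger.
have fn : birkhoff f n xi <= - m * n%:R by exact: birkhoff_le.
have mn : 0 < m * n%:R by rewrite mulr_gt0// ltr0n.
have f0 : birkhoff f n xi < 0 by lra.
rewrite /birkhoff_ratio distrC.
have -> : birkhoff psi n xi / birkhoff f n xi - alpha =
    (birkhoff psi n xi - alpha * birkhoff f n xi) / birkhoff f n xi.
  by rewrite mulrBl mulfK// lt_eqF.
rewrite normrM normfV ler_pdivrMr ?normr_gt0 ?lt_eqF//.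
rewrite (le_trans (H n nN))// (le_trans nK)// -mulrA ler_pM2l// ltr0_norm//; lra.
Unshelve. all: by end_near. Qed.

Variables (psi : Sigma -> R) (alpha D : R).
Hypothesis alpha0 : 0 <= alpha.
Hypothesis gibbsD : forall xi n, (0 < n)%N ->
  ((expR (birkhoff psi n xi - D))%:E <= nu (cylinder (initial_word xi n)) <=
   (expR (birkhoff psi n xi + D))%:E)%E.

Lemma gibbs_mass xi n : (0 < n)%N ->
  expR (birkhoff psi n xi - D) <= mass (cylinder (initial_word xi n)) <=
  expR (birkhoff psi n xi + D).
Proof.
move=> n0; have := gibbsD xi n0.
have -> : nu (cylinder (initial_word xi n)) = (mass (cylinder (initial_word xi n)))%:E.
  by apply: massE; exact: measurable_cylinder.
by rewrite !lee_fin.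
Qed.

Let mcyl w : measurable (cylinder w : set bS).
Proof. exact: measurable_cylinder. Qed.

Let mseg t s : measurable (coding @^-1` seg t s : set bS).
Proof. exact: (measurable_seg ch). Qed.

Lemma level_of_bounded xi (K : R) (N : nat) :
  (forall n, (N <= n)%N -> `|birkhoff psi n xi - alpha * birkhoff v n xi| <= K) ->
  level_set psi v alpha xi.
Proof.
apply: (@level_set_of_bounded _ _ _ (- ln (slope ch))).
  by rewrite oppr_gt0 ln_lt0// slope_itv.
by move=> z; rewrite opprK; exact: (geometric_potential_le ch).
Qed.

Section at_a_point.
Variables (xi : Sigma) (A eps : R).
Let e := letter xi 0.
Let t := coord xi.
Hypothesis A0 : 0 < A.
Hypothesis eps0 : 0 < eps.
Hypothesis HA : forall s, cell (init e) [:: e] s -> s != t -> `|s - t| < eps ->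
    A^-1 * `|s - t| `^ alpha <= seg_mass t s <= A * `|s - t| `^ alpha.

Let cell1 n s : (0 < n)%N -> cell (start xi) (initial_word xi n) s -> cell (init e) [:: e] s.
Proof. by move=> n0 /(cell_initial_word_sub n0). Qed.

(** Two segments from [t] cover the cell, which bounds its mass above. For the lower bound, the
    segment from [t] to halfway towards the farther end is at least a quarter of the cell long and
    lies inside it, except perhaps for [t] itself, which has no mass. *)
Lemma nonatomic_level : seg_mass t t = 0 -> level_set psi v alpha xi.
Proof.
move=> at0.
have [E E0 width] := cell_width ch.
have [L L0 HL] := diam_ex ch.
have [N HN] := geometric_small ch L eps0.
pose K := `|ln (2 * A)| + `|ln (A^-1 * (4^-1) `^ alpha)| + alpha * E + D.
apply: (@level_of_bounded xi K N.+1) => n nN.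
have n0 : (0 < n)%N by exact: leq_trans nN.
have W := walk_initial_word xi n.
have tn : cell (start xi) (initial_word xi n) t by exact: coordP.
have [a [b [an bn ab]]] := cell_extrema ch W.
have /andP[at_ tb] := ab _ tn.
have ab_small : b - a < eps.
  have := cell_dist_le W HL bn an; rewrite size_initial_word ger0_norm ?subr_ge0 ?(le_trans at_)//.
  move=> /le_lt_trans; apply; apply: le_lt_trans HN; rewrite ler_pM2l//.
  by apply: ler_wiXn2l; rewrite ?(ltW (slope_gt0 ch)) ?(ltW (slope_lt1 ch))// ltnW.
have upper s : cell (start xi) (initial_word xi n) s -> seg_mass t s <= A * (b - a) `^ alpha.
  move=> sn; have /andP[as_ sb] := ab _ sn.
  have [->|st] := eqVneq s t.
    by rewrite at0 mulr_ge0 ?powR_ge0// ltW.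
  have sle : `|s - t| <= b - a by rewrite ler_norml; apply/andP; split; lra.
  have /andP[_ h] := HA (cell1 n0 sn) st (le_lt_trans sle ab_small).
  apply: (le_trans h); rewrite ler_pM2l//; apply: ge0_ler_powR => //; rewrite nnegrE; lra.
have [w1 [y [z [yn zn yz]]]] := width xi n.
have ba_ge : expR (birkhoff v n xi - E) <= b - a.
  apply: (le_trans yz); have /andP[ay yb] := ab _ yn; have /andP[az zb] := ab _ zn.
  by rewrite ler_norml; apply/andP; split; lra.
have ba_le : b - a <= expR (birkhoff v n xi + E).
  by rewrite (le_trans (ler_norm _))// w1.
have ba0 : 0 < b - a by apply: lt_le_trans ba_ge; exact: expR_gt0.
have /andP[g1 g2] := gibbs_mass xi n0.
have cyl_le : mass (cylinder (initial_word xi n)) <= 2 * A * (b - a) `^ alpha.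
  apply: (@le_trans _ _ (seg_mass t a + seg_mass t b)).
    apply: mass_leU => // zeta zx.
    have [|_ zc] := cylinder_coord ch W _ zx; first by rewrite -size_eq0 size_initial_word -lt0n.
    have /andP[az zb] := ab _ zc.
    have [zt|/ltW tz] := leP (coord zeta) t; [left|right]; apply/segP;
      exists (coord zeta); rewrite ?par_coord//.
      by rewrite min_r ?max_l// az.
    by rewrite min_l ?max_r// tz.
  have := upper _ an; have := upper _ bn; lra.
have cyl_ge : A^-1 * (4^-1) `^ alpha * (b - a) `^ alpha <= mass (cylinder (initial_word xi n)).
  rewrite -mulrA -powRM ?invr_ge0 ?(ltW ba0)//.
  have inner s : cell (start xi) (initial_word xi n) s -> a < s < b ->
      4^-1 * (b - a) <= `|s - t| ->
      A^-1 * (4^-1 * (b - a)) `^ alpha <= mass (cylinder (initial_word xi n)).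
    move=> sn /andP[as_ sb] sle.
    have q0 : 0 < 4^-1 * (b - a) by rewrite mulr_gt0// invr_gt0.
    have st : s != t by apply: contraTneq sle => ->; rewrite subrr normr0 -ltNge.
    have sle' : `|s - t| <= b - a by rewrite ler_norml; apply/andP; split; lra.
    have /andP[h _] := HA (cell1 n0 sn) st (le_lt_trans sle' ab_small).
    apply: (@le_trans _ _ (A^-1 * `|s - t| `^ alpha)).
      rewrite ler_pM2l ?invr_gt0//; apply: ge0_ler_powR => //; rewrite nnegrE//; exact: ltW.
    apply: (le_trans h).
    rewrite -[leRHS]add0r -at0; apply: mass_leU => // zeta /segP[r rs rz].
    have [rt|rt] := eqVneq r t.
      by left; apply/segP; exists t; rewrite ?minxx ?maxxx ?lexx// -rz rt.
    right; have rn : a < r < b.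
      move: rs; have [ts|/ltW st'] := leP t s => /andP[r1 r2].
        by rewrite (le_lt_trans r2)// andbT (le_lt_trans at_)// lt_neqAle eq_sym rt.
      by rewrite (lt_le_trans as_)//= (lt_le_trans _ tb)// lt_neqAle rt.
    exact: (coding_interior W an bn rn rz).
  have [h|h] := leP (b - t) (t - a).
    pose s := (t + a) / 2.
    have as_ : a < s < b by rewrite /s; apply/andP; split; lra.
    apply: (inner s) => //.
      by apply: (cell_itv W an bn); rewrite !ltW//; case/andP: as_.
    by rewrite distrC (le_trans _ (ler_norm _))// /s; lra.
  pose s := (t + b) / 2.
  have as_ : a < s < b by rewrite /s; apply/andP; split; lra.
  apply: (inner s) => //.
    by apply: (cell_itv W an bn); rewrite !ltW//; case/andP: as_.
  by rewrite (le_trans _ (ler_norm _))// /s; lra.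
have powE (c : R) : 0 < c -> c * (b - a) `^ alpha = expR (ln c + alpha * ln (b - a)).
  by move=> c0; rewrite expRD lnK ?posrE// /powR gt_eqF.
have c1 : 0 < 2 * A by rewrite mulr_gt0.
have c2 : 0 < A^-1 * 4^-1 `^ alpha by rewrite mulr_gt0 ?invr_gt0 ?powR_gt0 ?invr_gt0.
move: (le_trans g1 cyl_le) (le_trans cyl_ge g2); rewrite !powE// !ler_expR.
have l1 : ln (b - a) <= birkhoff v n xi + E by rewrite -(@expRK R (_ + E)) ler_ln ?posrE ?expR_gt0.
have l2 : birkhoff v n xi - E <= ln (b - a) by rewrite -(@expRK R (_ - E)) ler_ln ?posrE ?expR_gt0.
have := ler_wpM2l alpha0 l1; have := ler_wpM2l alpha0 l2; rewrite !mulrDr mulrN.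
have := ler_norm (ln (2 * A)); have := ler_norm (- ln (A^-1 * (4^-1) `^ alpha)); rewrite normrN.
have := normr_ge0 (ln (2 * A)); have := normr_ge0 (ln (A^-1 * (4^-1) `^ alpha)).
rewrite /K ler_norml; move: (birkhoff psi n xi) (alpha * birkhoff v n xi) (alpha * E) (alpha * ln (b - a)).
move: `|ln (2 * A)| `|ln (A^-1 * (4^-1) `^ alpha)| (ln (2 * A)) (ln (A^-1 * (4^-1) `^ alpha)).
by move=> *; apply/andP; split; lra.
Qed.

Lemma atomic_alpha0 : 0 < seg_mass t t -> alpha = 0.
Proof.
move=> at0; apply/eqP; rewrite eq_le alpha0 andbT leNgt; apply/negP => al0.
have tc : cell (init e) [:: e] t by exact: (coordP ch xi 1).
have [s0 s0c s0t] := cell_nondegenerate ch t (walk_single e).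
(* Once [|s - t|] to the power [alpha] is at most [c], a segment containing the atom has at most
   half its mass. *)
pose c := seg_mass t t / (2 * A).
have c0 : 0 < c by rewrite divr_gt0 ?mulr_gt0.
have d0 : 0 < Num.min eps (c `^ alpha^-1) by rewrite lt_min eps0 powR_gt0.
have ts0 : t != s0 by rewrite eq_sym.
have [s [st + ys]] := exists_near_between ts0 d0; rewrite lt_min => /andP[s1 s2].
have /andP[_ h] := HA (cell_between (walk_single e) tc s0c ys) st s1.
have h2 : seg_mass t t <= seg_mass t s.
  apply: mass_le => // zeta /segP[r + rz]; rewrite minxx maxxx -eq_le => /eqP tr; subst r.
  by apply/segP; exists t; rewrite // ge_min le_max lexx.
have h3 : `|s - t| `^ alpha <= c.
  rewrite -[leRHS]powRr1 ?(ltW c0)// -(@mulVf _ alpha) ?gt_eqF// powRrM.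
  by apply: ge0_ler_powR; rewrite ?nnegrE ?powR_ge0// ltW.
have := le_trans h2 (le_trans h (ler_wpM2l (ltW A0) h3)).
rewrite /c; have -> : A * (seg_mass t t / (2 * A)) = seg_mass t t / 2 by field; rewrite gt_eqF.
lra.
Qed.

(** The coding in the level set need not be [xi]: if the cylinders of [xi] drop below half of the
    mass [c] of the atom, those of the only other coding stay above [c / 2]. Masses between [c / 2]
    and 1 keep [S_n psi] bounded by the Gibbs property, which suffices as [alpha = 0]. *)
Lemma atomic_level : (Iedge e)° (coding xi) -> 0 < seg_mass t t ->
  exists2 zeta, coding zeta = coding xi & level_set psi v alpha zeta.
Proof.
move=> xe at0; have al0 := atomic_alpha0 at0.
pose c := seg_mass t t.
have tt zeta : (coding @^-1` seg t t) zeta -> coding zeta = coding xi.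
  by move=> /segP[r]; rewrite minxx maxxx -eq_le => /eqP <- <-; rewrite -(par_coord ch).
have big zeta N : coding zeta = coding xi ->
    (forall n, (N <= n)%N -> c / 2 <= mass (cylinder (initial_word zeta n))) ->
    level_set psi v alpha zeta.
  move=> zx H; apply: (@level_of_bounded zeta (`|ln (c / 2)| + `|D|) N.+1) => n nN.
  have n0 : (0 < n)%N by exact: leq_trans nN.
  have /andP[g1 g2] := gibbs_mass zeta n0.
  have g3 := le_trans (H n (ltnW nN)) g2.
  have g4 := le_trans g1 (mass_le1 nu (mcyl _)).
  have {}g4 : birkhoff psi n zeta - D <= 0 by rewrite -(@expRK R (_ - D)) -(@ln1 R) ler_ln ?posrE ?expR_gt0.
  have {}g3 : ln (c / 2) <= birkhoff psi n zeta + D.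
    by rewrite -(@expRK R (_ + D)) ler_ln ?posrE ?expR_gt0// divr_gt0.
  rewrite al0 mul0r subr0 ler_norml.
  have := ler_norm (- ln (c / 2)); have := ler_norm D; have := normr_ge0 (ln (c / 2)).
  by rewrite normrN => *; apply/andP; split; lra.
have mono zeta m n : (m <= n)%N -> mass (cylinder (initial_word zeta n)) <=
    mass (cylinder (initial_word zeta m)).
  by move=> mn; apply: mass_le => //; exact: initial_cylinder_sub.
have [H|] := pselect (forall n, (0 <= n)%N -> c / 2 <= mass (cylinder (initial_word xi n))).
  by exists xi => //; apply: big H.
move=> /existsNP[N /not_implyP[_ /negP]]; rewrite -ltNge => HN.
have [zeta zx zxi] : exists2 zeta, coding zeta = coding xi & zeta <> xi.
  apply: contrapT => none.
  have : c <= mass (cylinder (initial_word xi N)).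
    apply: mass_le => // zeta /tt zx; have -> : zeta = xi.
      by apply: contrapT => n; apply: none; exists zeta.
    exact: cylinder_initial_word.
  have : 0 < c by []. lra.
exists zeta => //; apply: (big zeta N) => // n nN.
have : c <= mass (cylinder (initial_word xi n)) + mass (cylinder (initial_word zeta n)).
  apply: mass_leU => // eta /tt ex.
  have [] := @coding_le2 e xi zeta eta xe (esym zx) _; first by rewrite zx ex.
  - by move=> xz; case: zxi.
  - by move=> <-; right; exact: cylinder_initial_word.
  - by move=> <-; left; exact: cylinder_initial_word.
have := mono xi N n nN; lra.
Qed.

End at_a_point.

Lemma UD_level x : UD nu alpha x ->
  exists2 xi, coding xi = x & level_set psi v alpha xi.
Proof.
move=> /(UD_density ch alpha0)[e [t [tx [xi _ xix] xe tc [A [eps [A0 eps0 HA]]]]]].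
subst x; have e0 : e = letter xi 0 by apply: letter_interior; rewrite xix.
have tE : t = coord xi.
  apply: (@par_inj_dom _ _ _ ch (init e)); first exact: cell_dom (walk_single e) tc.
    by rewrite e0; exact: coord_dom.
  by rewrite par_coord.
subst e t.
have := mass_ge0 nu (coding @^-1` seg (coord xi) (coord xi)).
rewrite le_eqVlt => /orP[/eqP at0|at0].
  by exists xi => //; exact: nonatomic_level A0 eps0 HA (esym at0).
have [|zeta zx zl] := atomic_level A0 eps0 HA _ at0; first by rewrite xix.
by exists zeta; rewrite // zx.
Qed.

End UD_level_set.

(** * Neighbouring cells and the inverse of the coding map *)

Section blocks.
Context {R : realType} {k : one_manifold} (Phi : cgdms R k) (ch : charts Phi).
Notation Sigma := (Sigma Phi).
Notation shift := (@left_shift Phi).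
Notation cell := (cell ch).
Notation coord := (coord ch).
Notation coding := (@coding R k Phi).
Notation v := (@geometric_potential R k Phi).
Implicit Types (p q : vertex Phi) (w : seq (edge Phi)) (xi zeta : Sigma).

Lemma geometric_potential_bounded : exists2 m : R, 0 < m & bounded_by m v.
Proof.
have [m h] := geometric_potential_ge ch; exists (`|m| + 1); first by rewrite ltr_wpDl.
move=> xi; have h1 := geometric_potential_le ch xi; have h2 := h xi.
have h3 : ln (slope ch) < 0 by rewrite ln_lt0// slope_itv.
by rewrite ler_norml; have := ler_norm m; move=> ?; apply/andP; split; lra.
Qed.

Lemma coding_lipschitz : exists2 C : R, 0 < C & forall xi zeta,
  mdist (coding xi) (coding zeta) <= C * du (fun x => - v x) xi zeta.
Proof.
have [D D0 width] := cell_width ch.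
have [m m0 vm] := geometric_potential_bounded.
have [E E0 vE] := geometric_potential_distortion ch.
have [B B0 HB] := finite_ubound (fun p => `|lo ch p| + `|hi ch p|).
have coordB xi : `|coord xi| <= B.
  have /andP[h1 h2] := coord_dom ch xi; apply: le_trans (HB (start xi)).
  have := ler_norm (- lo ch (start xi)); have := ler_norm (hi ch (start xi)); rewrite normrN.
  have := normr_ge0 (lo ch (start xi)); have := normr_ge0 (hi ch (start xi)).
  by move=> *; rewrite ler_norml; apply/andP; split; lra.
exists (B + B + expR D); first by rewrite addr_gt0 ?expR_gt0// addr_gt0.
move=> xi zeta; have [->|ne] := pselect (xi = zeta).
  by rewrite mdistxx /du asboolT// mulr0.
rewrite duE// -!(par_coord ch) /meet.
have [E1 _] := meet_lengthP ne; set n := meet_length xi zeta in E1 *.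
have := sup_birkhoff_bounds vm vE (cylinder_initial_word xi n).
rewrite size_initial_word => /andP[h1 _].
apply: (le_trans (par_lipschitz _ _)).
(* Without a common letter the sequences may start in different charts; the bound [B] on all
   coordinates suffices, because [du] is then at least 1. *)
have [n0|n0] := posnP n.
  rewrite n0 birkhoff0 -n0 in h1.
  have : 1 <= expR (sup_birkhoff v (initial_word xi n)) by rewrite -expR0 ler_expR.
  set X := expR _ => X1.
  apply: (@le_trans _ _ (B + B)).
    by rewrite (le_trans (ler_normB _ _))// lerD.
  have := expR_gt0 D; move: (expR D) => Y Y0.
  apply: (@le_trans _ _ (B + B + Y)); first by lra.
  by rewrite ler_peMr//; lra.
have [w1 _] := width xi n.
have zn : cell (start xi) (initial_word xi n) (coord zeta).
  apply: (cylinder_coord ch (walk_initial_word xi n) _ _).2.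
    by rewrite -size_eq0 size_initial_word -lt0n.
  by rewrite E1; exact: cylinder_initial_word.
apply: (le_trans (w1 _ _ (coordP ch xi n) zn)).
rewrite addrC expRD ler_pM ?expR_ge0 ?ler_expR//.
by rewrite lerDr addr_ge0// ltW.
Qed.

Variables (q : vertex Phi) (a th b : seq (edge Phi)).
Hypothesis fl : flanked ch q a th b.
Hypothesis a0 : a != [::].
Hypothesis b0 : b != [::].

(* A cell around [coord xi] has, on each side of this point, a whole subcell
   of comparable size, namely the one of [w]. *)
Definition side_cell (K : R) (f : Sigma -> R) xi j w :=
  [/\ walk (start xi) w, w != [::],
      (forall y, cell (start xi) w y -> cell (start xi) (initial_word xi j) y),
      (exists y z, [/\ cell (start xi) w y, cell (start xi) w z &
         expR (birkhoff v j xi - K) <= z - y]) &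
      (exists2 zeta, cylinder w zeta &
         birkhoff f j xi - K <= birkhoff f (size w) zeta)].

(** Putting [a] and [b] in place of [th] at time [j] gives the two cells. As these words are fixed,
    only a bounded part is added to the sums; which cell lies on the left depends on the orientation
    of the preceding lift. *)
Lemma side_cells (f : Sigma -> R) (Mf Df : R) : bounded_by Mf f -> bounded_distortion Df f ->
  exists2 K : R, 0 < K & forall xi j,
  cylinder th (iter j shift xi) -> start (iter j shift xi) = q ->
  exists wl wr, [/\ side_cell K f xi j wl, side_cell K f xi j wr,
    forall y, cell (start xi) wl y -> y <= coord xi &
    forall y, cell (start xi) wr y -> coord xi <= y].
Proof.
move=> fM fD.
have [D D0 width] := cell_width ch.
have [m m0 vm] := geometric_potential_bounded.
have [E E0 vE] := geometric_potential_distortion ch.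
pose S : R := (size a + size b)%:R.
have Mf0 := bounded_by_ge0 fM.
have Df0 := bounded_distortion_ge0 fD.
have S0 : 0 <= S by exact: ler0n.
pose K := D + E + m * S + Df + Mf * S.
have mS : 0 <= m * S by rewrite mulr_ge0// ltW.
have MS : 0 <= Mf * S by rewrite mulr_ge0.
exists K; first by rewrite /K; lra.
move=> xi j thj sj.
have uq : walk_end (start xi) (initial_word xi j) = q.
  by rewrite walk_end_initial_word.
have pu := walk_initial_word xi j.
have side c : walk q c -> (size c <= size a + size b)%N -> c != [::] ->
    side_cell K f xi j (initial_word xi j ++ c).
  move=> qc sc c0; set w := _ ++ c.
  have pw : walk (start xi) w by rewrite walk_cat pu uq.
  have sw : size w = (j + size c)%N by rewrite size_cat size_initial_word.
  have w0 : w != [::] by rewrite -size_eq0 sw addn_eq0 negb_and size_eq0 c0 orbT.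
  have [zeta wz sz] := walk_cylinder pw.
  have uz : initial_word xi j = initial_word zeta j.
    by have /cylinder_cat[+ _] := wz; rewrite /cylinder/= size_initial_word.
  have scS : (size c)%:R <= S by rewrite /S ler_nat.
  have wE : initial_word zeta (size w) = w by [].
  split=> //.
  - by move=> y; exact: cell_catl.
  - have [_ [y [z [yw zw yz]]]] := width zeta (size w).
    rewrite wE sz in yw zw.
    have h1 := birkhoff_cat_dist (size c) vm vE uz; rewrite -sw in h1.
    have h2 : expR (birkhoff v j xi - K) <= `|y - z|.
      apply: le_trans yz; rewrite ler_expR; move: h1; rewrite ler_norml => /andP[h1 _].
      have := ler_wpM2l (ltW m0) scS; rewrite /K; lra.
    have [yz'|zy'] := leP y z.
      by exists y, z; split=> //; rewrite distrC ger0_norm ?subr_ge0// in h2.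
    by exists z, y; split=> //; rewrite gtr0_norm ?subr_gt0// in h2.
  - exists zeta => //; have := birkhoff_cat_dist (size c) fM fD uz; rewrite -sw.
    rewrite ler_norml => /andP[h1 _].
    have := ler_wpM2l Mf0 scS; rewrite /K; lra.
have [qa qt qb _ _] := fl.
have sa := side a qa (leq_addr _ _) a0; have sb := side b qb (leq_addl _ _) b0.
have xt : cell (start xi) (initial_word xi j ++ th) (coord xi).
  rewrite -[X in _ ++ X]thj -initial_wordD; exact: coordP.
have [[_ _ _ h1 h2]|[_ _ _ h1 h2]] := flanked_cat pu uq fl.
  by exists (initial_word xi j ++ a), (initial_word xi j ++ b); split=> // y yc; auto.
by exists (initial_word xi j ++ b), (initial_word xi j ++ a); split=> // y yc; auto.
Qed.

Lemma flanked_inside xi j r : cylinder th (iter j shift xi) ->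
  start (iter j shift xi) = q -> cell (start xi) (initial_word xi (j + size th)) r ->
  exists y1 y2, [/\ cell (start xi) (initial_word xi j) y1,
    cell (start xi) (initial_word xi j) y2 & y1 < r < y2].
Proof.
move=> thj sj; rewrite initial_wordD thj => rc.
have pu := walk_initial_word xi j.
have uq : walk_end (start xi) (initial_word xi j) = q by rewrite walk_end_initial_word.
have [f|f] := flanked_cat pu uq fl; have [y1 [y2 [c1 c2 yy]]] := flanked_strict f rc;
  exists y1, y2; split=> //; have [w1 w2 w3 _ _] := f;
  by [exact: cell_catl c1|exact: cell_catl c2].
Qed.

Lemma recurrent_inside N xi n : recurrent q th N xi ->
  exists y1 y2, [/\ cell (start xi) (initial_word xi n) y1,
    cell (start xi) (initial_word xi n) y2 & y1 < coord xi < y2].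
Proof.
move=> rec; have [j [/andP[nj _] thj sj]] := rec n.
have [y1 [y2 [c1 c2 yy]]] := flanked_inside thj sj (coordP ch xi _).
by exists y1, y2; split=> //; apply: (cell_initial_word_sub nj).
Qed.

(** Take a time [j] beyond the meet length [n], with [j - n] bounded, at which [th] is read. The
    coordinate of [zeta] is not inside the cell of [xi] of generation [j], so a whole side cell
    separates the two coordinates, and its size is comparable to [exp (S_n v)]. *)
Lemma coding_bilipschitz N : exists2 C : R, 0 < C & forall xi zeta, start xi = start zeta ->
  recurrent q th N xi -> du (fun x => - v x) xi zeta <= C * mdist (coding xi) (coding zeta).
Proof.
have [m m0 vm] := geometric_potential_bounded.
have [E E0 vE] := geometric_potential_distortion ch.
have [K K0 sides] := side_cells vm vE.
have [c c0 Hc] := par_lower ch.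
pose Q := E + K + m * N.+1%:R.
exists (c^-1 * expR Q); first by rewrite mulr_gt0 ?invr_gt0 ?expR_gt0.
move=> xi zeta sxz rec; have [->|ne] := pselect (xi = zeta).
  by rewrite mdistxx /du asboolT// mulr0.
rewrite duE// -!(par_coord ch) /meet.
set n := meet_length xi zeta.
have [j [/andP[nj jN] thj sj]] := rec n.+1.
have [wl [wr [Sl Sr hl hr]]] := sides xi j thj sj.
have W := walk_initial_word xi j.
have out y z : cell (start xi) (initial_word xi j) y -> cell (start xi) (initial_word xi j) z ->
    ~ (y < coord zeta < z).
  move=> yc zc yz; have := coding_interior W yc zc yz (par_coord ch zeta).
  rewrite /cylinder/= size_initial_word => /esym/(le_meet_length ne).
  by rewrite leqNgt nj.
have dist : expR (birkhoff v j xi - K) <= `|coord xi - coord zeta|.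
  have [zx|xz] := leP (coord zeta) (coord xi).
    have [pl _ sub [y [z [yc zc yz]]] _] := Sl.
    suff zy : coord zeta <= y.
      by have := hl _ zc; rewrite ger0_norm ?subr_ge0//; lra.
    (* A point of the cell beyond [coord xi] shows that [coord zeta] would be inside the cell. *)
    have [r1 [r2 [r1c r2c /andP[r1x xr2]]]] := recurrent_inside j rec.
    rewrite leNgt; apply/negP => yzeta.
    by apply: (out y r2 (sub _ yc) r2c); rewrite yzeta (le_lt_trans zx).
  have [pr _ sub [y [z [yc zc yz]]] _] := Sr.
  suff zy : z <= coord zeta.
    by have := hr _ yc; rewrite ltr0_norm ?subr_lt0//; lra.
  have [r1 [r2 [r1c r2c /andP[r1x xr2]]]] := recurrent_inside j rec.
  rewrite leNgt; apply/negP => yzeta.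
  by apply: (out r1 z r1c (sub _ zc)); rewrite yzeta (lt_trans r1x).
have mge := Hc (start xi) _ _ (coord_dom ch xi); rewrite sxz in mge.
have {}mge := mge _ (coord_dom ch zeta).
rewrite -mulrA ler_pdivlMl//.
have := sup_birkhoff_bounds vm vE (cylinder_initial_word xi n).
rewrite size_initial_word => /andP[_ h1].
have h2 : birkhoff v n xi - m * N.+1%:R <= birkhoff v j xi.
  have : (n <= j <= n + N.+1)%N by rewrite (ltnW nj)/= addnS -addSn.
  by move=> /(birkhoff_dist_le xi vm); rewrite ler_norml => /andP[h _]; lra.
apply: (@le_trans _ _ (expR Q * (c * expR (birkhoff v j xi - K)))).
  rewrite mulrCA ler_pM2l// -expRD ler_expR /Q; lra.
by rewrite ler_pM2l ?expR_gt0// (le_trans _ mge)// ler_pM2l.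
Qed.

End blocks.

(** * From recurrent codings with bounded sums to [UD] *)

Section recurrent_UD.
Context {R : realType} {k : one_manifold} (Phi : cgdms R k) (ch : charts Phi).
Variable nu : probability (@borel_Sigma R Phi) R.
Notation Sigma := (Sigma Phi).
Notation bS := (@borel_Sigma R Phi).
Notation cell := (cell ch).
Notation coord := (coord ch).
Notation coding := (@coding R k Phi).
Notation v := (@geometric_potential R k Phi).
Notation mass := (mass nu).
Notation seg_mass := (seg_mass nu).
Variables (q : vertex Phi) (a th b : seq (edge Phi)).
Hypothesis fl : flanked ch q a th b.
Hypothesis a0 : a != [::].
Hypothesis b0 : b != [::].
Variables (psi : Sigma -> R) (alpha Dg Mp Dp B : R).
Hypothesis alpha0 : 0 <= alpha.
Hypothesis gibbsD : forall xi n, (0 < n)%N ->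
  ((expR (birkhoff psi n xi - Dg))%:E <= nu (cylinder (initial_word xi n)) <=
   (expR (birkhoff psi n xi + Dg))%:E)%E.
Hypothesis psiM : bounded_by Mp psi.
Hypothesis psiD : bounded_distortion Dp psi.
Variables (N : nat) (xi : Sigma).
Hypothesis rec : recurrent q th N xi.
Hypothesis xiB : forall n, `|birkhoff psi n xi - alpha * birkhoff v n xi| <= B.

Let mcyl w : measurable (cylinder w : set bS).
Proof. exact: measurable_cylinder. Qed.

Let mseg t s : measurable (coding @^-1` seg t s : set bS).
Proof. exact: (measurable_seg ch). Qed.

Let t := coord xi.
Let p := start xi.

(** The point [s] leaves the cells of [xi] at generation [n.+1], so it is outside the cell at the
    next reading time [j] of [th], and the segment from [t] to [s] contains a whole side cell. *)
Lemma recurrent_distances : exists C : R, forall s n,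
  cell p (initial_word xi n) s -> ~ cell p (initial_word xi n.+1) s ->
  [/\ `|s - t| <= expR (birkhoff v n xi + C), expR (birkhoff v n xi - C) <= `|s - t| &
      expR (birkhoff psi n xi - C) <= seg_mass t s].
Proof.
have [D D0 width] := cell_width ch.
have [m m0 vm] := geometric_potential_bounded ch.
have [K K0 sides] := side_cells fl a0 b0 psiM psiD.
have Mp0 := bounded_by_ge0 psiM.
have Dg0 : 0 <= `|Dg| by [].
have mN : 0 <= m * N.+1%:R by rewrite mulr_ge0// ltW.
have MN : 0 <= Mp * N.+1%:R by rewrite mulr_ge0.
exists (D + K + `|Dg| + m * N.+1%:R + Mp * N.+1%:R) => s n sn sn1.
have [j [/andP[nj jN] thj sj]] := rec n.+1.
have [wl [wr [Sl Sr hl hr]]] := sides xi j thj sj.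
have W := walk_initial_word xi j.
have sj' : ~ cell p (initial_word xi j) s by move/(cell_initial_word_sub nj).
have njN : (n <= j <= n + N.+1)%N by rewrite (ltnW nj)/= addnS -addSn.
have v1 : birkhoff v n xi - m * N.+1%:R <= birkhoff v j xi.
  by have := birkhoff_dist_le xi vm njN; rewrite ler_norml => /andP[? _]; lra.
have p1 : birkhoff psi n xi - Mp * N.+1%:R <= birkhoff psi j xi.
  by have := birkhoff_dist_le xi psiM njN; rewrite ler_norml => /andP[? _]; lra.
have mass_w w : side_cell ch K psi xi j w -> expR (birkhoff psi j xi - K - `|Dg|) <= mass (cylinder w).
  move=> [pw w0 _ _ [zeta wz hz]].
  have sw : (0 < size w)%N by rewrite lt0n size_eq0.
  have := gibbs_mass gibbsD zeta sw; rewrite (_ : initial_word zeta (size w) = w)// => /andP[h _].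
  by apply: le_trans h; rewrite ler_expR; have := ler_norm Dg; lra.
have seg_w w : side_cell ch K psi xi j w ->
    (forall y, cell p w y -> Num.min t s <= y <= Num.max t s) ->
    mass (cylinder w) <= seg_mass t s.
  move=> [pw w0 _ _ _] sub; apply: mass_le => // zeta wz.
  have [_ zc] := cylinder_coord ch pw w0 wz.
  by apply/segP; exists (coord zeta); [exact: sub|rewrite par_coord].
split.
- have [w1 _] := width xi n; apply: (le_trans (w1 _ _ sn (coordP ch xi n))).
  rewrite ler_expR; lra.
- apply: (@le_trans _ _ (expR (birkhoff v j xi - K))); first by rewrite ler_expR; lra.
  have tj : cell p (initial_word xi j) t by exact: coordP.
  have [ts|st] := leP t s.
    have [_ _ sub [y [z [yc zc yz]]] _] := Sr.
    suff zs : z <= s by have := hr _ yc; rewrite -/t ger0_norm ?subr_ge0//; lra.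
    rewrite leNgt; apply/negP => sz; apply: sj'.
    by apply: (cell_itv W tj (sub _ zc)); rewrite ts ltW.
  have [_ _ sub [y [z [yc zc yz]]] _] := Sl.
  suff sy : s <= y by have := hl _ zc; rewrite -/t ltr0_norm ?subr_lt0//; lra.
  rewrite leNgt; apply/negP => ys; apply: sj'.
  by apply: (cell_itv W (sub _ yc) tj); rewrite (ltW ys) ltW.
apply: (@le_trans _ _ (expR (birkhoff psi j xi - K - `|Dg|))).
  by rewrite ler_expR; lra.
have tj : cell p (initial_word xi j) t by exact: coordP.
have [ts|/ltW st] := leP t s.
  apply: (le_trans (mass_w _ Sr)); apply: seg_w => // y yc; rewrite min_l// max_r//.
  rewrite (hr _ yc)/= leNgt; apply/negP => sy; apply: sj'.
  have [_ _ sub _ _] := Sr.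
  by apply: (cell_itv W tj (sub _ yc)); rewrite ts ltW.
apply: (le_trans (mass_w _ Sl)); apply: seg_w => // y yc; rewrite min_r// max_l//.
rewrite (hl _ yc) andbT leNgt; apply/negP => ys; apply: sj'.
have [_ _ sub _ _] := Sl.
by apply: (cell_itv W (sub _ yc) tj); rewrite (ltW ys).
Qed.

(** Points of the segment may be ends of the cell of generation [n], with codings that leave it. But
    [th] was read at an earlier time [j] with [j + size th <= n], so the segment is inside the cell
    of generation [j], and all these codings share the first [j] letters. *)
Lemma recurrent_mass_le : exists C : R, forall s n, (N + size th < n)%N ->
  cell p (initial_word xi n) s -> seg_mass t s <= expR (birkhoff psi n xi + C).
Proof.
have Mp0 := bounded_by_ge0 psiM.
exists (Dg + Mp * (N + size th)%:R) => s n nN sn.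
pose i := (n - (N + size th))%N.
have i0 : (0 < i)%N by rewrite subn_gt0.
have [j [/andP[ij jN] thj sj]] := rec i.
have j0 : (0 < j)%N by exact: leq_trans ij.
have jn : (j + size th <= n)%N.
  by rewrite -(subnK (ltnW nN)) -/i addnA leq_add2r.
have jle : (j <= n <= j + (N + size th))%N.
  rewrite (leq_trans (leq_addr _ _) jn)/= -(subnK (ltnW nN)) -/i leq_add2r//.
have := gibbs_mass gibbsD xi j0 => /andP[_ gj].
apply: (@le_trans _ _ (mass (cylinder (initial_word xi j)))); last first.
  apply: (le_trans gj); rewrite ler_expR.
  by have := birkhoff_dist_le xi psiM jle; rewrite ler_norml => /andP[? _]; lra.
apply: mass_le => // zeta /segP[r rts rz].
have rc : cell p (initial_word xi n) r.
  have Wn := walk_initial_word xi n.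
  by move: rts; case: (leP t s) => _ /(cell_itv Wn); apply=> //; exact: coordP.
have [y1 [y2 [c1 c2 yy]]] := flanked_inside fl thj sj (cell_initial_word_sub jn rc).
exact: (coding_interior (walk_initial_word xi j) c1 c2 yy rz).
Qed.

Lemma recurrent_UD : UD nu alpha (coding xi).
Proof.
have [C1 H1] := recurrent_distances.
have [C2 H2] := recurrent_mass_le.
have [m m0 vm] := geometric_potential_bounded ch.
have [L L0 HL] := diam_ex ch.
have [y1 [y2 [c1 c2 yy]]] := recurrent_inside fl 1 rec.
(* The first summand serves the upper bound on the mass, the second the lower one. *)
pose A := expR (B + C2 + alpha * C1) + expR (B + C1 + alpha * C1).
have A0 : 0 < A by rewrite addr_gt0 ?expR_gt0.
(* At smaller distances the generation [n] exceeds [N + size th], as [recurrent_mass_le]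
   requires. *)
pose eps := expR (- (m * (N + size th)%:R) - C1).
apply: (density_UD alpha0 c1 c2 yy A0 (expR_gt0 _ : 0 < eps)) => s sc st sl.
have [n sn sn1] : exists2 n, cell p (initial_word xi n) s & ~ cell p (initial_word xi n.+1) s.
  have ex : exists n, `[< ~ cell p (initial_word xi n) s >].
    have s0 : 0 < `|s - t| by rewrite normr_gt0 subr_eq0.
    have [n hn] := geometric_small ch L s0; exists n; apply/asboolP => sn.
    have := cell_dist_le (walk_initial_word xi n) HL sn (coordP ch xi n).
    by rewrite size_initial_word leNgt -/t hn.
  have [n /asboolP nn min] := ex_minnP ex.
  (* Generation 0 cannot be the first one left, since [s] lies in the cell of the first letter. *)
  case: n nn min => [|n] nn min.
    by case: nn; exact: (@cell_initial_word_sub _ _ _ ch xi 0 1).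
  exists n => //; apply: contrapT => h.
  by have := min n; rewrite ltnn => /(_ (asboolT h)).
have [d1 d2 d3] := H1 s n sn sn1.
have nbig : (N + size th < n)%N.
  rewrite ltnNge; apply/negP => nle; move: sl; apply/negP; rewrite -leNgt.
  apply: le_trans d2; rewrite /eps ler_expR lerD2r.
  have := norm_birkhoff_le n xi vm; rewrite ler_norml => /andP[h _]; apply: le_trans h.
  by rewrite lerN2 ler_pM2l// ler_nat.
have d4 := H2 s n nbig sn.
have s0 : 0 < `|s - t| by rewrite normr_gt0 subr_eq0.
have powE : `|s - t| `^ alpha = expR (alpha * ln `|s - t|) by rewrite /powR gt_eqF.
have l1 : alpha * ln `|s - t| <= alpha * (birkhoff v n xi + C1).
  by rewrite ler_wpM2l// -(@expRK R (_ + C1)) ler_ln ?posrE ?expR_gt0.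
have l2 : alpha * (birkhoff v n xi - C1) <= alpha * ln `|s - t|.
  by rewrite ler_wpM2l// -(@expRK R (_ - C1)) ler_ln ?posrE ?expR_gt0.
rewrite !mulrDr ?mulrN in l1 l2.
have := xiB n; rewrite ler_norml => /andP[b1 b2].
apply/andP; split.
  apply: le_trans d3; rewrite powE ler_pdivrMl//.
  apply: (@le_trans _ _ (expR (B + C1 + alpha * C1) * expR (birkhoff psi n xi - C1))).
    by rewrite -expRD ler_expR; lra.
  by rewrite ler_pM2r ?expR_gt0// lerDr expR_ge0.
apply: (le_trans d4); rewrite powE.
apply: (@le_trans _ _ (expR (B + C2 + alpha * C1) * expR (alpha * ln `|s - t|))).
  by rewrite -expRD ler_expR; lra.
by rewrite ler_pM2r ?expR_gt0// lerDl expR_ge0.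
Qed.

End recurrent_UD.

Theorem theorem1p6 (R : realType) (k : one_manifold) (Phi : cgdms R k)
    (psi : Sigma Phi -> R) (nu : probability (@borel_Sigma R Phi) R) :
  hoelder_on d1 setT psi -> pressure psi = 0 -> gibbs psi nu ->
  let v : Sigma Phi -> R := geometric_potential (Phi := Phi) in
  let u : Sigma Phi -> R := fun xi => - v xi in
  forall alpha : R, 0 <= alpha ->
    alpha%:E <> alpha_minus psi v -> alpha%:E <> alpha_plus psi v ->
    hausdorff_dim mdist (UD nu alpha) =
    hausdorff_dim (du u) (level_set psi v alpha).
Proof.
move=> psiH psi0 psiG v u alpha alpha0 am ap.
have [ch] := charts_exist Phi.
have [[Mp Mp0 psiM] [Dp Dp0 psiD]] := hoelder_d1_regular psiH.
have [Dg Dg0 gibbsD] := gibbs_cylinder psiH psi0 psiG.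
have [Dv Dv0 vD] := geometric_potential_distortion ch.
have [Mv Mv0 vM] := geometric_potential_bounded ch.
have m0 : 0 < - ln (slope ch) by rewrite oppr_gt0 ln_lt0// slope_itv.
have vm z : v z <= - - ln (slope ch) by rewrite opprK; exact: (geometric_potential_le ch).
have duxx (xi : Sigma Phi) : 0 <= du u xi xi by exact: du_ge0.
have mxx (x : M1 R k) : 0 <= mdist x x by exact: mdist_ge0.
apply/eqP; rewrite eq_le; apply/andP; split.
  have [C C0 lip] := coding_lipschitz ch.
  apply: le_ereal_inf_tmp => _ [s [s0 Hs] <-]; apply: ereal_inf_lbound.
  exists s => //; split=> //.
  (* A section of [coding] over [UD], along which covers of the level set are pulled back. *)
  have sec (x : M1 R k) : exists xi : Sigma Phi, UD nu alpha x -> coding xi = x /\ level_set psi v alpha xi.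
    have [xU|nU] := pselect (UD nu alpha x); last by exists point.
    by have [xi xix xil] := UD_level ch alpha0 gibbsD xU; exists xi.
  have [g gP] := choice sec.
  apply: (hausdorff_measure0_transfer s0 C0 duxx mxx (g := g) _ _ Hs).
    by move=> x /gP[].
  move=> x y /gP[gx _] /gP[gy _]; rewrite -{1}gx -{1}gy; exact: lip.
have pos r : 0 < r -> (r%:E < hausdorff_dim (du u) (level_set psi v alpha))%E ->
    hausdorff_measure mdist r (UD nu alpha) <> 0%E.
  move=> r0 rdim.
  have [s rs sdim] : exists2 s, r < s & (s%:E < hausdorff_dim (du u) (level_set psi v alpha))%E.
    move: rdim; case: (hausdorff_dim _ _) => [l| |//].
      by rewrite lte_fin => rl; exists ((r + l) / 2); rewrite ?lte_fin; lra.
    by move=> _; exists (r + 1); rewrite ?ltry//; lra.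
  have Hs := hausdorff_dim_gt_measure (ltW (lt_trans r0 rs)) sdim.
  have Lne : level_set psi v alpha !=set0.
    by apply/set0P/eqP => L0; apply: Hs; rewrite L0; exact: hausdorff_measure_set0.
  have [above below] := unbounded_both m0 vm Lne am ap.
  pose T q th := exists a b, [/\ flanked ch q a th b, a != [::] & b != [::]].
  have HT q w1 w2 w3 : distinct_walks q w1 w2 w3 -> exists2 th, walk q th & T q th.
    move=> [[W1 W2 W3] [w10 s12 s23] [n12 n23 n13]].
    have w20 : w2 != [::] by rewrite -size_eq0 -s12 size_eq0.
    have w30 : w3 != [::] by rewrite -size_eq0 -s23 size_eq0.
    have [a [th [b [fl a0 _ b0]]]] := exists_flanked ch (P := fun w => w != [::])
      W1 W2 W3 s12 s23 n12 n23 n13 w10 w20 w30.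
    by exists th; [case: fl|exists a, b].
  have [q [th [N [B [K [[a [b [fl a0 b0]]] HK KP]]]]]] :=
    symbolic_tree m0 vm vM vD psiM psiD r0 rs Hs HT above below.
  move=> HUD; apply: HK.
  have [C C0 bil] := coding_bilipschitz fl a0 b0 N.
  apply: (hausdorff_measure0_transfer (ltW r0) C0 mxx duxx (g := @coding R k Phi) _ _ HUD).
    move=> xi /KP[_ rec xiB].
    exact: (recurrent_UD fl a0 b0 alpha0 gibbsD psiM psiD rec xiB).
  move=> xi zeta /KP[sx rec _] /KP[sz _ _].
  by apply: bil => //; rewrite sx sz.
apply: le_ereal_inf_tmp => _ [r [r0 Hr] <-]; rewrite leNgt; apply/negP => rdim.
(* At exponent 0, vanishing measure means that [UD] is empty; its measure then vanishes also for a
   positive exponent below the dimension, against [pos]. *)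
move: r0; rewrite le_eqVlt => /orP[/eqP r0|r0]; last exact: (pos r).
rewrite -r0 in Hr rdim.
have [r' r'0 r'dim] : exists2 r', 0 < r' & (r'%:E < hausdorff_dim (du u) (level_set psi v alpha))%E.
  move: rdim; case: (hausdorff_dim _ _) => [l| |//].
    by rewrite lte_fin => rl; exists (l / 2); rewrite ?lte_fin; lra.
  by move=> _; exists 1; rewrite ?ltry//; lra.
apply: (pos r') => //; rewrite (hausdorff_measure_0_set0 Hr).
exact: hausdorff_measure_set0.
Qed.
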